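(* Let $g(x)=\sum_{k=1}^N\frac{a_k}{x-iw_k}$ with $a_k,w_k\in\mathbb{C}$, $a_k\ne0$, $\Re w_k\neq 0$, and $\Re w_k\neq\Re w_l$ for $k\neq l$. Then for $\alpha,\beta>0$, the system $\mathcal{G}(g;\alpha,\beta)$ is complete in $L^2(\mathbb{R})$ if and only if $\alpha\beta\le 1$.
   Context: $\mathcal{G}(g;\alpha,\beta)=\{e^{2\pi i\beta n t}g(t-\alpha m)\}_{m,n\in\mathbb{Z}}$. A system is complete in $L^2(\mathbb{R})$ if its closed linear span is $L^2(\mathbb{R})$. *)

(* Defs.v *)
From HB Require Import structures.
From mathcomp Require Import all_boot all_order all_algebra.
From mathcomp Require Import all_classical all_reals all_analysis.
From mathcomp Require Import complex.

Set Implicit Arguments.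
Unset Strict Implicit.
Unset Printing Implicit Defensive.

Import Order.TTheory GRing.Theory Num.Theory.
Local Open Scope ring_scope.

Section Gabor.
Variable R : realType.

Definition sqmod (z : R[i]) : R := (complex.Re z) ^+ 2 + (complex.Im z) ^+ 2.

Definition expi (x : R) : R[i] := Complex (cos x) (sin x).

Definition gfun (N : nat) (a w : 'I_N -> R[i]) (x : R) : R[i] :=
  \sum_(k < N) a k / (Complex x 0 - Complex 0 1 * w k).

Definition gabor (g : R -> R[i]) (alpha beta : R) (m n : int) (t : R) : R[i] :=
  expi (2 * pi * beta * n%:~R * t) * g (t - alpha * m%:~R).

Definition L2 (f : R -> R[i]) : Prop :=
  measurable_fun setT (fun x => complex.Re (f x)) /\
  measurable_fun setT (fun x => complex.Im (f x)) /\
  (\int[@lebesgue_measure R]_x (sqmod (f x))%:E < +oo)%E.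

Definition lincomb (G : int -> int -> R -> R[i]) (s : seq (int * int * R[i])) (t : R) : R[i] :=
  \sum_(p <- s) p.2 * G p.1.1 p.1.2 t.

Definition complete_L2 (G : int -> int -> R -> R[i]) : Prop :=
  forall f : R -> R[i], L2 f ->
  forall eps : R, 0 < eps ->
  exists s : seq (int * int * R[i]),
    (\int[@lebesgue_measure R]_x (sqmod (f x - lincomb G s x))%:E < eps%:E)%E.

End Gabor.

(* Main.v *)
Require Import Defs.
From HB Require Import structures.
From mathcomp Require Import all_boot all_order all_algebra.
From mathcomp Require Import all_classical all_reals all_analysis.
From mathcomp Require Import complex measurable_realfun.
From mathcomp Require Import ring lra zify.
Import Order.TTheory GRing.Theory Num.Theory.
Import numFieldNormedType.Exports.
Local Open Scope ring_scope.

Set Implicit Arguments.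
Unset Strict Implicit.
Unset Printing Implicit Defensive.

Local Notation Re := complex.Re.
Local Notation Im := complex.Im.
Local Notation "x %:C" := (real_complex _ x) : ring_scope.

(* If alpha beta > 1, put p = 1 / beta and c = min (alpha, 2 p) > p. As c <= alpha,
   the Gabor atoms built on the indicators of [0, p) and [p, c), scaled by
   sqrt beta, together form a Bessel family of bound 1; their squared norms add up
   to c / p > 1 per index (m, n). If the system were complete, both indicators
   would be close to combinations of finitely many atoms of g, so the atoms with
   indices up to r would be close to the span of (2 r + O(1))^2 atoms of g;
   comparing traces for large r is a contradiction.

   If alpha beta <= 1, decompose the line into the fibers t + p Z. It suffices to
   find, for each t, a finite combination of translates of g whose restriction to
   the fiber is close in l^2 to the delta at t: by compactness finitely many such
   combinations, multiplied by p-periodic functions, then reproduce a bounded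
   function supported in one cell, and the periodic factors are approximated by
   trigonometric polynomials. Since 1 / (t + k - alpha m - i w) is, up to an
   explicit factor, the k-th Fourier coefficient of an exponential on [0, 1), the
   claim on the fiber says that the constant 1 lies in the closure of the image of
   trigonometric polynomials of period gam = 1 / (alpha beta) >= 1 under an operator
   b |-> sum_k B_k(x) b(x + k) whose coefficients B_k are exponential sums. This
   equation is solved explicitly with bounded gam-periodic b, off a countable set
   of zeros of a determinant that is an exponential sum. *)

(** * Squared moduli and complex exponentials *)

(** Scale [p] to 1 and put [m j = exp (2 pi (w j + i t))], [omega = exp (2 i pi q / gam)]. The
    Fourier coefficients hide denominators [m j omega - 1]. Multiplying the coefficient of the
    [q]-th translate by the product of all [m l omega - 1] clears them; otherwise the operator on
    [b] would involve infinitely many shifts. Distinctness of the [Re (w j)] serves twice: one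
    exponential dominates at +oo, so the determinants are nonzero exponential sums, and the [m l]
    have distinct moduli, so the powers of the [1 / m l] span along any infinite set of exponents.
    If gam > 1, the orbit of a point of R / gam Z under x |-> x - 1 leaves [0, 1[ infinitely often,
    and no equation is imposed there; this freedom makes up for the length of the filter. The number
    of steps needed depends on the point, hence the splitting by visit patterns and a limit. If gam
    = 1 there is no freedom, the equation is scalar, and [Re (w j) != 0] keeps it solvable. If alpha
    beta > 1, the boxes on [0, p) alone have squared norm 1 per index, exactly what one atom of [g]
    per index can match; the piece [p, c) creates the excess. *)

Section ComplexNumbers.
Variable R : realType.
Local Notation C := R[i].
Implicit Types (x y z : C) (s t : R).

Lemma complexP x y : Re x = Re y -> Im x = Im y -> x = y.
Proof. by case: x y => [a b] [c d] /= -> ->. Qed.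

Lemma cReD x y : Re (x + y) = Re x + Re y. Proof. by case: x y => [? ?] []. Qed.
Lemma cImD x y : Im (x + y) = Im x + Im y. Proof. by case: x y => [? ?] []. Qed.
Lemma cReN x : Re (- x) = - Re x. Proof. by case: x. Qed.
Lemma cImN x : Im (- x) = - Im x. Proof. by case: x. Qed.
Lemma cReM x y : Re (x * y) = Re x * Re y - Im x * Im y.
Proof. by case: x y => [? ?] []. Qed.
Lemma cImM x y : Im (x * y) = Re x * Im y + Im x * Re y.
Proof. by case: x y => [? ?] []. Qed.
Definition ReImE := (cReD, cImD, cReN, cImN, cReM, cImM).

Lemma Re_sum I (r : seq I) (P : pred I) (F : I -> C) :
  Re (\sum_(i <- r | P i) F i) = \sum_(i <- r | P i) Re (F i).
Proof. exact: (big_morph (@complex.Re R) cReD erefl). Qed.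

Lemma Im_sum I (r : seq I) (P : pred I) (F : I -> C) :
  Im (\sum_(i <- r | P i) F i) = \sum_(i <- r | P i) Im (F i).
Proof. exact: (big_morph (@complex.Im R) cImD erefl). Qed.

Lemma sqmod_ge0 x : 0 <= sqmod x.
Proof. by rewrite /sqmod addr_ge0// sqr_ge0. Qed.

Lemma sqmod0 : sqmod (0 : C) = 0.
Proof. by rewrite /sqmod/= expr0n/= addr0. Qed.

Lemma sqmod1 : sqmod (1 : C) = 1.
Proof. by rewrite /sqmod/= expr0n/= addr0 expr1n. Qed.

Lemma sqmodM x y : sqmod (x * y) = sqmod x * sqmod y.
Proof. by rewrite /sqmod !ReImE; ring. Qed.

Lemma sqmodN x : sqmod (- x) = sqmod x.
Proof. by rewrite /sqmod !ReImE !sqrrN. Qed.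

Lemma sqmodX x n : sqmod (x ^+ n) = sqmod x ^+ n.
Proof. by elim: n => [|n IH]; rewrite ?expr0 ?sqmod1// !exprS sqmodM IH. Qed.

Lemma sqmodR s : sqmod s%:C = s ^+ 2.
Proof. by rewrite /sqmod/= expr0n/= addr0. Qed.

Lemma sqmod_eq0 x : (sqmod x == 0) = (x == 0).
Proof.
rewrite /sqmod paddr_eq0 ?sqr_ge0// !sqrf_eq0.
by rewrite eq_complex.
Qed.

Lemma sqmod_gt0 x : (0 < sqmod x) = (x != 0).
Proof. by rewrite lt_def sqmod_ge0 andbT sqmod_eq0. Qed.

Lemma sqmodV x : sqmod x^-1 = (sqmod x)^-1.
Proof.
have [->|x0] := eqVneq x 0; first by rewrite invr0 sqmod0 invr0.
apply: (mulfI (x := sqmod x)); first by rewrite sqmod_eq0.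
by rewrite -sqmodM !mulfV ?sqmod_eq0// sqmod1.
Qed.

Lemma sqmodD_le x y : sqmod (x + y) <= 2 * sqmod x + 2 * sqmod y.
Proof.
rewrite /sqmod !ReImE -subr_ge0.
have -> : 2 * (Re x ^+ 2 + Im x ^+ 2) + 2 * (Re y ^+ 2 + Im y ^+ 2) -
  ((Re x + Re y) ^+ 2 + (Im x + Im y) ^+ 2)
  = (Re x - Re y) ^+ 2 + (Im x - Im y) ^+ 2 by ring.
by rewrite addr_ge0// sqr_ge0.
Qed.

Lemma sqmodB_le x y : sqmod (x - y) <= 2 * sqmod x + 2 * sqmod y.
Proof. by rewrite -(sqmodN y) sqmodD_le. Qed.

Lemma sqmod_sum_le I (r : seq I) (F : I -> C) :
  sqmod (\sum_(i <- r) F i) <= (size r)%:R * \sum_(i <- r) sqmod (F i).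
Proof.
elim: r => [|i r IH]; first by rewrite !big_nil sqmod0 mulr0.
rewrite !big_cons /= -natr1.
set n : R := (size r)%:R in IH *; set S := \sum_(j <- r) _ in IH *.
set T := \sum_(j <- r) _ in IH *.
have n0 : 0 <= n by rewrite ler0n.
have T0 : 0 <= T by apply: sumr_ge0 => j _; exact: sqmod_ge0.
case: (eqVneq n 0) => [n00|nn0].
  have -> : S = 0.
    by apply/eqP; rewrite -sqmod_eq0 eq_le sqmod_ge0 andbT (le_trans IH)// n00 mul0r.
  rewrite addr0 n00 add0r mul1r lerDl//.
have n1 : 0 < n by rewrite lt_def nn0 n0.
(* Young's inequality with weight [n]: the factor [1 + n^-1] turns the inductive [n] into
   [n + 1]. *)
suff : sqmod (F i + S) <= (n + 1) * sqmod (F i) + (1 + n^-1) * sqmod S.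
  move/le_trans; apply.
  rewrite [leRHS]mulrDr lerD2l.
  have -> : (n + 1) * T = (1 + n^-1) * (n * T) by field.
  by rewrite ler_wpM2l// addr_ge0// invr_ge0.
have key (a b : R) : (a + b) ^+ 2 <= (n + 1) * a ^+ 2 + (1 + n^-1) * b ^+ 2.
  have -> : (n + 1) * a ^+ 2 + (1 + n^-1) * b ^+ 2
    = (a + b) ^+ 2 + n * (a - n^-1 * b) ^+ 2 by field.
  by rewrite lerDl mulr_ge0// sqr_ge0.
rewrite /sqmod !ReImE; have := key (Re (F i)) (Re S); have := key (Im (F i)) (Im S).
by lra.
Qed.

Lemma sqr_Re_le x : Re x ^+ 2 <= sqmod x.
Proof. by rewrite /sqmod lerDl sqr_ge0. Qed.
Lemma sqr_Im_le x : Im x ^+ 2 <= sqmod x.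
Proof. by rewrite /sqmod lerDr sqr_ge0. Qed.

Lemma sqmod_expi t : sqmod (expi t) = 1.
Proof. by rewrite /sqmod /= cos2Dsin2. Qed.

Lemma expiD s t : expi (s + t) = expi s * expi t.
Proof. by apply: complexP; rewrite /= ?cosD ?sinD; ring. Qed.

Lemma expi0 : expi (0 : R) = 1.
Proof. by rewrite /expi cos0 sin0. Qed.

Lemma expiN s : expi (- s) = (expi s)^-1.
Proof.
have e0 : expi s != 0 by rewrite -sqmod_eq0 sqmod_expi oner_eq0.
by apply: (mulfI e0); rewrite mulfV// -expiD subrr expi0.
Qed.

Lemma expi_2piz (m : int) : expi (2 * pi * m%:~R : R) = 1.
Proof.
suff Hn (n : nat) : expi (2 * pi * n%:R : R) = 1.
  case: m => n; first exact: Hn.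
  by rewrite NegzE mulrNz mulrN expiN Hn invr1.
elim: n => [|n IH]; first by rewrite mulr0 expi0.
have -> : 2 * pi * n.+1%:R = 2 * pi * n%:R + 2 * pi :> R by rewrite -natr1; ring.
rewrite expiD IH mul1r /expi.
by rewrite mulr_natl cos2pi sin2pi.
Qed.

Definition cexp z : C := (expR (Re z))%:C * expi (Im z).

Lemma cexpD x y : cexp (x + y) = cexp x * cexp y.
Proof. by rewrite /cexp cReD cImD expRD expiD rmorphM/= mulrACA. Qed.

Lemma cexp0 : cexp 0 = 1.
Proof. by rewrite /cexp/= expR0 expi0 mul1r. Qed.

Lemma sqmod_cexp z : sqmod (cexp z) = expR (Re z) ^+ 2.
Proof. by rewrite sqmodM sqmodR sqmod_expi mulr1. Qed.

Lemma cexp_neq0 z : cexp z != 0.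
Proof. by rewrite -sqmod_eq0 sqmod_cexp expf_neq0// gt_eqF// expR_gt0. Qed.

Lemma cexpN z : cexp (- z) = (cexp z)^-1.
Proof.
by apply: (mulfI (cexp_neq0 z)); rewrite mulfV ?cexp_neq0// -cexpD subrr cexp0.
Qed.

Lemma expi_cexp s : expi s = cexp (Complex 0 s).
Proof. by rewrite /cexp /= expR0 mul1r. Qed.

Lemma Re_mulR s x : Re (s%:C * x) = s * Re x.
Proof. by rewrite cReM /= mul0r subr0. Qed.
Lemma Im_mulR s x : Im (s%:C * x) = s * Im x.
Proof. by rewrite cImM /= mul0r addr0. Qed.

End ComplexNumbers.

(** * Integrals of nonnegative functions *)

Section NonnegIntegral.
Variable R : realType.
Local Notation mu := (@lebesgue_measure R).
Implicit Types (D A : set R) (F G : R -> R).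
Local Open Scope classical_set_scope.

Definition nnint D F : \bar R := (\int[mu]_(x in D) (F x)%:E)%E.

Lemma nnint_ge0 D F : (forall x, 0 <= F x) -> (0 <= nnint D F)%E.
Proof. by move=> F0; apply: integral_ge0 => x _; rewrite lee_fin. Qed.

Lemma eq_nnint D F G : (forall x, D x -> F x = G x) -> nnint D F = nnint D G.
Proof. by move=> FG; apply: eq_integral => x /set_mem Dx; rewrite FG. Qed.

Let mEFin D F : measurable_fun setT F -> measurable_fun D (EFin \o F).
Proof. by move=> mF; apply/measurable_EFinP; apply: measurable_funTS. Qed.

Let mEFin' D F : measurable_fun setT F -> measurable_fun D (fun x => (F x)%:E).
Proof. exact: mEFin. Qed.

Lemma le_nnint D F G : measurable D -> (forall x, D x -> 0 <= F x) ->
  measurable_fun setT F -> measurable_fun setT G ->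
  (forall x, D x -> F x <= G x) -> (nnint D F <= nnint D G)%E.
Proof.
move=> mD F0 mF mG FG; apply: ge0_le_integral => //; first [exact: mEFin' | by move=> x Dx; rewrite lee_fin ?F0 ?FG].
Qed.

Lemma nnintD D F G : measurable D -> (forall x, 0 <= F x) -> (forall x, 0 <= G x) ->
  measurable_fun setT F -> measurable_fun setT G ->
  nnint D (fun x => F x + G x) = (nnint D F + nnint D G)%E.
Proof.
move=> mD F0 G0 mF mG; rewrite /nnint -ge0_integralD//; 
  first [exact: mEFin' | by move=> *; rewrite lee_fin].
Qed.

Lemma nnintZ D F k : measurable D -> (forall x, 0 <= F x) -> 0 <= k ->
  measurable_fun setT F -> nnint D (fun x => k * F x) = (k%:E * nnint D F)%E.
Proof.
move=> mD F0 k0 mF; rewrite /nnint -ge0_integralZl_EFin//; 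
  first [exact: mEFin' | by move=> *; rewrite lee_fin].
Qed.

Lemma nnint_sum D I (s : seq I) (F : I -> R -> R) : measurable D ->
  (forall i x, 0 <= F i x) -> (forall i, measurable_fun setT (F i)) ->
  nnint D (fun x => \sum_(i <- s) F i x) = (\sum_(i <- s) nnint D (F i))%E.
Proof.
move=> mD F0 mF; rewrite /nnint -ge0_integral_sum//;
  first [by apply: eq_integral => x _; rewrite sumEFin
    | by move=> *; exact: mEFin' | by move=> *; rewrite lee_fin].
Qed.

Lemma nnint_indic A F : nnint setT (fun x => \1_A x * F x) = nnint A F.
Proof.
rewrite /nnint [RHS]integral_mkcond; apply: eq_integral => x _.
by rewrite /patch indicE; case: (x \in A); rewrite ?mul1r ?mul0r.
Qed.

Lemma subset_nnint D A F : measurable D -> measurable A -> (forall x, 0 <= F x) ->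
  measurable_fun setT F -> D `<=` A -> (nnint D F <= nnint A F)%E.
Proof.
move=> mD mA F0 mF DA; apply: ge0_subset_integral => //; 
  first [exact: mEFin' | by move=> *; rewrite lee_fin].
Qed.

Lemma nnint_setU D A F : measurable D -> measurable A -> (forall x, 0 <= F x) ->
  measurable_fun setT F -> [disjoint D & A] ->
  nnint (D `|` A) F = (nnint D F + nnint A F)%E.
Proof.
move=> mD mA F0 mF DA; rewrite /nnint ge0_integral_setU//; 
  first [exact: mEFin' | by move=> *; rewrite lee_fin].
Qed.

Lemma nnint_cst D k : measurable D -> nnint D (cst k) = (k%:E * mu D)%E.
Proof. by move=> mD; exact: (integral_cst mu mD k%:E). Qed.

Lemma measurable_shift (a : R) : measurable_fun setT (fun x : R => x + a).
Proof. by apply: measurable_funD. Qed.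

Lemma measurable_fun_shift F (a : R) :
  measurable_fun setT F -> measurable_fun setT (fun x : R => F (x + a)).
Proof. by move=> mF; apply: measurableT_comp mF (measurable_shift a). Qed.

(** Translation preserves the lengths of half-open intervals, and these determine Lebesgue
    measure. *)
Lemma lebesgue_measure_shift (a : R) A : measurable A ->
  pushforward mu (fun x : R => x + a : measurableTypeR R) A = mu A.
Proof.
move=> mA; apply/esym; apply: lebesgue_measure_unique => //.
  exact: measurable_shift.
move=> ma _ [[u v]] _ <- /=; rewrite /pushforward.
rewrite (_ : _ @^-1` _ = `]u - a, v - a]%classic); last first.
  by apply/seteqP; split => x /=; rewrite !in_itv/= ltrBlDr lerBrDr.
rewrite !lebesgue_measure_itv/= !lte_fin ltrD2r; case: ifP => // _.
by rewrite -!EFinD; congr EFin; ring.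
Qed.

Lemma nnint_shift (a : R) F D : measurable D -> (forall x, 0 <= F x) ->
  measurable_fun setT F ->
  nnint [set x | D (x + a)] (fun x => F (x + a)) = nnint D F.
Proof.
move=> mD F0 mF; rewrite /nnint.
rewrite (_ : [set x | D (x + a)] =
  (fun x : R => x + a : measurableTypeR R) @^-1` D)//.
have mE : measurable_fun D (EFin \o F) by exact: mEFin.
rewrite -(@ge0_integral_pushforward _ _ (measurableTypeR R) (measurableTypeR R) R
  _ (measurable_shift a) mu D (EFin \o F))//; last by move=> x _; rewrite lee_fin.
apply: eq_measure_integral; first exact: measurable_shift.
by move=> ma A mA AS; exact: lebesgue_measure_shift.
Qed.

Lemma nnint_itv_shift (a u v : R) F : (forall x, 0 <= F x) ->
  measurable_fun setT F ->
  nnint `[u, v[ (fun x => F (x + a)) = nnint `[u + a, v + a[ F.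
Proof.
move=> F0 mF; rewrite -(nnint_shift a (D := `[u + a, v + a[))//.
congr (nnint _ _); apply/seteqP; split => x /=;
  by rewrite !in_itv/= lerD2r ltrD2r.
Qed.

Lemma nnint_cells_partial (a p : R) F n : 0 < p -> (forall x, 0 <= F x) ->
  measurable_fun setT F ->
  nnint `[a, a + n%:R * p[ F =
  nnint `[a, a + p[ (fun x => \sum_(0 <= l < n) F (x + l%:R * p)).
Proof.
move=> p0 F0 mF; rewrite nnint_sum//; last by move=> i; exact: measurable_fun_shift.
elim: n => [|n IH].
  rewrite big_geq// mul0r addr0.
  rewrite (_ : `[a, a[%classic = set0) ?/nnint ?integral_set0//.
  by apply/seteqP; split => x //=; rewrite in_itv/= => /andP[/le_lt_trans h /h]; rewrite ltxx.
rewrite big_nat_recr//= -IH nnint_itv_shift//.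
rewrite -nnint_setU//; last first.
  apply/disj_setPS => x [/=]; rewrite !in_itv/= => /andP[_ h1] /andP[h2 _].
  by move: (lt_le_trans h1 h2); rewrite ltxx.
congr nnint; apply/seteqP; split => x /=; rewrite !in_itv/= -natr1.
  move=> /andP[-> h2]/=; case: (ltP x (a + n%:R * p)) => h; [by left|right].
  by apply/andP; split => //; lra.
have np : 0 <= n%:R * p by rewrite mulr_ge0// ltW.
case=> /andP[h1 h2]; apply/andP; split => //; nra.
Qed.

(** Periodization without series: a bound on the sums over [2 n] cells around [a], uniform in [n],
    passes to the whole line by monotone convergence. This is why the estimates on fibers below are
    stated for finite windows. *)
Lemma le_nnint_cells (a p : R) F (B : \bar R) : 0 < p -> (forall x, 0 <= F x) ->
  measurable_fun setT F ->
  (forall n, (nnint `[a, (a + p)%R[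
    (fun x : R => \sum_(0 <= l < n + n) F (x + (l%:R - n%:R) * p))%R <= B)%E) ->
  (nnint setT F <= B)%E.
Proof.
move=> p0 F0 mF HB.
pose S n := `[a - n%:R * p, a + n%:R * p[%classic.
have SU : \bigcup_n S n = [set: R].
  apply/seteqP; split => // x _.
  pose n := (Num.truncn (`|x - a| / p)).+1.
  have : `|x - a| < n%:R * p.
    by rewrite -ltr_pdivrMr// truncnS_gt.
  rewrite ltr_norml => /andP[h1 h2]; exists n => //.
  by rewrite /S /= in_itv/=; apply/andP; split; lra.
have cvgS : nnint (S i) F @[i --> \oo] --> nnint setT F.
  rewrite /nnint -SU.
  apply: (@ge0_nondecreasing_set_cvg_integral _ (measurableTypeR R)) => //.
  - apply/nondecreasing_seqP => n; rewrite subsetEset => x.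
    by rewrite /S /= !in_itv/= -natr1 => /andP[h1 h2]; apply/andP; split; lra.
  - by move=> i; exact: measurable_itv.
  - by move=> i; exact: mEFin'.
  - by move=> i x _; rewrite lee_fin.
apply: (cvge_le _ cvgS).
near=> n; apply: le_trans (HB n).
have -> : S n = `[a - n%:R * p, a - n%:R * p + (n + n)%:R * p[%classic.
  by rewrite /S (_ : a - n%:R * p + (n + n)%:R * p = a + n%:R * p)// natrD; ring.
rewrite -/(nnint _ F) nnint_cells_partial//.
pose G (y : R) := \sum_(0 <= l < n + n) F (y + l%:R * p).
rewrite [X in (_ <= X)%E](eq_nnint (G := fun x => G (x + (- (n%:R * p))))); last first.
  by move=> x _; rewrite /G; apply: eq_bigr => l _; congr F; ring.
rewrite nnint_itv_shift.
- by rewrite [a + p - _]addrAC.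
- by move=> x; apply: sumr_ge0.
- by apply: measurable_sum => l; exact: measurable_fun_shift.
Unshelve. all: by end_near.
Qed.

End NonnegIntegral.

(** * Measurability and square integrals of complex functions *)

Section ComplexMeasurability.
Variable R : realType.
Local Notation C := R[i].
Local Notation mu := (@lebesgue_measure R).
Implicit Types (f g : R -> C) (D A : set R).
Local Open Scope classical_set_scope.

Definition cmeas f := measurable_fun setT (fun x : R => Re (f x)) /\
  measurable_fun setT (fun x : R => Im (f x)).

Lemma cmeas_cst z : cmeas (fun=> z).
Proof. by split; exact: measurable_cst. Qed.

Lemma cmeas_real (h : R -> R) :
  measurable_fun setT h -> cmeas (fun x => (h x)%:C).
Proof. by move=> mh; split => //=. Qed.

Lemma cmeas_indic A : measurable A -> cmeas (fun x : R => (\1_A x : R)%:C).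
Proof. by move=> mA; apply: cmeas_real; exact: measurable_indic. Qed.

Lemma cmeasD f g : cmeas f -> cmeas g -> cmeas (fun x => f x + g x).
Proof.
move=> [f1 f2] [g1 g2]; split.
  by under eq_fun do rewrite cReD; exact: measurable_funD.
by under eq_fun do rewrite cImD; exact: measurable_funD.
Qed.

Lemma cmeasN f : cmeas f -> cmeas (fun x => - f x).
Proof.
move=> [f1 f2]; split.
  by under eq_fun do rewrite cReN; exact: measurable_funN.
by under eq_fun do rewrite cImN; exact: measurable_funN.
Qed.

Lemma cmeasB f g : cmeas f -> cmeas g -> cmeas (fun x => f x - g x).
Proof. by move=> mf mg; apply: cmeasD => //; exact: cmeasN. Qed.

Lemma cmeasM f g : cmeas f -> cmeas g -> cmeas (fun x => f x * g x).
Proof.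
move=> [f1 f2] [g1 g2]; split.
  under eq_fun do rewrite cReM.
  by apply: measurable_funB; apply: measurable_funM.
under eq_fun do rewrite cImM.
by apply: measurable_funD; apply: measurable_funM.
Qed.

Lemma cmeas_sum I (s : seq I) (P : pred I) (F : I -> R -> C) :
  (forall i, cmeas (F i)) -> cmeas (fun x => \sum_(i <- s | P i) F i x).
Proof.
move=> mF; elim: s => [|i s IH].
  by under eq_fun do rewrite big_nil; exact: cmeas_cst.
by under eq_fun do rewrite big_cons; case: (P i) => //; exact: cmeasD.
Qed.

Lemma cmeas_prod I (s : seq I) (P : pred I) (F : I -> R -> C) :
  (forall i, cmeas (F i)) -> cmeas (fun x => \prod_(i <- s | P i) F i x).
Proof.
move=> mF; elim: s => [|i s IH].
  by under eq_fun do rewrite big_nil; exact: cmeas_cst.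
by under eq_fun do rewrite big_cons; case: (P i) => //; exact: cmeasM.
Qed.

Lemma cmeas_comp f (h : R -> R) :
  cmeas f -> measurable_fun setT h -> cmeas (fun x => f (h x)).
Proof. by move=> [f1 f2] mh; split; [exact: (measurableT_comp f1 mh)|exact: (measurableT_comp f2 mh)]. Qed.

Lemma cmeas_shift f (a : R) : cmeas f -> cmeas (fun x => f (x + a)).
Proof. by move=> mf; apply: cmeas_comp => //; exact: measurable_shift. Qed.

Lemma measurable_sqmod f : cmeas f -> measurable_fun setT (fun x : R => sqmod (f x)).
Proof.
by move=> [f1 f2]; apply: measurable_funD; apply: measurable_funX.
Qed.

Lemma cmeas_expi (c : R) : cmeas (fun x => expi (c * x)).
Proof.
have mc : measurable_fun setT (fun x : R => c * x) by exact: measurable_funM.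
split => /=; apply: measurableT_comp mc; apply: continuous_measurable_fun;
  [exact: continuous_cos|exact: continuous_sin].
Qed.

Lemma cmeas_cexp (z : C) : cmeas (fun x => cexp (z * x%:C)).
Proof.
rewrite /cexp.
have -> : (fun x : R => (expR (Re (z * x%:C)))%:C * expi (Im (z * x%:C))) =
  (fun x => (expR (Re z * x))%:C * expi (Im z * x)).
  by apply/funext => x; rewrite [z * _]mulrC Re_mulR Im_mulR !(mulrC x).
apply: cmeasM; last exact: cmeas_expi.
apply: cmeas_real; apply: measurableT_comp; first exact: measurable_expR.
exact: measurable_funM.
Qed.

Lemma cmeasV f : cmeas f -> cmeas (fun x => (f x)^-1).
Proof.
move=> mf.
(* The inverse is the conjugate over the squared modulus, also at 0 where both sides are 0; the real
   power function supplies the measurability of the real inverse. *)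
have -> : (fun x => (f x)^-1) = (fun x => (powR (sqmod (f x)) (-1))%:C *
   Complex (Re (f x)) (- Im (f x))).
  apply/funext => x; rewrite powR_inv1 ?sqmod_ge0//.
  by apply: complexP; case: (f x) => a b; rewrite /sqmod/=; ring.
have [m1 m2] := mf.
apply: cmeasM; last by split => //=; exact: measurable_funN.
apply: cmeas_real.
exact: (measurableT_comp (measurable_powR (-1)) (measurable_sqmod mf)).
Qed.

Definition n2 D f : \bar R := nnint D (fun x => sqmod (f x)).

Lemma n2_ge0 D f : (0 <= n2 D f)%E.
Proof. by apply: nnint_ge0 => x; exact: sqmod_ge0. Qed.

Lemma eq_n2 D f g : (forall x, D x -> f x = g x) -> n2 D f = n2 D g.
Proof. by move=> fg; apply: eq_nnint => x Dx; rewrite fg. Qed.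

Lemma n2N D f : n2 D (fun x => - f x) = n2 D f.
Proof. by apply: eq_nnint => x _; rewrite sqmodN. Qed.

Lemma n2D_le D f g : measurable D -> cmeas f -> cmeas g ->
  (n2 D (fun x => f x + g x)%R <= 2%:E * n2 D f + 2%:E * n2 D g)%E.
Proof.
move=> mD cf cg; have mf := measurable_sqmod cf; have mg := measurable_sqmod cg.
rewrite /n2 -!nnintZ//;
  try by move=> x; exact: sqmod_ge0.
rewrite -nnintD//.
- apply: le_nnint => //.
  + by move=> x _; exact: sqmod_ge0.
  + apply: measurable_sqmod; exact: cmeasD.
  + by apply: measurable_funD; apply: measurable_funM.
  + by move=> x _; exact: sqmodD_le.
- by move=> x; rewrite mulr_ge0 ?sqmod_ge0.
- by move=> x; rewrite mulr_ge0 ?sqmod_ge0.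
- exact: measurable_funM.
- exact: measurable_funM.
Qed.

Lemma n2_sum_le D I (s : seq I) (F : I -> R -> C) : measurable D ->
  (forall i, cmeas (F i)) ->
  (n2 D (fun x => \sum_(i <- s) F i x)%R <= (size s)%:R%:E * \sum_(i <- s) n2 D (F i))%E.
Proof.
move=> mD mF; rewrite /n2 -nnint_sum//; last first.
- by move=> i; exact: measurable_sqmod.
- by move=> i x; exact: sqmod_ge0.
rewrite -nnintZ//.
- apply: le_nnint => //.
  + by move=> x _; exact: sqmod_ge0.
  + by apply: measurable_sqmod; exact: cmeas_sum.
  + by apply: measurable_funM => //; apply: measurable_sum => i; exact: measurable_sqmod.
  + by move=> x _; exact: sqmod_sum_le.
- by move=> x; apply: sumr_ge0 => i _; exact: sqmod_ge0.
- by apply: measurable_sum => i; exact: measurable_sqmod.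
Qed.

Lemma n2M_le D f g K : measurable D -> cmeas f -> cmeas g -> 0 <= K ->
  (forall x, D x -> sqmod (f x) <= K) ->
  (n2 D (fun x => f x * g x)%R <= K%:E * n2 D g)%E.
Proof.
move=> mD mf mg K0 fK; rewrite /n2 -nnintZ//;
  try by [move=> x; exact: sqmod_ge0 | exact: measurable_sqmod].
apply: le_nnint => //.
- by move=> x _; exact: sqmod_ge0.
- by apply: measurable_sqmod; exact: cmeasM.
- by apply: measurable_funM => //; exact: measurable_sqmod.
- by move=> x Dx; rewrite sqmodM ler_wpM2r ?sqmod_ge0// fK.
Qed.

Lemma n2_bounded D f K : measurable D -> cmeas f ->
  (forall x, D x -> sqmod (f x) <= K) -> (n2 D f <= K%:E * mu D)%E.
Proof.
move=> mD mf fK; rewrite -nnint_cst//; apply: le_nnint => //.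
- by move=> x _; exact: sqmod_ge0.
- exact: measurable_sqmod.
Qed.

Lemma n2_indic A f : n2 setT (fun x => (\1_A x)%:C * f x) = n2 A f.
Proof.
rewrite /n2 -[RHS]nnint_indic; apply: eq_nnint => x _.
by rewrite sqmodM sqmodR indicE; case: (x \in A); rewrite ?expr1n ?expr0n.
Qed.

Lemma subset_n2 D A f : measurable D -> measurable A -> cmeas f -> D `<=` A ->
  (n2 D f <= n2 A f)%E.
Proof.
move=> mD mA mf DA; apply: subset_nnint => //.
  by move=> x; exact: sqmod_ge0.
exact: measurable_sqmod.
Qed.

Lemma n2_shift f (a : R) : cmeas f -> n2 setT (fun x => f (x + a)) = n2 setT f.
Proof.
move=> mf; rewrite /n2 -[RHS](nnint_shift a)//.
  by move=> x; exact: sqmod_ge0.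
exact: measurable_sqmod.
Qed.

End ComplexMeasurability.

(** * Bessel families close to a finite-dimensional space *)

Section TraceBound.
Variables (R : rcfType) (V : lmodType R) (S : V -> Prop) (ip : V -> V -> R).
Hypothesis S0 : S 0.
Hypothesis SD : forall u v, S u -> S v -> S (u + v).
Hypothesis SZ : forall (c : R) u, S u -> S (c *: u).
Hypothesis ipDl : forall u v w, S u -> S v -> S w -> ip (u + v) w = ip u w + ip v w.
Hypothesis ipZl : forall (c : R) u v, S u -> S v -> ip (c *: u) v = c * ip u v.
Hypothesis ipC : forall u v, ip u v = ip v u.
Hypothesis ip_ge0 : forall u, 0 <= ip u u.

Let SN u : S u -> S (- u).
Proof. by move=> Su; rewrite -scaleN1r; exact: SZ. Qed.

Lemma span_sum I (r : seq I) (F : I -> V) :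
  (forall i, S (F i)) -> S (\sum_(i <- r) F i).
Proof. by move=> SF; elim/big_ind : _ => // u v; exact: SD. Qed.

Let ipDr u v w : S u -> S v -> S w -> ip w (u + v) = ip w u + ip w v.
Proof. by move=> *; rewrite ipC ipDl// !(ipC w). Qed.

Let ipZr c u v : S u -> S v -> ip u (c *: v) = c * ip u v.
Proof. by move=> *; rewrite ipC ipZl// (ipC v). Qed.

Let ip0l v : S v -> ip 0 v = 0.
Proof. by move=> Sv; rewrite -(scale0r 0) ipZl// mul0r. Qed.

Lemma ip_suml I (r : seq I) (F : I -> V) v : (forall i, S (F i)) -> S v ->
  ip (\sum_(i <- r) F i) v = \sum_(i <- r) ip (F i) v.
Proof.
move=> SF Sv; elim: r => [|i r IH]; first by rewrite !big_nil ip0l.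
by rewrite !big_cons ipDl// ?IH//; exact: span_sum.
Qed.

Definition orthonormal n (e : 'I_n -> V) :=
  forall i j, ip (e i) (e j) = (i == j)%:R.

(** The squared distance of [u] to the span of an orthonormal [e]. As [ip] is only assumed
    semidefinite (null functions exist), a vanishing defect stands in for membership in the span. *)
Definition bessel_defect n (e : 'I_n -> V) u := ip u u - \sum_i ip u (e i) ^+ 2.

Definition proj n (e : 'I_n -> V) u := \sum_i ip u (e i) *: e i.

Section Orthonormal.
Variables (n : nat) (e : 'I_n -> V).
Hypothesis Se : forall i, S (e i).
Hypothesis oe : orthonormal e.

Let Sproj u : S (proj e u).
Proof. by apply: span_sum => i; exact: SZ. Qed.

Lemma proj_residual_orth u i : S u -> ip (u - proj e u) (e i) = 0.
Proof.
move=> Su; rewrite ipDl//; last exact/SN/Sproj.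
rewrite -scaleN1r ipZl// ip_suml//; last by move=> j; exact: SZ.
under eq_bigr do rewrite ipZl// oe.
rewrite (bigD1 i)//= eqxx mulr1 big1 ?addr0; first by rewrite mulN1r subrr.
by move=> j /negbTE ->; rewrite mulr0.
Qed.

Lemma proj_residual_ip u v : S u -> S v ->
  ip (u - proj e u) v = ip (u - proj e u) (v - proj e v).
Proof.
move=> Su Sv; have Sr : S (u - proj e u) by apply: SD => //; exact/SN/Sproj.
rewrite [RHS]ipDr//; last exact/SN/Sproj.
rewrite -(scaleN1r (proj e v)) ipZr//.
suff -> : ip (u - proj e u) (proj e v) = 0 by rewrite mulr0 addr0.
rewrite ipC ip_suml//; last by move=> j; exact: SZ.
by rewrite big1// => j _; rewrite ipZl// (ipC (e j)) proj_residual_orth// mulr0.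
Qed.

Lemma bessel_defectE u : S u ->
  bessel_defect e u = ip (u - proj e u) (u - proj e u).
Proof.
move=> Su; rewrite -proj_residual_ip// ipDl//; last exact/SN/Sproj.
rewrite -scaleN1r ipZl// ip_suml//; last by move=> j; exact: SZ.
rewrite mulN1r; congr (_ - _); apply: eq_bigr => i _.
by rewrite ipZl// (ipC (e i)) expr2.
Qed.

Lemma bessel_defect_ge0 u : S u -> 0 <= bessel_defect e u.
Proof. by move=> Su; rewrite bessel_defectE. Qed.

(** The defect is a nonnegative quadratic form. Along [t *: u + r] it is affine in [t], since its
    value at [u] is 0; an affine function bounded below is constant, so the cross term [B]
    vanishes. *)
Lemma bessel_defect_add u r (c : R) : S u -> S r -> bessel_defect e u = 0 ->
  bessel_defect e (c *: u + r) = bessel_defect e r.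
Proof.
move=> Su Sr u0.
pose B := ip u r - \sum_i ip u (e i) * ip r (e i).
have E t : bessel_defect e (t *: u + r) = t ^+ 2 * bessel_defect e u + 2 * t * B + bessel_defect e r.
  rewrite /bessel_defect ipDl ?ipDr ?ipZl ?ipZr//; do ?[exact: SZ | apply: SD => //; exact: SZ].
  rewrite (ipC r u).
  have -> : \sum_i ip (t *: u + r) (e i) ^+ 2 =
    t ^+ 2 * (\sum_i ip u (e i) ^+ 2) + 2 * t * (\sum_i ip u (e i) * ip r (e i))
     + \sum_i ip r (e i) ^+ 2.
    rewrite !mulr_sumr -!big_split/=; apply: eq_bigr => i _.
    by rewrite ipDl ?ipZl//; [ring|exact: SZ].
  by rewrite /B; ring.
suff B0 : B = 0 by rewrite E u0 B0 !mulr0 !add0r.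
have H t : 0 <= 2 * t * B + bessel_defect e r.
  have : 0 <= bessel_defect e (t *: u + r).
    by apply: bessel_defect_ge0; apply: SD => //; exact: SZ.
  by rewrite E u0 mulr0 add0r.
apply/eqP/negPn/negP => B0.
have := H (- (bessel_defect e r + 1) / (2 * B)).
have -> : 2 * (- (bessel_defect e r + 1) / (2 * B)) * B + bessel_defect e r = -1 by field.
by rewrite ler0N1.
Qed.

Lemma bessel_defect_lincomb (m : nat) (v : 'I_m -> V) (c : 'I_m -> R) r :
  (forall j, S (v j)) -> S r -> (forall j, bessel_defect e (v j) = 0) ->
  bessel_defect e (\sum_j c j *: v j + r) = bessel_defect e r.
Proof.
move=> Sv Sr v0; elim: (index_enum _) => [|j s IH]; first by rewrite big_nil add0r.
rewrite big_cons -addrA bessel_defect_add//.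
by apply: SD => //; apply: span_sum => i; exact: SZ.
Qed.

End Orthonormal.

Lemma gram_schmidt m (v : 'I_m -> V) : (forall i, S (v i)) ->
  exists n (e : 'I_n -> V), [/\ (n <= m)%N, forall i, S (e i), orthonormal e &
    forall j, bessel_defect e (v j) = 0].
Proof.
elim: m v => [v _|m IH v Sv].
  by exists 0%N, v; split => // -[].
have [n [e [nm Se oe ve]]] := IH (fun i => v (lift ord0 i)) (fun i => Sv _).
set u := v ord0; set r := u - proj e u.
have Su : S u by exact: Sv.
have Sr : S r by apply: SD => //; apply/SN/span_sum => i; exact: SZ.
(* A residual of norm 0 need not be the zero vector, but its defect already vanishes, so no basis
   vector is added. *)
have [q0|q0] := eqVneq (ip r r) 0.
  exists n, e; split => //; first exact: leq_trans nm _.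
  move=> j; case: (unliftP ord0 j) => [k ->|->]; first exact: ve.
  by rewrite (bessel_defectE Se oe).
pose f := (Num.sqrt (ip r r))^-1 *: r.
have Sf : S f by exact: SZ.
have s0 : Num.sqrt (ip r r) != 0 by rewrite sqrtr_eq0 -ltNge lt_def q0 ip_ge0.
pose e' (i : 'I_n.+1) := oapp e f (unlift ord0 i).
have e'0 : e' ord0 = f by rewrite /e' unlift_none.
have e'S i : e' (lift ord0 i) = e i by rewrite /e' liftK.
have Se' i : S (e' i).
  by case: (unliftP ord0 i) => [k ->|->]; rewrite ?e'S ?e'0.
have fe i : ip f (e i) = 0 by rewrite ipZl// (proj_residual_orth Se oe)// mulr0.
have ff : ip f f = 1.
  by rewrite ipZl// ipZr// mulrA -invfM -expr2 sqr_sqrtr ?mulVf.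
have oe' : orthonormal e'.
  move=> i j; case: (unliftP ord0 i) => [k ->|->]; case: (unliftP ord0 j) => [l ->|->].
  - by rewrite !e'S oe (inj_eq lift_inj).
  - by rewrite e'S e'0 ipC fe.
  - by rewrite e'S e'0 fe.
  - by rewrite e'0 ff eqxx.
have dE w : bessel_defect e' w = bessel_defect e w - ip w f ^+ 2.
  rewrite /bessel_defect big_ord_recl e'0; under eq_bigr do rewrite e'S.
  by ring.
exists n.+1, e'; split => // j; case: (unliftP ord0 j) => [k ->|->].
  apply/eqP; rewrite eq_le (bessel_defect_ge0 Se' oe')// andbT dE ve sub0r.
  by rewrite oppr_le0 sqr_ge0.
rewrite dE (bessel_defectE Se oe)// -/u -/r ipZr//.
have -> : ip u r = ip r r.
  by rewrite ipC /r (proj_residual_ip Se oe).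
by rewrite exprMn exprVn sqr_sqrtr// expr2 mulrA mulVf// mul1r subrr.
Qed.

(* With [P] the orthogonal projection onto the span of the [v j], the sum of the
   squared norms of the [P (x i)] is the sum over an orthonormal basis [e] of the
   sums of the [ip (e j) (x i) ^+ 2], hence at most the dimension. *)
Lemma trace_bound (I : finType) (x : I -> V) m (v : 'I_m -> V) eps :
  (forall i, S (x i)) -> (forall j, S (v j)) ->
  (forall u, S u -> \sum_i ip u (x i) ^+ 2 <= ip u u) ->
  (forall i, exists c : 'I_m -> R,
     let r := x i - \sum_j c j *: v j in ip r r <= eps) ->
  \sum_i ip (x i) (x i) <= m%:R + #|I|%:R * eps.
Proof.
move=> Sx Sv bx dx.
have [n [e [nm Se oe ve]]] := gram_schmidt Sv.
apply: (@le_trans _ _ (\sum_i (\sum_j ip (x i) (e j) ^+ 2 + eps))).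
  apply: ler_sum => i _; have [c] := dx i.
  set r := x i - _ => /= hr.
  have Sr : S r by apply: SD => //; apply/SN/span_sum => j; exact: SZ.
  rewrite addrC -lerBlDr; apply: le_trans hr.
  have -> : ip (x i) (x i) - \sum_j ip (x i) (e j) ^+ 2 = bessel_defect e r.
    rewrite -(bessel_defect_lincomb Se oe c Sv Sr ve).
    by rewrite /r addrCA subrr addr0.
  by rewrite /bessel_defect gerDl oppr_le0 sumr_ge0// => j _; rewrite sqr_ge0.
rewrite big_split/= sumr_const -(mulr_natl eps) lerD2r exchange_big/=.
apply: (@le_trans _ _ (\sum_(j < n) 1)).
  apply: ler_sum => j _; under eq_bigr do rewrite ipC.
  by apply: le_trans (bx _ (Se j)) _; rewrite oe eqxx.
by rewrite sumr_const card_ord ler_nat.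
Qed.

Lemma trace_bound_fin (I J : finType) (x : I -> V) (v : J -> V) eps :
  (forall i, S (x i)) -> (forall j, S (v j)) ->
  (forall u, S u -> \sum_i ip u (x i) ^+ 2 <= ip u u) ->
  (forall i, exists c : J -> R,
     let r := x i - \sum_j c j *: v j in ip r r <= eps) ->
  \sum_i ip (x i) (x i) <= #|J|%:R + #|I|%:R * eps.
Proof.
move=> Sx Sv bx dx.
apply: (trace_bound (v := fun k => v (enum_val k))) => // i.
have [c hc] := dx i; exists (fun k => c (enum_val k)).
by rewrite (reindex (@enum_val J xpredT)) in hc;
  last by apply: onW_bij; exact: enum_val_bij.
Qed.

End TraceBound.

(** * Derivatives and integrals of complex exponentials *)

Section ExpDerivative.
Variable R : realType.
Local Notation C := R[i].
Local Notation mu := (@lebesgue_measure R).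
Local Open Scope classical_set_scope.

Lemma Re_cexp (z l : C) (x : R) : Re (z * cexp (l * x%:C)) =
  expR (Re l * x) * (Re z * cos (Im l * x) - Im z * sin (Im l * x)).
Proof.
rewrite /cexp; have -> : Re (l * x%:C) = Re l * x by rewrite cReM /=; ring.
have -> : Im (l * x%:C) = Im l * x by rewrite cImM /=; ring.
by rewrite !(cReM, cImM) /=; ring.
Qed.

Lemma Im_cexp (z l : C) (x : R) :
  Im (z * cexp (l * x%:C)) = Re (- 'i%C * z * cexp (l * x%:C)).
Proof. by rewrite !(cReM, cImM, cReN, cImN) /=; ring. Qed.

Lemma is_derive_Re_cexp (z l : C) (x : R) :
  is_derive x 1 (fun t : R => Re (z * cexp (l * t%:C)))
    (Re (z * l * cexp (l * x%:C))).
Proof.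
under eq_fun do rewrite Re_cexp.
have dl (c : R) : is_derive x 1 (fun t : R => c * t) c.
  have h := @is_deriveZ R R R id c x 1 1 (is_derive_id x (1 : R)).
  rewrite -[X in is_derive _ _ _ X](mulr1 c). exact: h.
have de := @is_derive1_comp R expR (fun t => Re l * t) x _ _ (is_derive_expR _) (dl _).
have dc := @is_derive1_comp R cos (fun t => Im l * t) x _ _ (is_derive_cos _) (dl _).
have ds := @is_derive1_comp R sin (fun t => Im l * t) x _ _ (is_derive_sin _) (dl _).
have h := is_deriveM de (is_deriveB (is_deriveZ (Re z) dc) (is_deriveZ (Im z) ds)).
apply: (@is_derive_eq _ _ _ _ _ _ _ _ h).
rewrite Re_cexp !(cReM, cImM).
rewrite (_ : (_ \*: _ - _ \*: _) x =
  Re z * cos (Im l * x) - Im z * sin (Im l * x))// /GRing.scale /= /GRing.scale /=.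
by ring.
Qed.

Lemma is_derive_Im_cexp (z l : C) (x : R) :
  is_derive x 1 (fun t : R => Im (z * cexp (l * t%:C)))
    (Im (z * l * cexp (l * x%:C))).
Proof.
rewrite Im_cexp (mulrA (- 'i%C) z l) (_ : (fun t : R => Im _) =
  fun t => Re (- 'i%C * z * cexp (l * t%:C))); first exact: is_derive_Re_cexp.
by apply/funext => t; exact: Im_cexp.
Qed.

Lemma continuous_Re_cexp (z l : C) :
  continuous (fun t : R => Re (z * cexp (l * t%:C))).
Proof.
move=> x; have h := is_derive_Re_cexp z l x.
by apply/differentiable_continuous/derivable1_diffP; exact: ex_derive.
Qed.

Lemma Rintegral_Re_cexp (z l : C) (u v : R) : u < v -> l != 0 ->
  (\int[mu]_(x in `[u, v]) Re (z * cexp (l * x%:C)))%R =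
  Re (z / l * (cexp (l * v%:C) - cexp (l * u%:C))).
Proof.
move=> uv l0; pose F t := Re (z / l * cexp (l * t%:C)).
rewrite /Rintegral (continuous_FTC2 (F := F))//.
- by rewrite /F -EFinB /= mulrBr cReD cReN.
- by apply: continuous_subspaceT => x; exact: continuous_Re_cexp.
- split.
  + by move=> x _; have h := is_derive_Re_cexp (z / l) l x; exact: ex_derive.
  + by apply: cvg_at_right_filter; exact: continuous_Re_cexp.
  + by apply: cvg_at_left_filter; exact: continuous_Re_cexp.
- move=> x _; rewrite derive1E; have h := is_derive_Re_cexp (z / l) l x.
  by rewrite derive_val divfK.
Qed.

End ExpDerivative.

(** * The real inner product of square-integrable functions *)

Section L2InnerProduct.
Variable R : realType.
Local Notation C := R[i].
Local Notation mu := (@lebesgue_measure R).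
Local Open Scope classical_set_scope.
Local Notation V := (R -> Rcomplex R).
Implicit Types (f g : R -> C).

Lemma L2P f : L2 f <-> cmeas f /\ (n2 setT f < +oo)%E.
Proof. by rewrite /L2 /cmeas; split=> [[? [? ?]]|[[? ?] ?]]. Qed.

(** The real part of the Hermitian product. The trace bound is over a real field, so below every
    complex atom occurs twice, once multiplied by ['i]. *)
Definition ip (f g : V) : R :=
  (\int[mu]_x (Re (f x) * Re (g x) + Im (f x) * Im (g x)))%R.

Lemma L2_integrable f g : L2 f -> L2 g -> mu.-integrable setT
  (EFin \o (fun x => Re (f x) * Re (g x) + Im (f x) * Im (g x))).
Proof.
move=> /L2P[mf lf] /L2P[mg lg].
have [f1 f2] := mf; have [g1 g2] := mg.
have ms := measurable_funD (measurable_sqmod mf) (measurable_sqmod mg).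
have mm := measurable_funD (measurable_funM f1 g1) (measurable_funM f2 g2).
apply: (@le_integrable _ (measurableTypeR R) R mu setT measurableT _
   (EFin \o (fun x => sqmod (f x) + sqmod (g x)))).
- exact/measurable_EFinP.
- move=> x _ /=; rewrite lee_fin.
  rewrite [leRHS]ger0_norm; last by rewrite addr_ge0// sqmod_ge0.
  rewrite /sqmod.
  rewrite ler_norml.
  move: (Re (f x)) (Re (g x)) (Im (f x)) (Im (g x)) => a b c d.
  have h1 : 0 <= (a + b) ^+ 2 + (c + d) ^+ 2 + a ^+ 2 + b ^+ 2 + c ^+ 2 + d ^+ 2.
    by rewrite !addr_ge0// sqr_ge0.
  have h2 : 0 <= (a - b) ^+ 2 + (c - d) ^+ 2 + a ^+ 2 + b ^+ 2 + c ^+ 2 + d ^+ 2.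
    by rewrite !addr_ge0// sqr_ge0.
  by apply/andP; split; lra.
apply/integrableP; split; first exact/measurable_EFinP.
rewrite (_ : (\int[mu]_x _)%E = (n2 setT f + n2 setT g)%E).
  by rewrite lte_add_pinfty.
rewrite /n2 -nnintD//; do ?[exact: measurable_sqmod | by move=> x; exact: sqmod_ge0].
by apply: eq_integral => x _ /=; rewrite ger0_norm// addr_ge0// sqmod_ge0.
Qed.

Lemma L2_n2 f : L2 f -> (ip f f)%:E = n2 setT f.
Proof.
move=> Lf; rewrite /ip /Rintegral fineK; last first.
  exact: integrable_fin_num (L2_integrable Lf Lf).
by apply: eq_integral => x _; rewrite /sqmod !expr2.
Qed.

Lemma L20 : L2 (0 : V).
Proof.
apply/L2P; split; first exact: cmeas_cst.
by rewrite /n2 (eq_nnint (G := cst 0)) ?nnint_cst ?mul0e// => x _; rewrite sqmod0.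
Qed.

Lemma L2D f g : L2 f -> L2 g -> L2 (fun x => f x + g x).
Proof.
move=> /L2P[mf lf] /L2P[mg lg]; apply/L2P; split; first exact: cmeasD.
apply: le_lt_trans (n2D_le _ mf mg) _ => //.
by rewrite lte_add_pinfty// lte_mul_pinfty.
Qed.

Lemma L2_bounded_mul f g K : cmeas f -> (forall x, sqmod (f x) <= K) -> L2 g ->
  L2 (fun x => f x * g x).
Proof.
move=> mf fK /L2P[mg lg]; apply/L2P; split; first exact: cmeasM.
have K0 : 0 <= K by apply: le_trans (fK 0); exact: sqmod_ge0.
apply: (@le_lt_trans _ _ (K%:E * n2 setT g)%E); first exact: n2M_le.
by rewrite lte_mul_pinfty.
Qed.

Lemma L2Zc (c : C) f : L2 f -> L2 (fun x => c * f x).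
Proof. by apply: (L2_bounded_mul (K := sqmod c)) => //; exact: cmeas_cst. Qed.

Lemma RcomplexZ (k : R) (z : C) : k *: (z : Rcomplex R) = k%:C * z.
Proof. by case: z => a b; apply: complexP => /=; ring. Qed.

Lemma L2Z (c : R) (f : V) : L2 f -> L2 (c *: f).
Proof.
move=> Lf; rewrite (_ : c *: f = fun x => c%:C * f x); first exact: L2Zc.
by apply/funext => x; rewrite -RcomplexZ.
Qed.

Lemma ipDl (f g h : V) : L2 f -> L2 g -> L2 h -> ip (f + g) h = ip f h + ip g h.
Proof.
move=> Lf Lg Lh; rewrite /ip -RintegralD//; do ?exact: L2_integrable.
by apply: eq_Rintegral => x _; rewrite /= cReD cImD; ring.
Qed.

Lemma ipZl (c : R) (f g : V) : L2 f -> L2 g -> ip (c *: f) g = c * ip f g.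
Proof.
move=> Lf Lg; rewrite /ip -RintegralZl//; last exact: L2_integrable.
by apply: eq_Rintegral => x _; rewrite /= -[(c *: f) x]/(c *: (f x))
  RcomplexZ Re_mulR Im_mulR; ring.
Qed.

Lemma ipC (f g : V) : ip f g = ip g f.
Proof. by apply: eq_Rintegral => x _; ring. Qed.

Lemma ip_ge0 (f : V) : 0 <= ip f f.
Proof. by apply: Rintegral_ge0 => x _; rewrite -!expr2 addr_ge0// sqr_ge0. Qed.

Lemma L2_bessel (I : finType) (e : I -> V) (f : V) :
  (forall i, L2 (e i)) -> (forall i j, ip (e i) (e j) = (i == j)%:R) ->
  L2 f -> \sum_i ip f (e i) ^+ 2 <= ip f f.
Proof.
move=> Le oe Lf.
have := @bessel_defect_ge0 R V (@L2 R) ip L20 L2D L2Z ipDl ipZl ipC ip_ge0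
  #|I| (fun k => e (enum_val k)) (fun k => Le _) _ f Lf.
rewrite /bessel_defect subr_ge0.
rewrite [X in _ -> X <= _](reindex (@enum_val I xpredT))/=; last first.
  by apply: onW_bij; exact: enum_val_bij.
by apply=> i j; rewrite oe (inj_eq (@enum_val_inj _ _)).
Qed.

End L2InnerProduct.

(** * Gabor systems with alpha beta > 1 *)

Section BoxFunctions.
Variable R : realType.
Local Notation C := R[i].
Local Notation mu := (@lebesgue_measure R).
Local Open Scope classical_set_scope.
Local Notation V := (R -> Rcomplex R).

Lemma L2_indic_bounded (A : set R) (f : R -> C) K : measurable A ->
  (mu A < +oo)%E -> cmeas f -> (forall x, A x -> sqmod (f x) <= K) ->
  L2 (fun x => (\1_A x)%:C * f x).
Proof.
move=> mA Aoo mf fK; apply/L2P; split.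
  by apply: cmeasM => //; exact: cmeas_indic.
rewrite n2_indic; apply: (@le_lt_trans _ _ (`|K|%:E * mu A)%E).
  by apply: n2_bounded => // x /fK /le_trans; apply; exact: ler_norm.
by rewrite lte_mul_pinfty.
Qed.

Lemma expi_Cexp (c t : R) : expi (c * t) = cexp (Complex 0 c * t%:C).
Proof.
rewrite expi_cexp; congr cexp; apply: complexP => /=; ring.
Qed.

Lemma Rintegral_Re_expi (z : C) (u p : R) (k : int) : 0 < p ->
  (\int[mu]_(x in `[u, (u + p)%R[) Re (z * expi (2 * pi * p^-1 * k%:~R * x)))%R =
  if k == 0 then p * Re z else 0.
Proof.
move=> p0; have up : u < u + p by rewrite ltrDl.
set f : R -> R := fun x => _.
have mf : measurable_fun `[u, u + p[ f.
  apply: measurable_funTS; apply: (cmeasM _ _).1; first exact: cmeas_cst.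
  exact: cmeas_expi.
rewrite Rintegral_itv_bndo_bndc//; last first.
  apply: (@integrableS _ _ _ mu `[u, u + p]) => //.
    by apply: subset_itvl; rewrite bnd_simp.
  apply: continuous_compact_integrable; first exact: segment_compact.
  apply: continuous_subspaceT => x.
  rewrite /f (_ : (fun _ => _) = fun x : R => Re (z * cexp (Complex 0 (2 * pi * p^-1 * k%:~R) * x%:C))).
    exact: continuous_Re_cexp.
  by apply/funext => y; rewrite expi_Cexp.
have [k0|k0] := eqVneq k 0.
  rewrite (eq_Rintegral mu (g := cst (Re z))); last first.
    by move=> x _; rewrite /f k0 mulr0 mul0r expi0 mulr1.
  rewrite Rintegral_cst//= lebesgue_measure_itv/= lte_fin up.
  by rewrite -EFinB /= (addrAC u) subrr add0r mulrC.
rewrite /f; under eq_Rintegral do rewrite expi_Cexp.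
rewrite Rintegral_Re_cexp//; last first.
  rewrite -sqmod_eq0 /sqmod/= expr0n/= add0r sqrf_eq0 !mulf_neq0//.
  - by rewrite gt_eqF// pi_gt0.
  - by rewrite invr_eq0 gt_eqF.
  - by rewrite intr_eq0.
rewrite -!expi_Cexp (mulrDr _ u p).
rewrite (_ : 2 * pi * p^-1 * k%:~R * p = 2 * pi * k%:~R); last first.
  by field; rewrite gt_eqF.
by rewrite expiD expi_2piz mulr1 subrr mulr0.
Qed.

Variable p : R.
Hypothesis p0 : 0 < p.

(** The factor [Num.sqrt p^-1] makes the family orthonormal when [A] is a full interval of length
    [p]. *)
Definition box (A : set R) (n : int) (b : bool) : V := fun t =>
  (\1_A t)%:C * ((Num.sqrt p^-1)%:C * ((if b then 'i%C else 1) *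
    expi (2 * pi * p^-1 * n%:~R * t))).

Let unit_b (b : bool) : sqmod (if b then 'i%C else 1 : C) = 1.
Proof. by case: b; rewrite /sqmod/= ?expr1n ?expr0n/= ?addr0 ?add0r. Qed.

Let cmeas_box_body n b : cmeas (fun t : R => (Num.sqrt p^-1)%:C *
  ((if b then 'i%C else 1) * expi (2 * pi * p^-1 * n%:~R * t))).
Proof.
apply: cmeasM; first exact: cmeas_cst.
by apply: cmeasM; [exact: cmeas_cst|exact: cmeas_expi].
Qed.

Let sqmod_box_body n b (t : R) : sqmod ((Num.sqrt p^-1)%:C *
  ((if b then 'i%C else 1) * expi (2 * pi * p^-1 * n%:~R * t))) = p^-1.
Proof.
by rewrite !sqmodM unit_b sqmod_expi !mulr1 sqmodR sqr_sqrtr// invr_ge0 ltW.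
Qed.

Lemma L2_box A n b : measurable A -> (mu A < +oo)%E -> L2 (box A n b).
Proof.
move=> mA Aoo; apply: (L2_indic_bounded (K := p^-1)) => // x _.
by rewrite sqmod_box_body.
Qed.

Lemma n2_box A n b : measurable A -> n2 setT (box A n b) = ((p^-1)%:E * mu A)%E.
Proof.
move=> mA; rewrite n2_indic -nnint_cst//; apply: eq_nnint => x _.
exact: sqmod_box_body.
Qed.

Lemma ip_box u n b m c : ip (box `[u, u + p[ n b) (box `[u, u + p[ m c) =
  ((n, b) == (m, c))%:R.
Proof.
pose z : C := (if b then 'i%C else 1) * (if c then - 'i%C else 1).
rewrite /ip (eq_Rintegral mu (g := (fun t => p^-1 * Re (z *
   expi (2 * pi * p^-1 * (n - m)%:~R * t))) \_ `[u, u + p[)); last first.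
  move=> t _; rewrite /patch /box indicE; case: (t \in _); last first.
    by rewrite !Re_mulR !Im_mulR !mul0r addr0.
  have -> : 2 * pi * p^-1 * (n - m)%:~R * t =
     2 * pi * p^-1 * n%:~R * t + - (2 * pi * p^-1 * m%:~R * t).
    by rewrite intrB; ring.
  have s2 : Num.sqrt p^-1 * Num.sqrt p^-1 = p^-1.
    by rewrite -expr2 sqr_sqrtr// invr_ge0 ltW.
  rewrite expiD /z; move: (2 * pi * p^-1 * n%:~R * t) (2 * pi * p^-1 * m%:~R * t) => x y.
  rewrite !mul1r; move: (Num.sqrt p^-1) s2 => s <-.
  by case: b c {z} => [] []; rewrite !(cReM, cImM, cReN, cImN) /= cosN sinN; ring.
rewrite -Rintegral_mkcond RintegralZl//; last first.
  apply: (@integrableS _ _ _ mu `[u, u + p]) => //.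
    by apply: subset_itvl; rewrite bnd_simp.
  apply: continuous_compact_integrable; first exact: segment_compact.
  apply: continuous_subspaceT => x.
  rewrite (_ : (fun _ => _) = fun x : R => Re (z * cexp (Complex 0 (2 * pi * p^-1 * (n - m)%:~R) * x%:C))).
    exact: continuous_Re_cexp.
  by apply/funext => y; rewrite expi_Cexp.
rewrite Rintegral_Re_expi// subr_eq0 xpair_eqE.
case: (eqVneq n m) => _ /=; last by rewrite mulr0.
have pn0 : p != 0 by rewrite gt_eqF.
rewrite mulKf// /z.
by case: b c {z} => [] []; rewrite !(cReM, cImM, cReN, cImN) /=; ring.
Qed.

(** As [A] fits in an interval of length [p], the coefficients of [f] against the boxes on [A] are
    those of [\1_A f] against the orthonormal boxes on that interval. *)
Lemma box_bessel (J : finType) (nu : J -> int) (A : set R) u (f : V) :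
  injective nu -> measurable A -> A `<=` `[u, u + p[ -> L2 f ->
  ((\sum_(jb : J * bool) ip f (box A (nu jb.1) jb.2) ^+ 2)%:E <= n2 A f)%E.
Proof.
move=> inu mA Au Lf; rewrite -n2_indic.
have Lg : L2 (fun x => (\1_A x)%:C * f x).
  apply: (L2_bounded_mul (K := 1)) => //; first exact: cmeas_indic.
  by move=> x; rewrite sqmodR indicE; case: (_ \in _); rewrite ?expr1n ?expr0n/= ?ler01.
rewrite -L2_n2// lee_fin.
have fu : (mu `[u, (u + p)%R[%classic < +oo)%E.
  by rewrite lebesgue_measure_itv/=; case: ifP => // _; rewrite -EFinB ltry.
apply: le_trans (L2_bessel (e := fun jb : J * bool => box `[u, u + p[ (nu jb.1) jb.2) _ _ Lg).
- rewrite le_eqVlt; apply/orP; left; apply/eqP; apply: eq_bigr => -[j b] _ /=.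
  congr (_ ^+ 2); apply: eq_Rintegral => t _; rewrite /box !indicE.
  case: (boolP (t \in A)) => tA; last by rewrite !Re_mulR !Im_mulR !(mul0r, mulr0).
  suff -> : (t \in `[u, u + p[%classic) by rewrite !Re_mulR !Im_mulR !mul1r.
  by rewrite inE; apply: Au; rewrite inE in tA.
- by move=> jb; apply: L2_box.
- by move=> [j b] [j' b'] /=; rewrite ip_box !xpair_eqE (inj_eq inu).
Qed.

End BoxFunctions.

Definition indices_le T (r : nat) (t : seq (int * int * T)) :=
  all (fun q => (absz q.1.1 <= r)%N && (absz q.1.2 <= r)%N) t.

Lemma indices_leW T (r r' : nat) (t : seq (int * int * T)) :
  (r <= r')%N -> indices_le r t -> indices_le r' t.
Proof.
move=> rr'; apply: sub_all => q /andP[h1 h2].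
by rewrite (leq_trans h1)// (leq_trans h2).
Qed.

Lemma ex_indices_le T (t : seq (int * int * T)) : exists r, indices_le r t.
Proof.
elim: t => [|q t [r hr]]; first by exists 0%N.
exists (r + absz q.1.1 + absz q.1.2)%N; rewrite /indices_le /= -/(indices_le _ t).
by rewrite (indices_leW _ hr) -?addnA ?leq_addr// addnA leq_addl addnAC leq_addl.
Qed.

Section Incompleteness.
Variable R : realType.
Local Notation C := R[i].
Local Notation mu := (@lebesgue_measure R).
Local Open Scope classical_set_scope.
Local Notation V := (R -> Rcomplex R).

Lemma L2_shift (f : R -> C) (a : R) : L2 f -> L2 (fun x => f (x + a)).
Proof.
by move=> /L2P[mf lf]; apply/L2P; split; [exact: cmeas_shift|rewrite n2_shift].
Qed.

Lemma L2_gabor (g : R -> C) (alpha beta : R) (m n : int) : L2 g ->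
  L2 (gabor g alpha beta m n).
Proof.
move=> Lg; apply: (L2_bounded_mul (K := 1)); first exact: cmeas_expi.
  by move=> x; rewrite sqmod_expi.
exact: L2_shift.
Qed.

Lemma sum_n2_disjoint (J : finType) (B : J -> set R) (f : R -> C) :
  (forall j, measurable (B j)) -> cmeas f ->
  (forall j k x, B j x -> B k x -> j = k) ->
  (\sum_j n2 (B j) f <= n2 setT f)%E.
Proof.
move=> mB mf dB; have ms := measurable_sqmod mf.
rewrite (eq_bigr (fun j => nnint setT (fun x => \1_(B j) x * sqmod (f x)))%R); last first.
  by move=> j _; rewrite nnint_indic.
have m1 j : measurable_fun setT (fun x : R => \1_(B j) x * sqmod (f x)).
  by apply: measurable_funM => //; exact: measurable_indic.
have p1 j x : 0 <= \1_(B j) x * sqmod (f x) by rewrite mulr_ge0// sqmod_ge0.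
rewrite -nnint_sum//; apply: le_nnint => //.
- by move=> x _; apply: sumr_ge0.
- exact: measurable_sum.
- move=> x _; rewrite -mulr_suml ler_piMl ?sqmod_ge0//.
  case: (pselect (exists j, B j x)) => [[j Bj]|nB].
    rewrite (bigD1 j)//= big1 ?addr0; first by rewrite indicE; case: (_ \in _).
    move=> k kj; rewrite indicE memNset// => Bk.
    by move: kj; rewrite (dB _ _ _ Bk Bj) eqxx.
  rewrite big1 ?ler01// => j _; rewrite indicE memNset// => Bj.
  by apply: nB; exists j.
Qed.

(** Indices between [- r] and [K + r] are encoded as naturals by adding [r], whence the [K + r.*2]
    places per coordinate. *)
Lemma shift_index_lt (K r n : nat) (m : int) : (n < K)%N -> (absz m <= r)%N ->
  exists a : 'I_(K + r.*2), (a%:Z - r%:Z = n%:Z + m)%R.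
Proof.
move=> nK mr; have h : (absz (n%:Z + m + r%:Z)%R < K + r.*2)%N by lia.
by exists (Ordinal h) => /=; lia.
Qed.

Variables (g : R -> C) (alpha beta : R).
Hypothesis Lg : L2 g.
Hypothesis alpha0 : 0 < alpha.
Hypothesis beta0 : 0 < beta.
Hypothesis ab1 : 1 < alpha * beta.

Let p := beta^-1.
Let p0 : 0 < p. Proof. by rewrite invr_gt0. Qed.
Let pa : p < alpha.
Proof. by rewrite /p -[_^-1]mul1r ltr_pdivrMr. Qed.
Let pV : p^-1 = beta. Proof. by rewrite /p invrK. Qed.
(** The cap [alpha] keeps the translates by multiples of [alpha] disjoint; the cap [p + p] keeps [p,
    c) no longer than one period [p], as Bessel's inequality requires. *)
Let c := Num.min alpha (p + p).
Let ca : c <= alpha. Proof. by rewrite ge_min lexx. Qed.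
Let cp : c <= p + p. Proof. by rewrite ge_min lexx orbT. Qed.
Let pc : p < c. Proof. by rewrite lt_min pa ltrDl p0. Qed.

Let A (m : nat) (i : bool) : set R :=
  if i then `[alpha * m%:R + p, alpha * m%:R + c[ else `[alpha * m%:R, alpha * m%:R + p[.

Let mA m i : measurable (A m i).
Proof. by rewrite /A; case: i. Qed.

Let muA m i : mu (A m i) = (if i then c - p else p)%:E.
Proof.
rewrite /A; case: i; rewrite lebesgue_measure_itv/= lte_fin.
  rewrite ltrD2l pc -EFinB; congr EFin; ring.
by rewrite ltrDl p0 -EFinB; congr EFin; ring.
Qed.

Let muAoo m i : (mu (A m i) < +oo)%E.
Proof. by rewrite muA ltry. Qed.

Let disjA m i m' i' x : A m i x -> A m' i' x -> (m, i) = (m', i').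
Proof.
have H k j : A k j x -> alpha * k%:R <= x < alpha * k.+1%:R.
  rewrite -natr1 mulrDr mulr1 /A; case: j => /=; rewrite in_itv/=;
    by move=> /andP[h1 h2]; have := p0; have := pa; have := ca; move=> *; apply/andP; split; lra.
move=> h h'; have /andP[h1 h2] := H _ _ h; have /andP[h3 h4] := H _ _ h'.
have mm : m = m'.
  have := le_lt_trans h1 h4; have := le_lt_trans h3 h2.
  by rewrite !ltr_pM2l// !ltr_nat !ltnS => a1 a2; apply/eqP; rewrite eqn_leq a1 a2.
rewrite -{}mm in h' *; congr pair.
by move: h h'; rewrite /A; case: i i' => [] [] //=; rewrite !in_itv/=;
  move=> /andP[h5 h6] /andP[h7 h8]; exfalso;
  [have := le_lt_trans h5 h8|have := le_lt_trans h7 h6]; rewrite ltxx.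
Qed.

(** Time-frequency shifts map base atoms exactly to atoms, so approximating the two base atoms
    approximates all of them equally well. *)
Let shift_box m n i b (t : R) : box p (A m i) n b t =
  (if b then 'i%C else 1) * expi (2 * pi * beta * n%:~R * t) *
  box p (A 0 i) 0 false (t - alpha * m%:R).
Proof.
rewrite /box pV !mulr0 !mul0r expi0 !mulr1.
have -> : \1_(A m i) t = \1_(A 0 i) (t - alpha * m%:R) :> R.
  rewrite !indicE (_ : (t \in A m i) = (t - alpha * m%:R \in A 0 i))//.
  by apply/idP/idP; rewrite !inE /A; case: i => /=;
    rewrite !in_itv/= mulr0 ?add0r lerBrDl ltrBlDl ?addr0.
by rewrite [RHS]mulrC -!mulrA.
Qed.

Section Counting.
Variables (K r : nat).
Let L := (K + r.*2)%N.
Let J := ('I_L * 'I_L * bool)%type.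

Let v (j : J) : V := fun t => (if j.2 then 'i%C else 1) *
  gabor g alpha beta (j.1.1%:Z - r%:Z) (j.1.2%:Z - r%:Z) t.

Let Lv j : L2 (v j).
Proof. exact: (L2Zc _ (L2_gabor alpha beta _ _ Lg)). Qed.

Let gspan (w : V) := exists d : J -> R, w = \sum_j d j *: v j.

Let span0 : gspan 0.
Proof. by exists (fun=> 0); rewrite big1// => j _; rewrite scale0r. Qed.

Let spanD u w : gspan u -> gspan w -> gspan (u + w).
Proof.
move=> [d ->] [e ->]; exists (fun j => d j + e j).
by rewrite -big_split/=; apply: eq_bigr => j _; rewrite scalerDl.
Qed.

Let span_gen (a b : 'I_L) (z : C) : gspan (fun t => z *
  gabor g alpha beta (a%:Z - r%:Z) (b%:Z - r%:Z) t).
Proof.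
exists (fun j => (j == (a, b, false))%:R * Re z + (j == (a, b, true))%:R * Im z).
under eq_bigr do rewrite scalerDl -!scalerA.
have pick (j0 : J) (F : J -> V) : \sum_j (j == j0)%:R *: F j = F j0.
  rewrite (bigD1 j0)//= eqxx scale1r big1 ?addr0// => j /negbTE ->.
  by rewrite scale0r.
rewrite big_split/= !pick; apply/funext => t /=.
rewrite -[RHS]/(Re z *: (v (a, b, false) t) + Im z *: (v (a, b, true) t)).
rewrite !RcomplexZ /v /= mul1r mulrA -mulrDl; congr (_ * _).
by apply: complexP; rewrite !(cReD, cImD, cReM, cImM) /=; ring.
Qed.

(** Translations and modulations commute up to a unimodular constant, which is absorbed into the
    coefficient; shifting by indices below [K] enlarges the index range from [r] to [K + r]. *)
Let span_shift (s : seq (int * int * C)) (m n : 'I_K) (z : C) : indices_le r s ->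
  gspan (fun t => z * expi (2 * pi * beta * n%:~R * t) *
    lincomb (gabor g alpha beta) s (t - alpha * m%:R)).
Proof.
elim: s => [_|[[m' n'] z'] s IH /= /andP[/andP[/= hm hn] hs]].
  rewrite (_ : (fun _ => _) = 0); first exact: span0.
  by apply/funext => t; rewrite /lincomb big_nil mulr0.
have [a ha] := shift_index_lt (ltn_ord m) hm.
have [b hb] := shift_index_lt (ltn_ord n) hn.
have := spanD (span_gen a b (z * z' * expi (- (2 * pi * beta * n'%:~R * (alpha * m%:R))))) (IH hs).
congr gspan; apply/funext => t.
rewrite /lincomb big_cons (mulrDr (z * expi _)).
apply: (f_equal2 (fun u1 u2 : C => u1 + u2)); last by [].
rewrite /=.
rewrite /gabor ha hb !rmorphD/=.
have -> : t - alpha * (m%:~R + m'%:~R) = t - alpha * m%:R - alpha * m'%:~R by ring.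
have -> : 2 * pi * beta * n'%:~R * (t - alpha * m%:R) =
  2 * pi * beta * n'%:~R * t + - (2 * pi * beta * n'%:~R * (alpha * m%:R)) by ring.
have -> : 2 * pi * beta * (n%:~R + n'%:~R) * t =
  2 * pi * beta * n%:~R * t + 2 * pi * beta * n'%:~R * t by ring.
rewrite 2!expiD.
move: (expi _) (expi _) (expi _) (g _) => e1 e2 e3 e4; ring.
Qed.

(** The trace inequality divided by 2: the trace is [2 K^2 (1 + (c - p) / p)], there are [4 K^2]
    vectors [x], and the approximating space has [2 L^2] generators. *)
Lemma gabor_count (s : bool -> seq (int * int * C)) (eps : R) :
  (forall i, indices_le r (s i)) ->
  (forall i, (n2 setT (fun x => box p (A 0 i) 0 false x -
     lincomb (gabor g alpha beta) (s i) x)%R <= eps%:E)%E) ->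
  K%:R ^+ 2 * (1 + (c - p) / p - 2 * eps) <= L%:R ^+ 2.
Proof.
move=> hs heps.
pose I := (('I_K * bool) * ('I_K * bool))%type.
pose x (q : I) : V := box p (A q.1.1 q.1.2) q.2.1%:Z q.2.2.
have Lx q : L2 (x q) by exact: (L2_box p0 _ _ (mA _ _) (muAoo _ _)).
have ipx q : ip (x q) (x q) = if q.1.2 then (c - p) / p else 1.
  apply: EFin_inj; rewrite L2_n2// n2_box// muA -EFinM mulrC.
  by case: ifP => // _; rewrite mulfV// gt_eqF.
(* The sets [A m i] are pairwise disjoint and Bessel's inequality holds on each of them, so the
   whole family has Bessel bound 1. *)
have bx u : L2 u -> \sum_q ip u (x q) ^+ 2 <= ip u u.
  move=> Lu; have [mu' _] := (L2P u).1 Lu.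
  rewrite -lee_fin (L2_n2 Lu) -(pair_bigA _ (fun mi nb => ip u (x (mi, nb)) ^+ 2))/=.
  rewrite -sumEFin.
  apply: (@le_trans _ _ (\sum_(mi : 'I_K * bool) n2 (A mi.1 mi.2) u)%E).
    apply: lee_sum => -[m i] _ /=.
    pose u0 := if i then alpha * m%:R + p else alpha * m%:R.
    apply: (@box_bessel R p p0 'I_K (fun n => n%:Z) (A m i) u0) => //.
      by move=> n n' [] /val_inj.
    rewrite /A /u0 {u0}; case: i => y /=; rewrite !in_itv/= => /andP[-> h] //=.
    by have := cp; lra.
  apply: sum_n2_disjoint => // -[m i] [m' i'] y h h'.
  have := disjA h h' => -[] /val_inj -> ->; by [].
have ub (b : bool) : sqmod (if b then 'i%C else 1 : C) = 1.
  by case: b; rewrite /sqmod/= ?expr1n ?expr0n/= ?addr0 ?add0r.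
have hd (q : I) : exists d : J -> R,
    let rr := x q - \sum_j d j *: v j in ip rr rr <= eps.
  case: q => [[m i] [n b]].
  have [d hd] := span_shift (s := s i) m n (if b then 'i%C else 1) (hs i).
  exists d; cbv zeta; rewrite -hd.
  rewrite -lee_fin L2_n2; last first.
    apply: L2D => //; rewrite -scaleN1r; apply: L2Z.
    rewrite hd; exact: (@span_sum R V (@L2 R) (@L20 R) (@L2D R) _ _ _
      (fun j => L2Z (d j) (Lv j))).
  apply: le_trans (heps i); rewrite -[X in (_ <= X)%E](n2_shift (- (alpha * m%:R))).
    rewrite le_eqVlt; apply/orP; left; apply/eqP; apply: eq_nnint => t _.
    rewrite -[X in sqmod X]/(x ((m, i), (n, b)) t - _).
    rewrite /x /= shift_box -mulrBr !sqmodM sqmod_expi mulr1.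
    by rewrite ub mul1r.
  have [mb _] := (L2P _).1 (L2_box p0 0 false (mA 0 i) (muAoo 0 i)).
  apply: cmeasB => //; apply: cmeas_sum => q; apply: cmeasM; first exact: cmeas_cst.
  exact: ((L2P _).1 (L2_gabor alpha beta _ _ Lg)).1.
have := @trace_bound_fin R V (@L2 R) (@ip R) (@L20 R) (@L2D R) (@L2Z R) (@ipDl R)
  (@ipZl R) (@ipC R) (@ip_ge0 R) I J x v eps Lx Lv bx hd.
have -> : \sum_q ip (x q) (x q) = 2 * K%:R ^+ 2 * (1 + (c - p) / p).
  rewrite (eq_bigr (fun q : I => if q.1.2 then (c - p) / p else 1)) //.
  rewrite -(pair_bigA _ (fun (mi nb : 'I_K * bool) => if mi.2 then (c - p) / p else 1))/=.
  under eq_bigr do rewrite sumr_const.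
  rewrite -(pair_bigA _ (fun (m : 'I_K) i => (if i then (c - p) / p else 1) *+ #|{: 'I_K * bool}|))/=.
  under eq_bigr do rewrite big_bool/=.
  rewrite sumr_const !card_prod !card_ord card_bool.
  set a := (c - p) / p.
  have -> : (a *+ (K * 2) + 1 *+ (K * 2)) *+ K = K%:R * ((K%:R * 2) * (a + 1)).
    by rewrite -mulrnDl -(mulr_natl _ K) -(mulr_natl (a + 1)) natrM.
  by ring.
rewrite /I !card_prod !card_ord card_bool !natrM => h.
by rewrite !expr2; lra.
Qed.

End Counting.

Theorem gabor_incomplete : ~ complete_L2 (gabor g alpha beta).
Proof.
move=> H; pose d := (c - p) / p.
have d0 : 0 < d by rewrite divr_gt0// subr_gt0.
have d8 : 0 < d / 8 by rewrite divr_gt0.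
have /choice[s hs] : forall i, exists s, (n2 setT (fun x =>
    box p (A 0 i) 0 false x - lincomb (gabor g alpha beta) s x)%R < (d / 8)%:E)%E.
  by move=> i; apply: (H _ _ _ d8); exact: (L2_box p0 _ _ (mA _ _) (muAoo _ _)).
have [r0 h0] := ex_indices_le (s false); have [r1 h1] := ex_indices_le (s true).
pose r := (r0 + r1)%N.
have hr i : indices_le r (s i).
  by case: i; [apply: indices_leW h1|apply: indices_leW h0];
    rewrite /r ?leq_addl ?leq_addr.
(* This gives [r <= K] and [16 (r + 1) < K d], so the excess [4 K r + 4 r^2 <= 8 K r] of
   [(K + 2 r)^2] over [K^2] stays below [K^2 d / 2], while the left side exceeds [K^2] by
   [3 K^2 d / 4]. *)
pose K := (Num.truncn (16 * (r%:R + 1) / d) + r).+1.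
have := @gabor_count K r s (d / 8) hr (fun i => ltW (hs i)).
rewrite -/d natrD.
have -> : (r.*2)%:R = 2 * r%:R :> R by rewrite -muln2 natrM; ring.
have hK : 16 * (r%:R + 1) < K%:R * d.
  rewrite -ltr_pdivrMr//; apply: lt_le_trans (truncnS_gt _) _.
  by rewrite ler_nat /K ltnS leq_addr.
have hr' : r%:R <= K%:R :> R by rewrite ler_nat ltnW// ltnS leq_addl.
have r00 : 0 <= r%:R :> R by [].
have k0 : 0 < K%:R :> R by rewrite ltr0n.
move: (K%:R) (r%:R) hK hr' r00 k0 => k x hK hr' r00 k0.
apply/negP; rewrite -ltNge.
have e1 : 0 < k * (k * d - 16 * (x + 1)) by rewrite mulr_gt0// subr_gt0.
have e2 : 0 <= x * (k - x) by rewrite mulr_ge0// subr_ge0.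
have e3 : 0 < k * k * d by apply: mulr_gt0 => //; exact: mulr_gt0.
have -> : (k + 2 * x) ^+ 2 = k * k + 4 * (k * x) + 4 * (x * x) by ring.
have -> : k ^+ 2 * (1 + d - 2 * (d / 8)) = k * k + 3 / 4 * (k * k * d) by field.
have e1' : 0 < k * k * d - 16 * (k * x) - 16 * k.
  by rewrite (_ : _ - 16 * k = k * (k * d - 16 * (x + 1)))//; ring.
have e2' : 0 <= k * x - x * x by rewrite (_ : _ - _ = x * (k - x))//; ring.
have e4 : 0 <= k * x by rewrite mulr_ge0// ltW.
lra.
Qed.

End Incompleteness.

(** * Density of trigonometric polynomials *)

Section DominatedVanishing.
Variable R : realType.
Local Notation mu := (@lebesgue_measure R).
Local Open Scope classical_set_scope.

Lemma nnint_dominated_small (D : set R) (F : nat -> R -> R) (G : R -> R) (eps : R) :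
  measurable D -> (forall n, measurable_fun setT (F n)) -> measurable_fun setT G ->
  (forall n x, 0 <= F n x) -> (forall n x, D x -> F n x <= G x) ->
  (nnint D G < +oo)%E ->
  (forall x, D x -> F n x @[n --> \oo] --> (0 : R)) -> 0 < eps ->
  exists n, (nnint D (F n) < eps%:E)%E.
Proof.
move=> mD mF mG F0 FG Goo Fcvg e0.
have mE (H : R -> R) : measurable_fun setT H -> measurable_fun D (fun x => (H x)%:E).
  by move=> mH; apply/measurable_EFinP; exact: measurable_funTS.
have [|||||_ _] := @dominated_convergence _ (measurableTypeR R) R mu D mD
  (fun n x => (F n x)%:E) (cst 0%E) (fun x => (G x)%:E).
- by move=> n; exact: mE.
- exact: measurable_cst.
- by apply: aeW => x Dx; apply: cvg_EFin; [exact: nearW|exact: Fcvg].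
- apply/(@integrableP _ (measurableTypeR R)); split; first exact: mE.
  rewrite (_ : (\int[mu]_(x in D) _)%E = nnint D G)//; apply: eq_integral => x.
  rewrite inE => Dx /=; rewrite ger0_norm//.
  exact: le_trans (F0 0%N x) (FG 0%N x Dx).
- by apply: aeW => x n Dx /=; rewrite lee_fin ger0_norm// FG.
rewrite integral0 => /fine_cvgP[hfin /cvgrPdist_lt/(_ _ e0) hlt].
have [n] : exists n, nnint D (F n) \is a fin_num /\ `|0 - fine (nnint D (F n))| < eps.
  have := filterI hfin hlt; case=> n _ /(_ n (leqnn _)) /= [h1 h2].
  by exists n.
move=> [h1 h2]; exists n; rewrite -(fineK h1) lte_fin.
by move: h2; rewrite sub0r normrN; apply: le_lt_trans; exact: ler_norm.
Qed.

End DominatedVanishing.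

Section TrigKernel.
Variable R : realType.
Local Notation C := R[i].

(** This is [cos (y / 2) ^ (2 n)], a nonnegative trigonometric polynomial of degree [n] that
    concentrates at the multiples of 2 pi. *)
Definition kern (n : nat) (y : R) : R := ((1 + cos y) / 2) ^+ n.

Lemma kern_ge0 n y : 0 <= kern n y.
Proof. by rewrite exprn_ge0// divr_ge0// -lerBlDl sub0r cos_geN1. Qed.

(** Reduces the moment of [1 - cos] against the kernel to two consecutive means of kernels. *)
Lemma kern_cos n y : kern n y * (1 - cos y) = 2 * (kern n y - kern n.+1 y).
Proof. by rewrite /kern exprS; field. Qed.

Lemma expiMn (y : R) n : expi (y *+ n) = expi y ^+ n.
Proof. by elim: n => [|n IH]; rewrite ?expi0// mulrS expiD IH exprS. Qed.

Lemma expi_neq0 (y : R) : expi y != 0 :> C.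
Proof. by rewrite -sqmod_eq0 sqmod_expi oner_eq0. Qed.

Lemma kern_base (y : R) : ((1 + cos y) / 2)%:C = (4^-1 : R)%:C * (expi (- y) * (1 + expi y) ^+ 2).
Proof.
have -> : expi (- y) * (1 + expi y) ^+ 2 = expi (- y) + (2 : R)%:C + expi y.
  have -> : (2 : R)%:C = 2 :> C by rewrite rmorph_nat.
  by rewrite expiN; field; exact: expi_neq0.
by apply: complexP; rewrite !(cReM, cImM, cReD, cImD)/= ?cosN ?sinN; field.
Qed.

Lemma kern_expand n y : (kern n y)%:C = ((4^-1 : R) ^+ n)%:C *
  \sum_(j < n.*2.+1) 'C(n.*2, j)%:R * expi ((j%:Z - n%:Z)%:~R * y).
Proof.
rewrite /kern rmorphXn/= kern_base exprMn rmorphXn; congr (_ * _).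
rewrite exprMn -exprM mul2n exprDn -expiMn mulr_sumr; apply: eq_bigr => j _.
rewrite expr1n mul1r -mulr_natl mulrCA; congr (_ * _).
rewrite -expiMn -expiD; congr expi.
by rewrite intrB -!pmulrn mulrBl !mulr_natl mulNrn addrC.
Qed.

Lemma expi_eq1 (u : R) : 0 < u < pi -> expi (u + u) != 1.
Proof.
move=> hu; apply/eqP => /(congr1 (@complex.Re R)) /=.
rewrite cosD -!expr2 sin2cos2.
have := sin_gt0_pi hu; have := cos2Dsin2 u => h1 h2 h3.
have : sin u ^+ 2 = 0 by lra.
by move/eqP; rewrite sqrf_eq0 gt_eqF.
Qed.

Lemma expi_root_neq1 (L : nat) (k : int) : (absz k < L)%N -> k != 0 ->
  expi (2 * pi * (k%:~R / L%:R) : R) != 1.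
Proof.
move=> kL k0.
have L0 : 0 < L%:R :> R by rewrite ltr0n; apply: leq_ltn_trans kL.
suff h (m : nat) : (0 < m)%N -> (m < L)%N -> expi (2 * pi * (m%:R / L%:R) : R) != 1.
  case: k kL k0 => m mL m0; first by apply: h => //; rewrite lt0n; apply: contra m0 => /eqP ->.
  rewrite NegzE mulrNz mulNr mulrN expiN invr_eq1; exact: h.
move=> m0 mL.
have -> : 2 * pi * (m%:R / L%:R) = pi * (m%:R / L%:R) + pi * (m%:R / L%:R) :> R by ring.
have m0' : 0 < m%:R :> R by rewrite ltr0n.
apply: expi_eq1; apply/andP; split.
  by apply: mulr_gt0; [exact: pi_gt0|exact: divr_gt0].
by rewrite gtr_pMr ?pi_gt0// ltr_pdivrMr// mul1r ltr_nat.
Qed.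

Lemma sum_roots (L : nat) (k : int) (th : R) : (absz k < L)%N ->
  \sum_(l < L) expi (k%:~R * (th - 2 * pi * (l%:R / L%:R))) =
  if k == 0 then L%:R else 0.
Proof.
move=> kL; case: eqVneq => [->|k0].
  under eq_bigr do rewrite mul0r expi0.
  by rewrite sumr_const card_ord.
have L0 : L%:R != 0 :> R by rewrite pnatr_eq0 -lt0n; apply: leq_ltn_trans kL.
pose z : C := expi (2 * pi * ((- k)%:~R / L%:R)).
have z1 : z != 1 by apply: expi_root_neq1; rewrite ?abszN ?oppr_eq0.
rewrite (eq_bigr (fun l : 'I_L => expi (k%:~R * th) * z ^+ l)); last first.
  move=> l _; rewrite -expiMn -expiD; congr expi.
  by rewrite mulrNz -mulr_natl; field.
rewrite -mulr_sumr; suff -> : \sum_(l < L) z ^+ l = 0 by rewrite mulr0.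
apply: (mulfI (x := z - 1)); first by rewrite subr_eq0.
rewrite mulr0 -subrX1 /z -expiMn
  -(mulr_natl (2 * pi * _) L).
have -> : L%:R * (2 * pi * ((- k)%:~R / L%:R)) = 2 * pi * (- k)%:~R :> R by field.
by rewrite expi_2piz subrr.
Qed.

(** An equidistant quadrature with more than [n] nodes is exact in degree [n]: only the constant
    term of the expansion, [j = n], survives. *)
Lemma sum_kern (n L : nat) (th : R) : (n < L)%N ->
  \sum_(l < L) kern n (th - 2 * pi * (l%:R / L%:R)) =
  L%:R * ('C(n.*2, n)%:R * 4^-1 ^+ n).
Proof.
move=> nL; apply: (@complexI R); rewrite rmorph_sum/=.
under eq_bigr do rewrite kern_expand.
rewrite -mulr_sumr exchange_big/=.
under eq_bigr do rewrite -mulr_sumr.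
have nn : (n < n.*2.+1)%N by rewrite ltnS -addnn leq_addr.
rewrite (bigD1 (Ordinal nn))//= [X in _ + X]big1 => [|j jn].
  rewrite sum_roots ?subrr ?absz0 ?(leq_ltn_trans _ nL)// eqxx addr0.
  by rewrite !rmorphM/= !rmorph_nat; ring.
rewrite sum_roots; last first.
  apply: leq_ltn_trans nL; have := ltn_ord j; rewrite ltnS; lia.
by rewrite subr_eq0 eqz_nat ifN ?mulr0.
Qed.

(** Consecutive kernel means thus have ratio [(2 n + 1) / (2 n + 2)], from which the decay rate
    [1 / (n + 1)] of the kernel moment follows. *)
Lemma central_bin_rec n : (n.+1 * 'C(n.+1.*2, n.+1) = 2 * (n.*2.+1 * 'C(n.*2, n)))%N.
Proof.
have fact_sq m : ('C(m.*2, m) * (m`! * m`!) = m.*2`!)%N.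
  have e : (m.*2 - m = m)%N by rewrite -addnn addnK.
  by have := @bin_fact m.*2 m; rewrite e; apply; rewrite -addnn leq_addr.
have h1 := fact_sq n; have h2 := fact_sq n.+1.
rewrite doubleS !factS -h1 in h2.
have f0 : (0 < n`! * n`!)%N by rewrite muln_gt0 fact_gt0.
apply/eqP; rewrite -(eqn_pmul2r f0) -(eqn_pmul2l (ltn0Sn n)); apply/eqP.
rewrite doubleS.
transitivity ('C(n.*2.+2, n.+1) * (n.+1 * n`! * (n.+1 * n`!)))%N; first by lia.
by rewrite h2; lia.
Qed.

End TrigKernel.

Section TrigDensity.
Variable R : realType.
Local Notation C := R[i].
Local Notation mu := (@lebesgue_measure R).
Local Open Scope classical_set_scope.

Definition trig_eval (p : R) (s : seq (int * C)) (x : R) : C :=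
  \sum_(q <- s) q.2 * expi (2 * pi * p^-1 * q.1%:~R * x).

Definition trigpoly (p : R) (f : R -> C) := exists s, f =1 trig_eval p s.

Lemma cmeas_trig p s : cmeas (trig_eval p s).
Proof.
apply: cmeas_sum => q; apply: cmeasM; first exact: cmeas_cst.
exact: cmeas_expi.
Qed.

Lemma trigpoly_mono p z k : trigpoly p (fun x => z * expi (2 * pi * p^-1 * k%:~R * x)).
Proof. by exists [:: (k, z)] => x; rewrite /trig_eval big_seq1. Qed.

Lemma trigpoly_cst p z : trigpoly p (fun=> z).
Proof.
have [s hs] := trigpoly_mono p z 0; exists s => x.
by rewrite -hs mulr0 mul0r expi0 mulr1.
Qed.

Lemma trigpolyD p f g : trigpoly p f -> trigpoly p g -> trigpoly p (fun x => f x + g x).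
Proof.
by move=> [s hs] [t ht]; exists (s ++ t) => x; rewrite /trig_eval big_cat hs ht.
Qed.

Lemma trigpolyM p f g : trigpoly p f -> trigpoly p g -> trigpoly p (fun x => f x * g x).
Proof.
move=> [s hs] [t ht]; exists [seq (q.1 + r.1, q.2 * r.2) | q <- s, r <- t] => x.
rewrite hs ht /trig_eval big_allpairs_dep mulr_suml; apply: eq_bigr => q _.
rewrite mulr_sumr; apply: eq_bigr => r _ /=.
by rewrite intrD (mulrDr (2 * pi / p)) (mulrDl _ _ x) expiD mulrACA.
Qed.

Lemma trigpoly_sum p I (r : seq I) (F : I -> R -> C) :
  (forall i, trigpoly p (F i)) -> trigpoly p (fun x => \sum_(i <- r) F i x).
Proof.
move=> tF; elim: r => [|i r IH].
  by have [s hs] := trigpoly_cst p 0; exists s => x; rewrite big_nil -hs.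
have [s hs] := trigpolyD (tF i) IH; exists s => x.
by rewrite big_cons -hs.
Qed.

Lemma trigpolyX p f n : trigpoly p f -> trigpoly p (fun x => f x ^+ n).
Proof.
move=> tf; elim: n => [|n IH]; first exact: trigpoly_cst.
have [s hs] := trigpolyM tf IH; exists s => x.
by rewrite exprS -hs.
Qed.

Section Kernel.
Variables (p a : R) (h : R -> R) (M : R).
Hypothesis p0 : 0 < p.
Hypothesis ch : continuous h.
Hypothesis hM : forall x, `|h x| <= M.

Let pn0 : p != 0. Proof. by rewrite gt_eqF. Qed.
Let node (L l : nat) := a + p * (l%:R / L%:R).

Let mean (n : nat) : R := n.+2%:R * ('C(n.*2, n)%:R * 4^-1 ^+ n).

Let mean_gt0 n : 0 < mean n.
Proof.
rewrite /mean mulr_gt0 ?ltr0n// mulr_gt0 ?exprn_gt0 ?invr_gt0// ltr0n bin_gt0.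
by rewrite -addnn leq_addr.
Qed.

Let angle L l x : 2 * pi * p^-1 * (x - node L l) =
  2 * pi * p^-1 * (x - a) - 2 * pi * (l%:R / L%:R).
Proof. by rewrite /node; move: (l%:R / L%:R) => q; field. Qed.

(* A quadrature version of the convolution with [((1 + cos) / 2) ^ n]; with
   [n + 2] nodes the kernel sums to the constant [mean n] at every [x]. *)
Definition jackson n x : R :=
  (\sum_(l < n.+2) h (node n.+2 l) * kern n (2 * pi * p^-1 * (x - node n.+2 l))) / mean n.

Let sumk n x : \sum_(l < n.+2) kern n (2 * pi * p^-1 * (x - node n.+2 l)) = mean n.
Proof.
by under eq_bigr do rewrite angle; rewrite sum_kern.
Qed.

(** The moment involves [kern n.+1] as well, of degree [n + 1]; this is why there are [n + 2] nodes
    and not [n + 1]. *)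
Let sumkc n x : \sum_(l < n.+2) kern n (2 * pi * p^-1 * (x - node n.+2 l)) *
  (1 - cos (2 * pi * p^-1 * (x - node n.+2 l))) = mean n / n.+1%:R.
Proof.
under eq_bigr do rewrite kern_cos angle.
rewrite -mulr_sumr sumrB !sum_kern// /mean.
have h1 : (n.+1)%:R * 'C(n.+1.*2, n.+1)%:R = 2 * (n.*2.+1%:R * 'C(n.*2, n)%:R) :> R.
  by rewrite -natrM central_bin_rec !natrM.
have n1 : n.+1%:R != 0 :> R by rewrite pnatr_eq0.
have -> : 'C(n.+1.*2, n.+1)%:R = 2 * (n.*2.+1%:R * 'C(n.*2, n)%:R) / n.+1%:R :> R.
  by rewrite -h1 mulrC mulKf.
rewrite exprS -!natr1 -muln2 natrM; rewrite -natr1 in n1.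
by field; rewrite n1.
Qed.

Lemma trigpoly_jackson n : trigpoly p (fun x => (jackson n x)%:C).
Proof.
pose F (l : 'I_n.+2) x : C := (h (node n.+2 l) / mean n)%:C *
  ((kern 1 (2 * pi * p^-1 * (x - node n.+2 l)))%:C ^+ n).
suff [s hs] : trigpoly p (fun x => \sum_l F l x).
  exists s => x; rewrite -hs /jackson mulr_suml rmorph_sum/=.
  apply: eq_bigr => l _; rewrite /F -rmorphXn/= -rmorphM/= /kern expr1.
  by congr (_%:C); ring.
apply: trigpoly_sum => l; apply: trigpolyM; first exact: trigpoly_cst.
apply: trigpolyX; set c := node _ _.
pose k := 2 * pi * p^-1.
have [s hs] : trigpoly p (fun x => (2^-1 : R)%:C + ((4^-1 : R)%:C * expi (- (k * c)) *
   expi (2 * pi * p^-1 * 1%:~R * x) + (4^-1 : R)%:C * expi (k * c) *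
   expi (2 * pi * p^-1 * (-1)%:~R * x))).
  apply: trigpolyD; first exact: trigpoly_cst.
  by apply: trigpolyD; exact: trigpoly_mono.
exists s => x; rewrite -hs -!(mulrA (4^-1 : R)%:C) -!expiD.
have -> : - (k * c) + 2 * pi * p^-1 * 1%:~R * x = 2 * pi * p^-1 * (x - c).
  by rewrite /k; ring.
have -> : k * c + 2 * pi * p^-1 * (-1)%:~R * x = - (2 * pi * p^-1 * (x - c)).
  by rewrite /k mulrN1z; ring.
move: (2 * pi * p^-1 * (x - c)) => y; rewrite /kern expr1.
by apply: complexP; rewrite !(cReD, cImD, cReM, cImM) /= cosN ?sinN; field.
Qed.

Lemma jackson_le n x : `|jackson n x| <= M.
Proof.
rewrite /jackson normrM [`|_^-1|]gtr0_norm ?invr_gt0// ler_pdivrMr//.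
apply: le_trans (ler_norm_sum _ _ _) _.
rewrite -(sumk n x) mulr_sumr; apply: ler_sum => l _.
by rewrite normrM [`|kern _ _|]ger0_norm ?kern_ge0// ler_wpM2r ?kern_ge0.
Qed.

(** Korovkin's test function: near [x] continuity gives [eps], and elsewhere [1 - cos] is bounded
    below, so a large multiple of it dominates [2 M]. The point is interior because [1 - cos] also
    vanishes when [y] is a full period away. *)
Lemma jackson_continuous_bound x eps : 0 < eps -> a < x < a + p ->
  exists K, 0 <= K /\ forall y, a <= y < a + p ->
   `|h y - h x| <= eps + K * (1 - cos (2 * pi * p^-1 * (x - y))).
Proof.
move=> e0 /andP[ax xp].
have [d d0 hd] : exists2 d, 0 < d & forall y, `|x - y| < d -> `|h y - h x| <= eps.
  have /cvgrPdist_le/(_ _ e0) [d /= d0 hd] := @ch x.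
  by exists d => // y xy; rewrite distrC; exact: hd.
(* For [y] in the cell with [d <= |x - y|], this [q] confines [pi |x - y| / p] to
   [[pi q, pi - pi q]], where the sine has a positive minimum. *)
pose q := Num.min (d / p) (Num.min ((x - a) / p) ((a + p - x) / p)).
have q0 : 0 < q by rewrite !lt_min !divr_gt0 ?subr_gt0.
have qd : q <= d / p by rewrite ge_min lexx.
have q1 : q <= (x - a) / p by rewrite /q !ge_min lexx !orbT.
have q2 : q <= (a + p - x) / p by rewrite /q !ge_min lexx !orbT.
have q3 : (x - a) / p + (a + p - x) / p = 1 by field.
pose m := pi * q.
have m0 : 0 < m by rewrite mulr_gt0 ?pi_gt0.
have m2 : m <= pi - m.
  by rewrite lerBrDr -mulrDr -[leRHS]mulr1 ler_pM2l ?pi_gt0//; lra.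
have [v0 v0m hv] := @EVT_min R (@sin R) m (pi - m) m2
  (continuous_subspaceT (@continuous_sin R)).
have s0 : 0 < sin v0.
  by apply: sin_gt0_pi; move: v0m; rewrite in_itv/= => /andP[h1 h2]; apply/andP; split; lra.
pose K := 2 * M / (2 * sin v0 ^+ 2).
have M0 : 0 <= M by apply: le_trans (hM 0).
have K0 : 0 <= K by rewrite divr_ge0// mulr_ge0// exprn_ge0// ltW.
exists K; split => // y /andP[ay yp].
have [xy|xy] := ltP (`|x - y|) d.
  apply: le_trans (hd _ xy) _; rewrite lerDl mulr_ge0// subr_ge0; exact: cos_le1.
apply: (@le_trans _ _ (2 * M)).
  apply: le_trans (ler_normB _ _) _.
  by rewrite (_ : 2 * M = M + M) ?lerD//; ring.
rewrite -[leLHS]add0r; apply: lerD; first exact: ltW.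
pose u := `|x - y|.
have -> : cos (2 * pi * p^-1 * (x - y)) = cos (pi * (u / p) *+ 2).
  rewrite /u; have [_|_] := ger0P (x - y); last rewrite -[LHS]cosN; congr cos;
    by rewrite mulr2n; field.
rewrite cos_mulr2n cos2sin2.
have sv : sin v0 <= sin (pi * (u / p)).
  apply: hv; rewrite in_itv/=; apply/andP; split.
    rewrite /m ler_pM2l ?pi_gt0//; apply: le_trans qd _.
    by rewrite ler_pM2r ?invr_gt0.
  rewrite lerBrDr -mulrDr -[leRHS]mulr1 ler_pM2l ?pi_gt0//.
  have : u / p <= 1 - (x - a) / p \/ u / p <= 1 - (a + p - x) / p.
    rewrite /u; have [_|_] := ger0P (x - y); [right|left];
    rewrite ler_pdivrMr// mulrBl divfK// mul1r; lra.
  by move=> [] ?; lra.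
have -> : 1 - ((1 - sin (pi * (u / p)) ^+ 2) *+ 2 - 1) = 2 * sin (pi * (u / p)) ^+ 2.
  by ring.
have d1 : 0 < 2 * sin v0 ^+ 2 by rewrite mulr_gt0// exprn_gt0.
rewrite /K [leRHS]mulrAC ler_pdivlMr// ler_wpM2l ?mulr_ge0//.
by rewrite ler_pM2l// ler_sqr ?nnegrE ?(le_trans _ sv)// ltW.
Qed.

(** Averaging the preceding bound against the normalized kernel leaves [e / 2] unchanged and turns
    [K (1 - cos)] into [K / (n + 1)]. *)
Lemma jackson_cvg x : a < x < a + p -> jackson n x @[n --> \oo] --> h x.
Proof.
move=> hx; apply/cvgrPdist_le => e e0.
have e2 : 0 < e / 2 by rewrite divr_gt0.
have [K [K0 hK]] := jackson_continuous_bound e2 hx.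
pose n0 := Num.truncn (K / (e / 2)).
exists n0 => // n /= n0n.
have -> : h x - jackson n x = (\sum_(l < n.+2) (h x - h (node n.+2 l)) *
    kern n (2 * pi * p^-1 * (x - node n.+2 l))) / mean n.
  rewrite /jackson; under [in RHS]eq_bigr do rewrite mulrBl.
  by rewrite sumrB -mulr_sumr sumk mulrBl mulfK// gt_eqF.
rewrite normrM [`|_^-1|]gtr0_norm ?invr_gt0// ler_pdivrMr//.
apply: le_trans (ler_norm_sum _ _ _) _.
apply: (@le_trans _ _ (\sum_(l < n.+2) (e / 2 * kern n (2 * pi * p^-1 * (x - node n.+2 l)) +
   K * (kern n (2 * pi * p^-1 * (x - node n.+2 l)) *
   (1 - cos (2 * pi * p^-1 * (x - node n.+2 l))))))).
  apply: ler_sum => l _; rewrite normrM [`|kern _ _|]ger0_norm ?kern_ge0//.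
  have := hK (node n.+2 l); rewrite distrC => /(_ _) hl.
  have {}hl : `|h x - h (node n.+2 l)| <=
      e / 2 + K * (1 - cos (2 * pi * p^-1 * (x - node n.+2 l))).
    apply: hl; rewrite /node lerDl ltrD2l; apply/andP; split.
      by rewrite mulr_ge0 ?divr_ge0// ltW.
    by rewrite gtr_pMr// ltr_pdivrMr ?ltr0n// mul1r ltr_nat.
  have k0 := kern_ge0 n (2 * pi * p^-1 * (x - node n.+2 l)).
  by have := ler_wpM2r k0 hl; lra.
rewrite big_split/= -!mulr_sumr sumk sumkc.
have hn : K / n.+1%:R <= e / 2.
  rewrite ler_pdivrMr ?ltr0n// mulrC -ler_pdivrMr//; apply/ltW.
  by apply: lt_le_trans (truncnS_gt _) _; rewrite ler_nat ltnS.
rewrite (_ : K * _ = K / n.+1%:R * mean n); last by rewrite mulrA mulrAC.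
by rewrite [e in leRHS]splitr mulrDl lerD2l ler_wpM2r// ltW.
Qed.

End Kernel.
End TrigDensity.

Section TrigDensityL2.
Variable R : realType.
Local Notation C := R[i].
Local Notation mu := (@lebesgue_measure R).
Local Open Scope classical_set_scope.

Lemma sqmod_realB (u v : R) : sqmod (u%:C - v%:C) = (u - v) ^+ 2.
Proof. by rewrite -rmorphB sqmodR. Qed.

Lemma mu_itv_lty (a p : R) : (mu `[a, (a + p)%R[%classic < +oo)%E.
Proof. by rewrite lebesgue_measure_itv/=; case: ifP => // _; rewrite -EFinB ltry. Qed.

Lemma jackson_dense (p a M : R) (h : R -> R) eps : 0 < p -> continuous h ->
  (forall x, `|h x| <= M) -> 0 < eps ->
  exists s, (n2 `[a, (a + p)%R[ (fun x => (h x)%:C - trig_eval p s x)%R < eps%:E)%E.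
Proof.
move=> p0 ch hM e0.
have M0 : 0 <= M by apply: le_trans (hM 0).
have mh : measurable_fun setT h by exact: continuous_measurable_fun.
have /choice[s hs] : forall n, trigpoly p (fun x => (jackson p a h n x)%:C).
  by move=> n; exact: trigpoly_jackson.
pose F n x := sqmod ((h x)%:C - trig_eval p (s n) x).
have FE n x : F n x = (h x - jackson p a h n x) ^+ 2 by rewrite /F -hs sqmod_realB.
have mF n : measurable_fun setT (F n).
  by apply: measurable_sqmod; apply: cmeasB; [exact: cmeas_real|exact: cmeas_trig].
(* The endpoint [a] is removed since [h] need not take the same value at [a] and [a + p]; pointwise
   convergence is known only inside the cell. *)
have [n hn] : exists n, (nnint `]a, (a + p)%R[ (F n) < eps%:E)%E.
  apply: (nnint_dominated_small (G := cst ((2 * M) ^+ 2))) => //.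
  - by move=> n x; exact: sqmod_ge0.
  - move=> n x _ /=; rewrite FE -[leLHS]real_normK ?num_real//.
    rewrite ler_sqr ?nnegrE ?mulr_ge0//; apply: le_trans (ler_normB _ _) _.
    by rewrite (_ : 2 * M = M + M) ?lerD//; [exact: jackson_le|ring].
  - rewrite nnint_cst// lte_mul_pinfty ?lee_fin ?sqr_ge0//.
    apply: le_lt_trans (mu_itv_lty a p); apply: le_measure; rewrite ?inE//.
    by apply: subset_itvr; rewrite bnd_simp.
  - move=> x; rewrite /= in_itv/= => xa.
    have hc : (h x - jackson p a h n x) @[n --> \oo] --> (0 : R).
      rewrite -[X in _ --> X](subrr (h x)); apply: cvgB; first exact: cvg_cst.
      exact: (jackson_cvg p0 ch hM xa).
    rewrite (_ : (fun n => F n x) = (fun n => (h x - jackson p a h n x) * (h x - jackson p a h n x))).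
      by rewrite -[X in _ --> X](mulr0 0); apply: cvgM.
    by apply/funext => n; rewrite FE expr2.
exists (s n); rewrite /n2 /nnint integral_itv_bndoo; first exact: hn.
by apply/measurable_EFinP; apply: measurable_funTS; exact: mF.
Qed.

(** Truncation of [y] to [[- M, M]], written with absolute values so that continuity is
    immediate. *)
Definition clamp (M y : R) : R := (`|y + M| - `|y - M|) / 2.

Lemma clamp_le M y : 0 <= M -> `|clamp M y| <= M.
Proof.
move=> M0; rewrite /clamp ler_norml ler_pdivlMr// ler_pdivrMr//.
by case: (ger0P (y + M)); case: (ger0P (y - M)) => h1 h2; apply/andP; split; lra.
Qed.

Lemma clamp_dist M u y : `|u| <= M -> `|u - clamp M y| <= `|u - y|.
Proof.
rewrite ler_norml => /andP[h1 h2]; rewrite /clamp.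
case: (ger0P (y + M)); case: (ger0P (y - M)) => h3 h4;
  rewrite ler_norml; case: (ger0P (u - y)) => h5; apply/andP; split; lra.
Qed.

Lemma continuous_clamp M (g : R -> R) : continuous g -> continuous (fun x => clamp M (g x)).
Proof.
move=> cg x; rewrite /clamp; apply: cvgM; last exact: cvg_cst.
by apply: cvgB; apply: cvg_norm; [apply: cvgD|apply: cvgB];
  first [exact: cvg_cst|exact: cg].
Qed.

(** Continuous functions are first obtained close in the integral norm only. Clamping them at [M]
    does not increase the error and bounds it by [2 M], so its square is at most [2 M] times its
    absolute value: this gives closeness in mean square. *)
Lemma trig_dense_real (p a M : R) (h : R -> R) eps : 0 < p ->
  measurable_fun setT h -> (forall x, `|h x| <= M) -> 0 < eps ->
  exists s, (n2 `[a, (a + p)%R[ (fun x => (h x)%:C - trig_eval p s x)%R < eps%:E)%E.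
Proof.
move=> p0 mh hM e0.
have M0 : 0 <= M by apply: le_trans (hM 0).
pose D := `[a, (a + p)%R[%classic.
have mD : measurable D by exact: measurable_itv.
have ih : mu.-integrable D (EFin \o h).
  apply: measurable_bounded_integrable => //.
  - exact: mu_itv_lty.
  - exact: measurable_funTS.
  - by exists M; split; [exact: num_real|move=> y My x _; apply: le_trans (hM x) (ltW My)].
have [g [cg ig gcvg]] := approximation_continuous_integrable mD (mu_itv_lty a p) ih.
pose eta := eps / (4 * (2 * M + 1)).
have eta0 : 0 < eta by rewrite divr_gt0// mulr_gt0// ltr_wpDl// mulr_ge0.
have mg n : measurable_fun setT (g n) by apply: continuous_measurable_fun; exact: cg.
have [n hn] : exists n, (nnint D (fun x => `|h x - g n x|%R) < eta%:E)%E.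
  move/fine_cvgP : gcvg => [hfin /cvgrPdist_lt/(_ _ eta0) hlt].
  have [n _ /(_ n (leqnn _)) /= [h1 h2]] := filterI hfin hlt.
  exists n; rewrite /nnint -(fineK h1) lte_fin.
  by move: h2; rewrite sub0r normrN; apply: le_lt_trans; exact: ler_norm.
pose cl x := clamp M (g n x).
have ccl : continuous cl by apply: continuous_clamp; exact: cg.
have clM x : `|cl x| <= M by exact: clamp_le.
have e4 : 0 < eps / 4 by rewrite divr_gt0.
have [s hs] := jackson_dense a p0 ccl clM e4.
exists s.
have mcl : measurable_fun setT cl by exact: continuous_measurable_fun.
have E : (n2 D (fun x => (h x)%:C - trig_eval p s x)%R =
   n2 D (fun x => ((h x)%:C - (cl x)%:C) + ((cl x)%:C - trig_eval p s x))%R)%E.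
  by apply: eq_n2 => x _; ring.
rewrite E; apply: le_lt_trans (n2D_le _ _ _) _ => //.
- by apply: cmeasB; exact: cmeas_real.
- by apply: cmeasB; [exact: cmeas_real|exact: cmeas_trig].
have h1 : (n2 D (fun x => ((h x)%:C - (cl x)%:C)%R) < (eps / 4)%:E)%E.
  apply: (@le_lt_trans _ _ (nnint D (fun x => 2 * M * `|h x - g n x|))).
    apply: le_nnint => //.
    - by move=> x _; exact: sqmod_ge0.
    - by apply: measurable_sqmod; apply: cmeasB; exact: cmeas_real.
    - apply: measurable_funM => //; apply: measurableT_comp => //.
      exact: measurable_funB.
    - move=> x _; rewrite sqmod_realB -[leLHS]real_normK ?num_real// expr2.
      apply: ler_pM => //; last exact: clamp_dist.
      apply: le_trans (ler_normB _ _) _.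
      by rewrite (_ : 2 * M = M + M) ?lerD//; ring.
  rewrite nnintZ ?mulr_ge0//; last first.
    by apply: measurableT_comp => //; exact: measurable_funB.
  apply: (@le_lt_trans _ _ ((2 * M)%:E * eta%:E)%E).
    by rewrite lee_wpmul2l ?lee_fin ?mulr_ge0// ltW.
  rewrite -EFinM lte_fin /eta mulrA ltr_pdivrMr ?mulr_gt0 ?ltr_wpDl ?mulr_ge0//.
  by rewrite (_ : eps / 4 * _ = 2 * M * eps + eps); [rewrite ltrDl|field].
apply: (@lt_le_trans _ _ (2%:E * (eps / 4)%:E + 2%:E * (eps / 4)%:E)%E).
  by apply: lteD; rewrite lte_pmul2l.
by rewrite -!EFinM -EFinD lee_fin; lra.
Qed.

Lemma normr_sqr_le (x M : R) : 0 <= M -> x ^+ 2 <= M -> `|x| <= Num.sqrt M.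
Proof. by move=> M0 xM; rewrite -sqrtr_sqr ler_sqrt. Qed.

Lemma trig_dense (p a M : R) (f : R -> C) eps : 0 < p -> cmeas f ->
  (forall x, sqmod (f x) <= M) -> 0 < eps ->
  exists s, (n2 `[a, (a + p)%R[ (fun x => f x - trig_eval p s x)%R < eps%:E)%E.
Proof.
move=> p0 mf fM e0; have [m1 m2] := mf.
have M0 : 0 <= M by apply: le_trans (fM 0); exact: sqmod_ge0.
have e4 : 0 < eps / 4 by rewrite divr_gt0.
have [s hs] := trig_dense_real a p0 m1
  (fun x => normr_sqr_le M0 (le_trans (sqr_Re_le _) (fM x))) e4.
have [t ht] := trig_dense_real a p0 m2
  (fun x => normr_sqr_le M0 (le_trans (sqr_Im_le _) (fM x))) e4.
have [r hr] : trigpoly p (fun x => trig_eval p s x + 'i%C * trig_eval p t x).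
  apply: trigpolyD; first by exists s.
  by apply: trigpolyM; [exact: trigpoly_cst|exists t].
exists r; set D := `[_, _[%classic in hs ht *.
have mD : measurable D by exact: measurable_itv.
rewrite (_ : n2 D _ = n2 D (fun x => ((Re (f x))%:C - trig_eval p s x) +
   'i%C * ((Im (f x))%:C - trig_eval p t x))%R); last first.
  apply: eq_n2 => x _; rewrite -hr.
  have fx : f x = (Re (f x))%:C + 'i%C * (Im (f x))%:C.
    by apply: complexP; rewrite !(cReD, cImD, cReM, cImM) /=; ring.
  by rewrite {1}fx; move: (Re (f x))%:C (Im (f x))%:C => u v; ring.
apply: le_lt_trans (n2D_le _ _ _) _ => //.
- by apply: cmeasB; [exact: cmeas_real|exact: cmeas_trig].
- apply: cmeasM; first exact: cmeas_cst.
  by apply: cmeasB; [exact: cmeas_real|exact: cmeas_trig].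
rewrite (_ : n2 D (fun x => 'i%C * _)%R = n2 D (fun x => (Im (f x))%:C - trig_eval p t x)%R); last first.
  by apply: eq_nnint => x _; rewrite sqmodM /sqmod/= expr0n/= expr1n add0r mul1r.
apply: (@lt_le_trans _ _ (2%:E * (eps / 4)%:E + 2%:E * (eps / 4)%:E)%E).
  by apply: lteD; rewrite lte_pmul2l.
by rewrite -!EFinM -EFinD lee_fin; lra.
Qed.

End TrigDensityL2.

(** * Exponential sums *)

Section ExpSums.
Variable R : realType.
Local Notation C := R[i].
Local Open Scope classical_set_scope.
Implicit Types (f g : R -> C) (s : seq (C * C)).

Definition expsum_eval s (x : R) : C := \sum_(q <- s) q.1 * cexp (q.2 * x%:C).

Definition expsum f := exists s, f =1 expsum_eval s.

Lemma expsum_mono z l : expsum (fun x => z * cexp (l * x%:C)).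
Proof. by exists [:: (z, l)] => x; rewrite /expsum_eval big_seq1. Qed.

Lemma expsum_cst z : expsum (fun=> z).
Proof.
have [s hs] := expsum_mono z 0; exists s => x.
by rewrite -hs mul0r cexp0 mulr1.
Qed.

Lemma expsumD f g : expsum f -> expsum g -> expsum (fun x => f x + g x).
Proof.
by move=> [s hs] [t ht]; exists (s ++ t) => x; rewrite /expsum_eval big_cat hs ht.
Qed.

Lemma expsumM f g : expsum f -> expsum g -> expsum (fun x => f x * g x).
Proof.
move=> [s hs] [t ht]; exists [seq (q.1 * r.1, q.2 + r.2) | q <- s, r <- t] => x.
rewrite hs ht /expsum_eval big_allpairs_dep mulr_suml; apply: eq_bigr => q _.
rewrite mulr_sumr; apply: eq_bigr => r _ /=.
by rewrite (mulrDl q.2) cexpD mulrACA.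
Qed.

Lemma expsum_sum I (r : seq I) (P : pred I) (F : I -> R -> C) :
  (forall i, expsum (F i)) -> expsum (fun x => \sum_(i <- r | P i) F i x).
Proof.
move=> eF; elim: r => [|i r IH].
  by have [s hs] := expsum_cst 0; exists s => x; rewrite big_nil -hs.
have [s hs] := expsumD (eF i) IH; have [t ht] := IH.
by case Pi : (P i); [exists s|exists t] => x; rewrite big_cons Pi -?hs -?ht.
Qed.

Lemma expsum_prod I (r : seq I) (P : pred I) (F : I -> R -> C) :
  (forall i, expsum (F i)) -> expsum (fun x => \prod_(i <- r | P i) F i x).
Proof.
move=> eF; elim: r => [|i r IH].
  by have [s hs] := expsum_cst 1; exists s => x; rewrite big_nil -hs.
have [s hs] := expsumM (eF i) IH; have [t ht] := IH.
by case Pi : (P i); [exists s|exists t] => x; rewrite big_cons Pi -?hs -?ht.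
Qed.

Lemma expsum_det n (A : R -> 'M[C]_n) :
  (forall i j, expsum (fun x => A x i j)) -> expsum (fun x => \det (A x)).
Proof.
move=> eA; apply: expsum_sum => sg; apply: expsumM; first exact: expsum_cst.
exact: expsum_prod.
Qed.

Lemma simple_zero_isolated (F : R -> R) (x d : R) : is_derive x 1 F d -> d != 0 ->
  F x = 0 -> exists2 V, nbhs x V & forall y, V y -> F y = 0 -> y = x.
Proof.
move=> [dF Fd] d0 Fx0.
have h : h^-1 *: (F (h *: 1 + x) - F x) @[h --> 0^'] --> d.
  by rewrite -Fd; exact: dF.
have h' : \forall h \near 0^', h^-1 *: (F (h *: 1 + x) - F x) != 0.
  by apply: cvgr_neq0 h _.
have [e /= e0 he] := h'.
exists (ball x e); first exact: nbhsx_ballx.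
move=> y xy Fy0; apply/eqP/negPn/negP => yx.
have /= := he (y - x); rewrite sub0r normrN distrC.
move=> /(_ xy); rewrite subr_eq0 => /(_ yx).
by rewrite -[(y - x) *: 1]/((y - x) * 1) mulr1 subrK Fy0 Fx0 subrr scaler0 eqxx.
Qed.

(* Divide by one exponential and differentiate to remove a term: a zero at which
   the derivative does not vanish is isolated, and the zeros of the derivative
   are countable by induction. *)
Lemma countable_expsum_zeros f :
  expsum f -> (exists x0, f x0 != 0) -> countable [set x | f x = 0].
Proof.
move=> [s hs] [x0 fx0].
elim: {s}(size s) {-2}s (erefl (size s)) f hs x0 fx0 => [|n IH] s sn f hs x0 fx0.
  by move: fx0; rewrite hs /expsum_eval (size0nil sn) big_nil eqxx.
case: s sn hs => // -[c l] s /= [sn] hs.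
pose G (x : R) : C := c + \sum_(q <- s) q.1 * cexp ((q.2 - l) * x%:C).
have GE x : f x = G x * cexp (l * x%:C).
  rewrite hs /expsum_eval big_cons /G mulrDl mulr_suml; congr (_ + _).
  apply: eq_bigr => q _ /=; rewrite -mulrA -cexpD; congr (_ * cexp _).
  by rewrite -mulrDl subrK.
have Gf x : (f x == 0) = (G x == 0).
  by rewrite GE mulf_eq0 (negbTE (cexp_neq0 _)) orbF.
pose t : seq (C * C) := [seq (q.1 * (q.2 - l), q.2 - l) | q <- s].
pose g := expsum_eval t.
have gE x : g x = \sum_(q <- s) q.1 * (q.2 - l) * cexp ((q.2 - l) * x%:C).
  by rewrite /g /expsum_eval big_map.
have dRe (x : R) : is_derive x 1 (fun y : R => Re (G y)) (Re (g x)).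
  have -> : (fun y : R => Re (G y)) = cst (Re c) +
      \sum_(q <- s) (fun y : R => Re (q.1 * cexp ((q.2 - l) * y%:C))).
    by apply/funext => y; rewrite /G cReD Re_sum -[RHS]/(_ + _) fct_sumE.
  rewrite gE Re_sum -[X in is_derive _ _ _ X]add0r; apply: is_deriveD.
  elim: (s) => [|q r IHr]; first by rewrite !big_nil; exact: is_derive_cst.
  by rewrite !big_cons; apply: is_deriveD; exact: is_derive_Re_cexp.
have dIm (x : R) : is_derive x 1 (fun y : R => Im (G y)) (Im (g x)).
  have -> : (fun y : R => Im (G y)) = cst (Im c) +
      \sum_(q <- s) (fun y : R => Im (q.1 * cexp ((q.2 - l) * y%:C))).
    by apply/funext => y; rewrite /G cImD Im_sum -[RHS]/(_ + _) fct_sumE.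
  rewrite gE Im_sum -[X in is_derive _ _ _ X]add0r; apply: is_deriveD.
  elim: (s) => [|q r IHr]; first by rewrite !big_nil; exact: is_derive_cst.
  by rewrite !big_cons; apply: is_deriveD; exact: is_derive_Im_cexp.
case: (pselect (exists x1, g x1 != 0)) => [[x1 gx1]|ng].
  have cg := IH t (etrans (size_map _ _) sn) g (fun=> erefl) x1 gx1.
  set Z := [set x | f x = 0].
  apply: (sub_countable (B := isolated Z `|` [set x | g x = 0])); last first.
    rewrite -bigcup2E; apply: bigcup_countable => // -[|[|k]] _ //=.
    exact: countable_isolated.
  apply: subset_card_le => x Zx; have [gx|gx] := eqVneq (g x) 0; [by right|left].
  have Gx0 : G x = 0 by apply/eqP; rewrite -Gf; apply/eqP.
  have [V nV hV] : exists2 V, nbhs x V & forall y, V y -> G y = 0 -> y = x.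
    have [gR|gR] := eqVneq (Re (g x)) 0.
      have gI : Im (g x) != 0.
        by apply: contra gx => /eqP gI; apply/eqP; apply: complexP.
      have [|V nV hV] := simple_zero_isolated (dIm x) gI; first by rewrite Gx0.
      by exists V => // y Vy Gy; apply: hV => //; rewrite Gy.
    have [|V nV hV] := simple_zero_isolated (dRe x) gR; first by rewrite Gx0.
    by exists V => // y Vy Gy; apply: hV => //; rewrite Gy.
  split; first exact/mem_set.
  exists V => //; apply/seteqP; split => [y [Vy Zy]|y ->] /=.
    by apply: hV => //; apply/eqP; rewrite -Gf; apply/eqP.
  by split => //; exact: nbhs_singleton.
(* If the derivative vanishes identically, [G] is constant; it is nonzero at [x0], so there are no
   zeros at all. *)
have g0 x : g x = 0.
  by apply/eqP/negPn/negP => gx; apply: ng; exists x.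
rewrite (_ : [set x | f x = 0] = set0); first exact: countable0.
apply/seteqP; split => // x /= fx; move: fx0; rewrite Gf.
have G0 : G x = 0 by apply/eqP; rewrite -Gf fx.
suff -> : G x0 = G x by rewrite G0 eqxx.
apply: complexP.
  apply: (@is_derive_0_is_cst R (fun y => Re (G y))) => y.
  by have := dRe y; rewrite g0.
apply: (@is_derive_0_is_cst R (fun y => Im (G y))) => y.
by have := dIm y; rewrite g0.
Qed.

Definition tends f (z : C) := Re (f x) @[x --> +oo] --> Re z /\
  Im (f x) @[x --> +oo] --> Im z.

Lemma tends_cst z : tends (fun=> z) z.
Proof. by split; exact: cvg_cst. Qed.

Lemma tendsD f g z w : tends f z -> tends g w -> tends (fun x => f x + g x) (z + w).
Proof.
move=> [f1 f2] [g1 g2]; split.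
  by under eq_fun do rewrite cReD; rewrite cReD; exact: cvgD.
by under eq_fun do rewrite cImD; rewrite cImD; exact: cvgD.
Qed.

Lemma tendsM f g z w : tends f z -> tends g w -> tends (fun x => f x * g x) (z * w).
Proof.
move=> [f1 f2] [g1 g2]; split.
  by under eq_fun do rewrite cReM; rewrite cReM; apply: cvgB; exact: cvgM.
by under eq_fun do rewrite cImM; rewrite cImM; apply: cvgD; exact: cvgM.
Qed.

Lemma tends_sum I (r : seq I) (P : pred I) (F : I -> R -> C) (z : I -> C) :
  (forall i, P i -> tends (F i) (z i)) ->
  tends (fun x => \sum_(i <- r | P i) F i x) (\sum_(i <- r | P i) z i).
Proof.
move=> tF; elim: r => [|i r IH].
  by under eq_fun do rewrite big_nil; rewrite big_nil; exact: tends_cst.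
under eq_fun do rewrite big_cons; rewrite big_cons.
by case Pi : (P i) => //; apply: tendsD => //; exact: tF.
Qed.

Lemma tends_prod I (r : seq I) (P : pred I) (F : I -> R -> C) (z : I -> C) :
  (forall i, P i -> tends (F i) (z i)) ->
  tends (fun x => \prod_(i <- r | P i) F i x) (\prod_(i <- r | P i) z i).
Proof.
move=> tF; elim: r => [|i r IH].
  by under eq_fun do rewrite big_nil; rewrite big_nil; exact: tends_cst.
under eq_fun do rewrite big_cons; rewrite big_cons.
by case Pi : (P i) => //; apply: tendsM => //; exact: tF.
Qed.

Lemma tends_det n (A : R -> 'M[C]_n) (B : 'M[C]_n) :
  (forall i j, tends (fun x => A x i j) (B i j)) -> tends (fun x => \det (A x)) (\det B).
Proof.
move=> tA; apply: tends_sum => sg _; apply: tendsM; first exact: tends_cst.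
by apply: tends_prod => i _.
Qed.

Lemma abs_Re_le (z : C) : `|Re z| <= Num.sqrt (sqmod z).
Proof. by rewrite -sqrtr_sqr ler_sqrt ?sqmod_ge0// sqr_Re_le. Qed.

Lemma abs_Im_le (z : C) : `|Im z| <= Num.sqrt (sqmod z).
Proof. by rewrite -sqrtr_sqr ler_sqrt ?sqmod_ge0// sqr_Im_le. Qed.

Lemma tends_cexp (l : C) : Re l < 0 -> tends (fun x => cexp (l * x%:C)) 0.
Proof.
move=> l0.
have E x : Num.sqrt (sqmod (cexp (l * x%:C))) = expR (Re l * x).
  rewrite sqmod_cexp sqrtr_sqr ger0_norm ?expR_ge0// mulrC Re_mulR mulrC.
  by [].
have h : expR (Re l * x) @[x --> +oo] --> (0 : R).
  have : expR (- x) @[x --> +oo] --> (0 : R) by exact: cvgr_expR.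
  move=> /cvgrPdist_lt hc; apply/cvgrPdist_lt => e e0.
  have [A [Ar hA]] := hc e e0.
  exists (`|A| / - Re l); split; first exact: num_real.
  move=> x hx; have := hA (- (Re l * x)); rewrite opprK; apply.
  apply: le_lt_trans (ler_norm A) _.
  by rewrite -mulNr mulrC -ltr_pdivrMr// oppr_gt0.
split; apply: norm_cvg0.
  apply: (@squeeze_cvgr _ _ _ _ (cst 0) (fun x => expR (Re l * x))) => //.
  - near=> x; apply/andP; split; first exact: normr_ge0.
    by apply: le_trans (abs_Re_le _) _; rewrite E.
  - exact: cvg_cst.
apply: (@squeeze_cvgr _ _ _ _ (cst 0) (fun x => expR (Re l * x))) => //.
- near=> x; apply/andP; split; first exact: normr_ge0.
  by apply: le_trans (abs_Im_le _) _; rewrite E.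
- exact: cvg_cst.
Unshelve. all: by end_near.
Qed.

Lemma tends_neq0 f z : tends f z -> z != 0 -> exists x0, f x0 != 0.
Proof.
move=> [f1 f2] z0; apply: contrapT => /forallNP h.
have f0 x : f x = 0 by apply/eqP/negPn/negP => fx; exact: (h x).
have Re0 : (fun x => Re (f x)) = cst 0 by apply/funext => x; rewrite f0.
have Im0 : (fun x => Im (f x)) = cst 0 by apply/funext => x; rewrite f0.
move: z0; rewrite (_ : z = 0) ?eqxx//; apply: complexP => /=.
  by rewrite -(cvg_lim _ f1)// Re0 lim_cst.
by rewrite -(cvg_lim _ f2)// Im0 lim_cst.
Qed.

End ExpSums.

(** * Filters with prescribed free coordinates *)

Section PowerSpan.
Variable R : realType.
Local Notation C := R[i].
Variables (r : nat) (z : 'I_r -> C).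
Hypothesis z0 : forall l, z l != 0.
Hypothesis zd : forall l m, l != m -> sqmod (z l) != sqmod (z m).

(* Divide by the power of the root of largest modulus among those with a nonzero
   coefficient. *)
Lemma powers_dominant (v : 'I_r -> C) (I : pred nat) :
  (forall m, exists2 s, (m <= s)%N & I s) ->
  (forall s, I s -> \sum_l v l * z l ^+ s = 0) -> forall l, v l = 0.
Proof.
move=> infI hv l1; apply/eqP/negPn/negP => vl1.
have [l0 vl0 hl0] : exists2 l0, v l0 != 0 &
    forall l, v l != 0 -> sqmod (z l) <= sqmod (z l0).
  have := @arg_maxP _ R _ l1 (fun l => v l != 0) (fun l => sqmod (z l)) vl1.
  by case=> l0 h1 h2; exists l0.
pose rho l := sqmod (z l) / sqmod (z l0).
have s0 : 0 < sqmod (z l0) by rewrite sqmod_gt0.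
have rho_lt l : v l != 0 -> l != l0 -> rho l < 1.
  move=> vl ll0; rewrite ltr_pdivrMr// mul1r lt_neqAle hl0// andbT; exact: zd.
pose F s := r%:R * \sum_(l | (l != l0) && (v l != 0)) sqmod (v l) * rho l ^+ s.
have hF s : I s -> sqmod (v l0) <= F s.
  move=> /hv; rewrite (bigD1 l0)//= => /eqP; rewrite addr_eq0 => /eqP hs.
  have : sqmod (v l0 * z l0 ^+ s) <= r%:R * \sum_(l | (l != l0) && (v l != 0)) sqmod (v l) * sqmod (z l) ^+ s.
    rewrite hs sqmodN.
    rewrite (bigID (fun l => v l == 0))/= big1 ?add0r; last first.
      by move=> l /andP[_ /eqP ->]; rewrite mul0r.
    rewrite -big_filter; apply: le_trans (sqmod_sum_le _ _) _.
    rewrite big_filter; apply: ler_pM; rewrite ?ler0n//.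
    - by apply: sumr_ge0 => l _; exact: sqmod_ge0.
    - rewrite ler_nat; apply: leq_trans (_ : size (index_enum 'I_r) <= r)%N.
        by rewrite size_filter count_size.
      by rewrite [index_enum _]unlock -enumT size_enum_ord.
    - by apply: ler_sum => l _; rewrite sqmodM sqmodX.
  rewrite sqmodM sqmodX -ler_pdivlMr ?exprn_gt0// => /le_trans; apply.
  rewrite /F -mulrA ler_wpM2l// mulr_suml; apply: ler_sum => l _.
  by rewrite /rho expr_div_n mulrA.
have cF : (F s @[s --> \oo] --> (0 : R))%classic.
  rewrite -(mulr0 r%:R); apply: cvgM; first exact: cvg_cst.
  elim: (index_enum _) => [|l t IHt].
    by under eq_fun do rewrite big_nil; exact: cvg_cst.
  under eq_fun do rewrite big_cons.
  case E : ((l != l0) && (v l != 0)); last exact: IHt.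
  have /andP[ll0 vl] := E.
  have h1 : (sqmod (v l) * rho l ^+ s @[s --> \oo] --> (0 : R))%classic.
    rewrite -(mulr0 (sqmod (v l))); apply: cvgM; first exact: cvg_cst.
    by apply: cvg_expr; rewrite ger0_norm ?rho_lt// divr_ge0 ?sqmod_ge0.
  by have H := cvgD h1 IHt; rewrite addr0 in H; exact: H.
have vp : 0 < sqmod (v l0) by rewrite sqmod_gt0.
have /cvgrPdist_lt/(_ _ vp) [n _ hn] := cF.
have [s ns Is] := infI n.
have := hn s ns; rewrite sub0r normrN => /(le_lt_trans (ler_norm _)).
by rewrite ltNge hF.
Qed.

(** Rows outside [I] are zero rather than deleted, so that the row index is still the exponent and
    the row space grows with [L]. *)
Definition pow_mx (I : pred nat) L : 'M[C]_(L, r) :=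
  \matrix_(s, l) if I s then z l ^+ s else 0.

Lemma pow_mxS I L L' : (L <= L')%N -> (pow_mx I L <= pow_mx I L')%MS.
Proof.
move=> LL'; apply/row_subP => s.
have -> : row s (pow_mx I L) = row (widen_ord LL' s) (pow_mx I L').
  by apply/rowP => l; rewrite !mxE.
exact: row_sub.
Qed.

(** The ranks are bounded by [r], so the row space stabilizes. A vector orthogonal to the stable row
    space is orthogonal to the powers at every exponent in [I], hence zero by [powers_dominant]. *)
Lemma powers_span (I : pred nat) : (forall m, exists2 s, (m <= s)%N & I s) ->
  exists L0, forall L, (L0 <= L)%N -> row_full (pow_mx I L).
Proof.
move=> infI.
have [L0 hL0] : exists L0, forall L, (\rank (pow_mx I L) <= \rank (pow_mx I L0))%N.
  have ex : exists n, `[< exists L, \rank (pow_mx I L) = n >].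
    by exists (\rank (pow_mx I 0)); apply/asboolP; exists 0%N.
  have ub n : `[< exists L, \rank (pow_mx I L) = n >] -> (n <= r)%N.
    by move=> /asboolP[L <-]; exact: rank_leq_col.
  case: (ex_maxnP ex ub) => n /asboolP[L0 hn] hm; exists L0 => L.
  by rewrite hn; apply: hm; apply/asboolP; exists L.
exists L0 => L LL; rewrite -col_leq_rank.
apply: leq_trans (mxrankS (pow_mxS I LL)).
rewrite leqNgt; apply/negP => hr.
set M := pow_mx I L0 in hr.
have : kermx M^T != 0.
  by rewrite kermx_eq0 -row_leq_rank mxrank_tr -ltnNge.
case/rowV0Pn => u /sub_kermxP uM u0.
have huL L' : u *m (pow_mx I L')^T = 0.
  have sub : (pow_mx I L' <= M)%MS.
    pose L1 := maxn L0 L'.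
    apply: submx_trans (pow_mxS I (leq_maxr L0 L')) _.
    have := (mxrank_leqif_sup (pow_mxS I (leq_maxl L0 L'))).2.
    by rewrite eqn_leq (mxrankS (pow_mxS I (leq_maxl L0 L'))) hL0 => /esym.
  by have /submxP[D ->] := sub; rewrite trmx_mul mulmxA uM mul0mx.
have v0 : forall l, u 0 l = 0.
  apply: (@powers_dominant (fun l => u 0 l) I infI) => s Is.
  have := congr1 (fun A : 'rV_s.+1 => A 0 (inord s)) (huL s.+1).
  rewrite !mxE => h; rewrite -[RHS]h; apply: eq_bigr => l _.
  by rewrite !mxE inordK// Is.
by move: u0 => /eqP; apply; apply/rowP => l; rewrite v0 mxE.
Qed.

End PowerSpan.

Section FilterInverse.
Variable R : realType.
Local Notation C := R[i].
Variables (r : nat) (z : 'I_r -> C).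

(** The factors are [m X - 1], not [X - m^-1], because their values on the unit circle are the
    numerators in the Fourier coefficients of the poles. *)
Definition filter_poly (m : 'I_r -> C) : {poly C} := \prod_l (m l *: 'X - 1).

Lemma size_filter_poly m : (forall l, m l != 0) -> size (filter_poly m) = r.+1.
Proof.
move=> m0; rewrite /filter_poly size_prod; last first.
  move=> l _; rewrite -size_poly_eq0 size_addl ?size_scale ?size_polyX//.
  by rewrite size_opp size_poly1.
rewrite (eq_bigr (fun=> 2%N)); last first.
  by move=> l _; rewrite size_addl ?size_scale ?size_polyX// size_opp size_poly1.
by rewrite sum_nat_const card_ord; lia.
Qed.

Lemma filter_poly_dvd (m : 'I_r -> C) (p : {poly C}) : injective m ->
  (forall l, m l != 0) -> (forall l, root p (m l)^-1) -> filter_poly m %| p.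
Proof.
move=> im m0 hp.
have u : uniq [seq (m l)^-1 | l <- index_enum 'I_r].
  by rewrite map_inj_uniq ?index_enum_uniq// => x y /invr_inj /im.
have -> : filter_poly m = (\prod_l m l) *: \prod_(x <- [seq (m l)^-1 | l <- index_enum 'I_r]) ('X - x%:P).
  rewrite big_map /filter_poly -mul_polyC rmorph_prod/= -big_split/=.
  apply: eq_bigr => l _; rewrite mulrBr mul_polyC -polyCM mulfV//.
rewrite dvdpZl; last by apply/prodf_neq0 => l _.
apply: uniq_roots_dvdp; last by rewrite uniq_rootsE.
by apply/allP => _ /mapP[l _ ->]; exact: hp.
Qed.

(* The slots [s] with [~~ sg s] are unconstrained. A finite input exists as soon
   as the prescribed output, completed on these slots, is a polynomial vanishing
   at the roots [(m l)^-1] of the filter. *)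
Lemma filter_right_inverse (m : 'I_r -> C) (sg : pred nat) L : injective m ->
  (forall l, m l != 0) -> row_full (pow_mx (fun l => (m l)^-1) (fun s => ~~ sg s) L) ->
  exists B : 'M[C]_(L - r, L), forall j : 'I_L, sg j -> forall k : 'I_L,
    \sum_(i < L - r) (if (i <= j)%N then (filter_poly m)`_(j - i) else 0) * B i k =
    (j == k)%:R.
Proof.
move=> im m0 full.
have col (k : 'I_L) : exists b : 'I_(L - r) -> C, forall j : 'I_L, sg j ->
    \sum_(i < L - r) (if (i <= j)%N then (filter_poly m)`_(j - i) else 0) * b i =
    (j == k)%:R.
  (* For an unconstrained [k] the prescribed output is 0 at all constrained places, and the zero
     input works. *)
  case sk : (sg k); last first.
    exists (fun=> 0) => j sj; rewrite big1 => [|i _]; last by rewrite mulr0.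
    by case: eqVneq => // jk; rewrite jk sk in sj.
  have [D hD] : exists D : 'rV_L, D *m pow_mx (fun l => (m l)^-1) (fun s => ~~ sg s) L =
      \row_l (- (m l)^-1 ^+ k).
    by have /submxP[D ->] := submx_full (\row_l (- (m l)^-1 ^+ k)) full; exists D.
  pose y (s : 'I_L) : C := (s == k)%:R + (if sg s then 0 else D 0 s).
  pose Y : {poly C} := \sum_(s < L) y s *: 'X^s.
  have Yc (s : 'I_L) : Y`_s = y s.
    rewrite coef_sum (bigD1 s)//= coefZ coefXn eqxx mulr1 big1 ?addr0// => t ts.
    by rewrite coefZ coefXn val_eqE eq_sym (negbTE ts) mulr0.
  have sY : (size Y <= L)%N.
    apply: (leq_trans (size_sum _ _ _)); apply/bigmax_leqP => s _.
    by apply: (leq_trans (size_scale_leq _ _)); rewrite size_polyXn ltn_ord.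
  have rY l : root Y (m l)^-1.
    apply/rootP; rewrite horner_sum.
    under eq_bigr do rewrite hornerZ hornerXn mulrDl.
    rewrite big_split/= (bigD1 k)//= eqxx mul1r big1 ?addr0; last first.
      by move=> s /negbTE ->; rewrite mul0r.
    have := congr1 (fun A : 'rV_r => A 0 l) hD; rewrite !mxE => hl.
    apply/eqP; rewrite addrC addr_eq0 -[X in _ == X]hl; apply/eqP.
    apply: eq_bigr => s _; rewrite !mxE; case: (sg s) => /=.
      by rewrite mul0r mulr0.
    by [].
  have /dvdpP[q qE] := filter_poly_dvd im m0 rY.
  exists (fun i => q`_i) => j sj.
  have sq : (size q <= L - r)%N.
    have [->|q0] := eqVneq q 0; first by rewrite size_poly0.
    have F0 : filter_poly m != 0 by rewrite -size_poly_eq0 size_filter_poly.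
    move: sY; rewrite qE size_mul// size_filter_poly// addnS/= => sY.
    by rewrite -(addnK r (size q)) leq_sub2r.
  rewrite -[RHS](_ : Y`_j = _); last by rewrite Yc /y sj addr0.
  rewrite qE coefM.
  rewrite (eq_bigr (fun i : 'I_(L - r) => (fun i : nat => if (i <= j)%N then (filter_poly m)`_(j - i) * q`_i else 0) i)); last first.
    by move=> i _; case: ifP => _; rewrite ?mul0r.
  rewrite -(big_mkord xpredT (fun i : nat => if (i <= j)%N then (filter_poly m)`_(j - i) * q`_i else 0)).
  rewrite -(big_mkord xpredT (fun i : nat => q`_i * (filter_poly m)`_(j - i))).
  (* Neither of [L - r] and [j + 1] need dominate the other; both sums are compared on a common
     range, [q] vanishing from [L - r] on and the summand beyond [j]. *)
  have E n : (L - r <= n)%N -> (j < n)%N ->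
     \sum_(0 <= i < L - r) (if (i <= j)%N then (filter_poly m)`_(j - i) * q`_i else 0) =
     \sum_(0 <= i < n) (if (i <= j)%N then (filter_poly m)`_(j - i) * q`_i else 0).
    move=> Ln jn; rewrite (big_cat_nat (n := L - r) _ Ln)//=.
    rewrite [X in _ = _ + X]big_nat_cond [X in _ = _ + X]big1 ?addr0//.
    move=> i /andP[/andP[hi _] _]; case: ifP => // _.
    by rewrite (nth_default 0 (leq_trans sq hi)) mulr0.
  rewrite (E (maxn (L - r) j.+1)) ?leq_maxl ?leq_maxr//.
  rewrite (big_cat_nat (n := j.+1) _ (leq_maxr _ _))//=.
  rewrite [X in _ + X]big_nat_cond [X in _ + X]big1 ?addr0; last first.
    by move=> i /andP[/andP[hi _] _]; rewrite leqNgt hi.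
  by apply: eq_big_nat => i /andP[_ hi]; rewrite -ltnS hi mulrC.
have /choice[b hb] := col.
exists (\matrix_(i, k) b k i) => j sj k.
by rewrite -(hb k j sj); apply: eq_bigr => i _; rewrite mxE.
Qed.

End FilterInverse.

(** * Density of the range of a shift filter *)

Section FilterApproximation.
Variable R : realType.
Local Notation C := R[i].
Local Notation mu := (@lebesgue_measure R).
Local Open Scope classical_set_scope.

Variables (N : nat) (gam : R) (B : nat -> R -> C) (KB : R).
Hypothesis gam1 : 1 <= gam.
Hypothesis mB : forall k, cmeas (B k).
Hypothesis BK : forall k x, 0 <= x < 1 -> sqmod (B k x) <= KB.

Let gam0 : 0 < gam. Proof. exact: lt_le_trans gam1. Qed.
Let KB0 : 0 <= KB.
Proof. by apply: le_trans (sqmod_ge0 _) (BK 0 (x := 0) _); rewrite lexx ltr01. Qed.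

Definition filt (b : R -> C) (x : R) : C := \sum_(k < N) B k x * b (x + k%:R).

Lemma cmeas_filt b : cmeas b -> cmeas (filt b).
Proof. by move=> mb; apply: cmeas_sum => k; apply: cmeasM => //; exact: cmeas_shift. Qed.

Definition filt_approx (f : R -> C) := forall eps, 0 < eps ->
  exists s, (n2 `[0%R, 1%R[ (fun x => filt (trig_eval gam s) x - f x)%R < eps%:E)%E.

Definition fold (y : R) : R := y - gam * (Num.floor (y / gam))%:~R.

Lemma measurable_fold : measurable_fun setT fold.
Proof.
apply: measurable_funB => //; apply: measurable_funM => //.
apply: (measurableT_comp (f := fun y : R => (Num.floor y)%:~R : R)) => //.
  apply: nondecreasing_measurable => // x y xy.
  by rewrite ler_int; exact: le_floor.
exact: measurable_funM.
Qed.

Lemma fold_bounds y : 0 <= fold y < gam.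
Proof.
have /andP[h1 h2] := floor_itv (y / gam).
rewrite /fold subr_ge0 mulrC -ler_pdivlMr// h1/= ltrBlDr.
by move: h2; rewrite ltr_pdivrMr// intrD mulrDl mul1r addrC.
Qed.

Lemma fold_uniq y (m : int) : 0 <= y - gam * m%:~R < gam -> fold y = y - gam * m%:~R.
Proof.
move=> /andP[h1 h2]; rewrite /fold; congr (_ - _ * _%:~R).
apply: floor_def; apply/andP; split.
  by rewrite ler_pdivlMr// mulrC -subr_ge0.
by rewrite ltr_pdivrMr// intrD mulrDl mul1r mulrC -ltrBlDl.
Qed.

Lemma foldE y : exists m : int, fold y = y - gam * m%:~R.
Proof. by exists (Num.floor (y / gam)). Qed.

Lemma foldD y : fold (y + gam) = fold y.
Proof.
have [m hm] := foldE y; rewrite hm.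
rewrite (@fold_uniq _ (m + 1)).
  by rewrite intrD; ring.
have -> : y + gam - gam * (m + 1)%:~R = fold y by rewrite hm intrD; ring.
exact: fold_bounds.
Qed.

Lemma fold_id x : 0 <= x < gam -> fold x = x.
Proof. by move=> hx; rewrite (@fold_uniq _ 0) mulr0 subr0. Qed.

Lemma trig_eval_periodic s y : trig_eval gam s (y + gam) = trig_eval gam s y.
Proof.
apply: eq_bigr => q _; congr (_ * _).
have -> : 2 * pi * gam^-1 * q.1%:~R * (y + gam) =
   2 * pi * gam^-1 * q.1%:~R * y + 2 * pi * q.1%:~R by field; rewrite gt_eqF.
by rewrite expiD expi_2piz mulr1.
Qed.

Lemma filt_approx_periodic b f K : cmeas b -> (forall y, sqmod (b y) <= K) ->
  (forall y, b (y + gam) = b y) ->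
  (forall x, 0 <= x < 1 -> filt b x = f x) -> filt_approx f.
Proof.
move=> mb bK pb bf eps e0.
(* As [gam >= 1], [N.+1] cells of length [gam] contain all shifts of [0, 1[ by [k < N]. In [eta] one
   factor [m] pays for these cells, one for the number of terms and one for the inequality on the
   square of a sum. *)
pose m := N.+1.
pose eta := eps / (m%:R * m%:R * m%:R * (KB + 1)).
have m0 : 0 < m%:R :> R by rewrite ltr0n.
have K1 : 0 < KB + 1 by rewrite ltr_wpDl.
have den : 0 < m%:R * m%:R * m%:R * (KB + 1) by rewrite !mulr_gt0.
have eta0 : 0 < eta by rewrite divr_gt0.
have [s hs] := trig_dense 0 gam0 mb bK eta0.
exists s; rewrite add0r in hs.
pose d y := b y - trig_eval gam s y.
have md : cmeas d by apply: cmeasB => //; exact: cmeas_trig.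
have pd y : d (y + gam) = d y by rewrite /d pb trig_eval_periodic.
have pdn n y : d (y + n%:R * gam) = d y.
  elim: n => [|n IH]; first by rewrite mul0r addr0.
  by rewrite -natr1 mulrDl mul1r addrA pd.
have big_cell n : n2 `[0, n%:R * gam[ d = (n%:R%:E * n2 `[0%R, gam[ d)%E.
  have := @nnint_cells_partial R 0 gam (fun y => sqmod (d y)) n gam0
     (fun y => sqmod_ge0 _) (measurable_sqmod md).
  rewrite !add0r /n2 => ->; rewrite -nnintZ//; last 2 first.
  - by move=> x; exact: sqmod_ge0.
  - exact: measurable_sqmod.
  apply: eq_nnint => x _; rewrite big_mkord.
  by under eq_bigr do rewrite pdn; rewrite sumr_const card_ord mulr_natl.
have shiftd (k : 'I_N) : (n2 `[0%R, 1%R[ (fun x => d (x + k%:R)%R) <= m%:R%:E * n2 `[0%R, gam[ d)%E.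
  have -> : n2 `[0, 1[ (fun x => d (x + k%:R)) = n2 `[0 + k%:R, 1 + k%:R[ d.
    apply: (nnint_itv_shift k%:R 0 1 (F := fun y => sqmod (d y))).
      by move=> x; exact: sqmod_ge0.
    exact: measurable_sqmod.
  rewrite -big_cell; apply: subset_n2 => // x /=; rewrite !in_itv/= add0r => /andP[h1 h2].
  rewrite (le_trans _ h1)//=; apply: lt_le_trans h2 _.
  apply: (@le_trans _ _ m%:R); last by rewrite ler_peMr// ltW.
  by rewrite nat1r ler_nat /m ltnS ltnW.
rewrite (_ : n2 `[0, 1[ _ = n2 `[0, 1[ (fun x => - \sum_(k < N) B k x * d (x + k%:R))); last first.
  apply: eq_n2 => x /=; rewrite in_itv/= => hx; rewrite -(bf x hx) /filt -sumrB -sumrN.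
  by apply: eq_bigr => k _; rewrite /d; ring.
rewrite n2N; apply: le_lt_trans (n2_sum_le _ _ _) _ => //.
  by move=> k; apply: cmeasM => //; exact: cmeas_shift.
apply: (@le_lt_trans _ _ (m%:R%:E * \sum_(k < N) (KB * (m%:R * eta))%:E)%E).
  apply: lee_pmul.
  - by rewrite lee_fin ler0n.
  - by apply: sume_ge0 => k _; exact: n2_ge0.
  - by rewrite lee_fin ler_nat [index_enum _]unlock -enumT size_enum_ord /m.
  - apply: lee_sum => k _.
    apply: le_trans (n2M_le (K := KB) _ _ _ _ _) _ => //.
    + exact: cmeas_shift.
    + by move=> x /=; rewrite in_itv/=; exact: BK.
    + rewrite EFinM; apply: lee_wpmul2l; first by rewrite lee_fin.
      apply: le_trans (shiftd k) _; rewrite EFinM; apply: lee_wpmul2l => //.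
      exact: ltW.
rewrite sumEFin -EFinM lte_fin sumr_const card_ord -(mulr_natl (KB * _)).
have eE : m%:R * m%:R * m%:R * (KB + 1) * eta = eps.
  by rewrite /eta mulrC divfK// gt_eqF.
rewrite -[ltRHS]eE.
have Nm : N%:R <= m%:R :> R by rewrite ler_nat.
apply: (@le_lt_trans _ _ (m%:R * (m%:R * (KB * (m%:R * eta))))).
  rewrite ler_pM2l//; apply: ler_wpM2r => //; apply: mulr_ge0 => //.
  by apply: mulr_ge0; exact: ltW.
rewrite (_ : m%:R * (m%:R * (KB * (m%:R * eta))) = m%:R * m%:R * m%:R * KB * eta); last by ring.
by rewrite ltr_pM2r// ltr_pM2l ?ltrDl// !mulr_gt0.
Qed.

Lemma filt_approxD f g : cmeas f -> cmeas g ->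
  filt_approx f -> filt_approx g -> filt_approx (fun x => f x + g x).
Proof.
move=> mf mg hf hg eps e0.
have e4 : 0 < eps / 4 by rewrite divr_gt0.
have [s hs] := hf _ e4; have [t ht] := hg _ e4.
exists (s ++ t).
rewrite (_ : n2 _ _ = n2 `[0, 1[ (fun x => (filt (trig_eval gam s) x - f x) +
   (filt (trig_eval gam t) x - g x))); last first.
  apply: eq_n2 => x _; rewrite (_ : filt (trig_eval gam (s ++ t)) x =
     filt (trig_eval gam s) x + filt (trig_eval gam t) x); first by ring.
  rewrite /filt -big_split/=; apply: eq_bigr => k _.
  by rewrite -mulrDr /trig_eval big_cat.
apply: le_lt_trans (n2D_le _ _ _) _ => //.
- by apply: cmeasB => //; apply: cmeas_filt; exact: cmeas_trig.
- by apply: cmeasB => //; apply: cmeas_filt; exact: cmeas_trig.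
apply: (@lt_le_trans _ _ (2%:E * (eps / 4)%:E + 2%:E * (eps / 4)%:E)%E).
  by apply: lteD; rewrite lte_pmul2l.
by rewrite -!EFinM -EFinD lee_fin; lra.
Qed.

Lemma filt_approx0 : filt_approx (fun=> 0).
Proof.
move=> eps e0; exists [::]; rewrite (_ : n2 _ _ = 0%E) ?lte_fin//.
rewrite /n2 (eq_nnint (G := cst 0)) ?nnint_cst ?mul0e// => x _.
rewrite /filt big1 ?subr0 ?sqmod0// => k _.
by rewrite /trig_eval big_nil mulr0.
Qed.

Lemma filt_approx_sum I (s : seq I) (F : I -> R -> C) :
  (forall i, cmeas (F i)) -> (forall i, filt_approx (F i)) ->
  filt_approx (fun x => \sum_(i <- s) F i x).
Proof.
move=> mF hF; elim: s => [|i s IH].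
  by under eq_fun do rewrite big_nil; exact: filt_approx0.
under eq_fun do rewrite big_cons.
by apply: filt_approxD => //; exact: cmeas_sum.
Qed.

Lemma filt_approx_lim f (g : nat -> R -> C) (K : R) : cmeas f -> (forall n, cmeas (g n)) ->
  (forall n, filt_approx (g n)) ->
  (forall n x, 0 <= x < 1 -> sqmod (g n x - f x) <= K) ->
  (forall x, 0 <= x < 1 -> exists n0, forall n, (n0 <= n)%N -> g n x = f x) ->
  filt_approx f.
Proof.
move=> mf mg hg gK gcv eps e0.
have e4 : 0 < eps / 4 by rewrite divr_gt0.
have [n hn] : exists n, (nnint `[0%R, 1%R[ (fun x => sqmod (g n x - f x)%R) < (eps / 4)%:E)%E.
  apply: (nnint_dominated_small (G := cst K)) => //.
  - by move=> n; apply: measurable_sqmod; exact: cmeasB.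
  - by move=> n x; exact: sqmod_ge0.
  - rewrite nnint_cst//.
    by rewrite lebesgue_measure_itv/= lte_fin ltr01 -EFinB -EFinM ltry.
  - move=> x /=; rewrite in_itv/= => hx; have [n0 hn0] := gcv x hx.
    apply: cvg_near_cst; exists n0 => // n /= nn.
    by rewrite hn0// subrr sqmod0.
have [s hs] := hg n _ e4; exists s.
rewrite (_ : n2 _ _ = n2 `[0, 1[ (fun x => (filt (trig_eval gam s) x - g n x) +
   (g n x - f x))); last by apply: eq_n2 => x _; ring.
apply: le_lt_trans (n2D_le _ _ _) _ => //.
- by apply: cmeasB => //; apply: cmeas_filt; exact: cmeas_trig.
- exact: cmeasB.
apply: (@lt_le_trans _ _ (2%:E * (eps / 4)%:E + 2%:E * (eps / 4)%:E)%E).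
  by apply: lteD; rewrite lte_pmul2l.
by rewrite -!EFinM -EFinD lee_fin; lra.
Qed.

(* The factor [\1_E] restores boundedness: [E] runs through the sublevel sets of
   the unbounded solution [u]. *)
Lemma filt_approx_trunc M (u : 'I_M -> R -> C) (f : R -> C) K :
  (forall i, cmeas (u i)) -> cmeas f -> (forall x, sqmod (f x) <= K) ->
  (forall (E : set R) x, 0 <= x < 1 ->
    filt (fun y => \sum_(i < M) (\1_E (fold (y + i%:R)))%:C * u i (fold (y + i%:R))) x =
    (\1_E x)%:C * f x) ->
  filt_approx f.
Proof.
move=> mu' mf fK hu.
pose S x := \sum_(i < M) sqmod (u i x).
have mS : measurable_fun setT S.
  by apply: measurable_sum => i; exact: measurable_sqmod.
pose E (n : nat) := [set x | S x <= n%:R].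
have mE n : measurable (E n).
  by rewrite /E -[X in measurable X]setTI; apply: measurable_fun_le.
have sind (A : set R) (x : R) (z : C) : sqmod ((\1_A x)%:C * z) <= sqmod z.
  rewrite sqmodM sqmodR indicE; case: (_ \in _); rewrite ?expr1n ?mul1r//.
  by rewrite expr0n mul0r sqmod_ge0.
apply: (@filt_approx_lim f (fun n x => (\1_(E n) x)%:C * f x) (2 * K + 2 * K)) => //.
- by move=> n; apply: cmeasM => //; exact: cmeas_indic.
- move=> n.
  apply: (@filt_approx_periodic (fun y => \sum_(i < M) (\1_(E n) (fold (y + i%:R)))%:C * u i (fold (y + i%:R)))
     _ (M%:R * (M%:R * n%:R))).
  + apply: cmeas_sum => i.
    apply: (cmeas_shift (f := fun y => (\1_(E n) (fold y))%:C * u i (fold y))).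
    apply: (cmeas_comp (f := fun y => (\1_(E n) y)%:C * u i y)); last exact: measurable_fold.
    by apply: cmeasM => //; exact: cmeas_indic.
  + move=> y; apply: le_trans (sqmod_sum_le _ _) _.
    apply: ler_pM; rewrite ?ler0n//.
    * by apply: sumr_ge0 => i _; exact: sqmod_ge0.
    * by rewrite ler_nat [index_enum _]unlock -enumT size_enum_ord.
    * apply: (@le_trans _ _ (\sum_(i < M) n%:R)); last first.
        by rewrite sumr_const card_ord mulr_natl.
      apply: ler_sum => i _; rewrite sqmodM sqmodR indicE.
      case: (boolP (fold (y + i%:R) \in E n)) => [|_]; last by rewrite expr0n mul0r ler0n.
      rewrite inE /E/= /S => h; rewrite expr1n mul1r; apply: le_trans h.
      by rewrite (bigD1 i)//= lerDl sumr_ge0// => j _; exact: sqmod_ge0.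
  + move=> y; apply: eq_bigr => i _.
    by rewrite addrAC foldD.
  + by move=> x hx; rewrite hu.
- move=> n x _; apply: le_trans (sqmodB_le _ _) _.
  by rewrite lerD// ler_pM2l//; apply: le_trans (sind _ _ _) (fK x).
- move=> x _; exists (Num.truncn (S x)).+1 => n nn.
  rewrite indicE mem_set ?mul1r// /E/=; apply: ltW.
  by apply: lt_le_trans (truncnS_gt _) _; rewrite ler_nat.
Qed.

End FilterApproximation.

Section ShiftFilter.
Variable R : realType.
Local Notation C := R[i].
Local Notation mu := (@lebesgue_measure R).
Local Open Scope classical_set_scope.

Lemma eq_nnint_countable (D Z : set R) (F G : R -> R) : measurable D ->
  measurable_fun setT F -> measurable_fun setT G ->
  (forall x, 0 <= F x) -> (forall x, 0 <= G x) -> countable Z ->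
  (forall x, ~ Z x -> F x = G x) -> nnint D F = nnint D G.
Proof.
move=> mD mF mG F0 G0 cZ FG; rewrite /nnint.
apply: ge0_ae_eq_integral => //.
- by apply/measurable_EFinP; exact: measurable_funTS.
- by apply/measurable_EFinP; exact: measurable_funTS.
- by move=> x _; rewrite lee_fin.
- by move=> x _; rewrite lee_fin.
exists Z; split => /=.
- by apply: (@countable_measurable _ (measurableTypeR R)).
- exact: countable_lebesgue_measure0.
- by move=> x /= hx; apply: contrapT => Zx; apply: hx => _; rewrite FG.
Qed.

Let leq_window N L i : (0 < N)%N -> (i < L - N.-1)%N -> (N <= L - i)%N.
Proof. by case: N => // n _; rewrite /= ltn_subRL addnC -ltn_subRL. Qed.

(** Collects the terms along the diagonals [j = k + i]; since [M = L - N.-1], every such [j] is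
    below [L]. *)
Lemma reindex_filter (V : nmodType) (N M L : nat) (F : nat -> nat -> V) :
  (forall k i, (N <= k)%N -> F k i = 0) -> (0 < N)%N -> (M = L - N.-1)%N ->
  \sum_(k < N) \sum_(i < M) F k i =
  \sum_(j < L) \sum_(i < M) (if (i <= j)%N then F (j - i)%N i else 0).
Proof.
move=> F0 N0 ->; rewrite exchange_big [RHS]exchange_big /=.
apply: eq_bigr => i _.
rewrite -(big_mkord xpredT (fun k => F k i)).
rewrite -(big_mkord xpredT (fun j => if (i <= j)%N then F (j - i)%N i else 0)).
have hi := ltn_ord i.
have iL : (i <= L)%N by apply: ltnW; apply: leq_trans hi (leq_subr _ _).
have NL := leq_window N0 hi.
rewrite [RHS](big_cat_nat (n := i) _ iL)//= [X in _ = X + _]big_nat_cond.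
rewrite [X in _ = X + _]big1 ?add0r; last first.
  by move=> j /andP[/andP[_ hj] _]; rewrite leqNgt hj.
rewrite -{2}[i : nat]add0n big_addn.
rewrite [RHS](big_cat_nat (n := N) _ NL)//= [X in _ = _ + X]big_nat_cond.
rewrite [X in _ = _ + X]big1 ?addr0; last first.
  move=> j /andP[/andP[hj _] _]; rewrite leq_addl addnK; exact: F0.
by apply: eq_bigr => k _; rewrite leq_addl addnK.
Qed.

Variables (r : nat) (gam : R) (a lam m : 'I_r.+1 -> C).
Hypothesis a0 : forall j, a j != 0.
Hypothesis lamd : forall j k, j != k -> Re (lam j) != Re (lam k).
Hypothesis m0 : forall j, m j != 0.
Hypothesis md : forall j k, j != k -> sqmod (m j) != sqmod (m k).

Definition cofilter (j : 'I_r.+1) : {poly C} :=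
  filter_poly (fun l : 'I_r => m (lift j l)).

Lemma size_cofilter j : size (cofilter j) = r.+1.
Proof. by apply: size_filter_poly => l; exact: m0. Qed.

(* For the symbols [prod_(l != j) (m l X - 1)] the filter with these coefficients
   applied to [exp (2 i pi c y)] gives the sum over [j] of the
   [a j exp ((lam j + 2 i pi c) x) / (m j omega - 1)], [omega = exp (2 i pi c)], up
   to the common factor [prod_l (m l omega - 1)]. *)
Definition shift_coef (k : nat) (x : R) : C :=
  \sum_j a j * cexp (lam j * x%:C) * (cofilter j)`_k.

Lemma shift_coef0 k x : (r < k)%N -> shift_coef k x = 0.
Proof.
by move=> rk; rewrite /shift_coef big1// => j _; rewrite nth_default ?mulr0// size_cofilter.
Qed.

Lemma cmeas_shift_coef k : cmeas (shift_coef k).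
Proof.
apply: cmeas_sum => j; apply: cmeasM; last exact: cmeas_cst.
by apply: cmeasM; [exact: cmeas_cst|exact: cmeas_cexp].
Qed.

Lemma shift_coef_bounded : exists K, forall k x, 0 <= x < 1 -> sqmod (shift_coef k x) <= K.
Proof.
pose T k := r.+1%:R * \sum_j sqmod (a j) * expR `|Re (lam j)| ^+ 2 * sqmod (cofilter j)`_k.
have T0 k : 0 <= T k.
  rewrite mulr_ge0// sumr_ge0// => j _.
  by rewrite !mulr_ge0 ?sqmod_ge0// exprn_ge0// expR_ge0.
exists (\sum_(k < r.+1) T k) => k x /andP[x0 x1].
have [rk|rk] := ltnP r k.
  by rewrite shift_coef0// sqmod0 sumr_ge0.
apply: (@le_trans _ _ (T k)); last first.
  by rewrite (bigD1 (Ordinal (rk : (k < r.+1)%N)))//= lerDl sumr_ge0.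
apply: le_trans (sqmod_sum_le _ _) _.
apply: ler_pM; rewrite ?ler0n//.
- by apply: sumr_ge0 => j _; exact: sqmod_ge0.
- by rewrite ler_nat [index_enum _]unlock -enumT size_enum_ord.
apply: ler_sum => j _; rewrite 2!sqmodM; apply: ler_wpM2r; first exact: sqmod_ge0.
apply: ler_wpM2l; first exact: sqmod_ge0.
rewrite sqmod_cexp ler_sqr ?nnegrE ?expR_ge0// ler_expR mulrC Re_mulR mulrC.
apply: le_trans (ler_norm _) _; rewrite normrM (ger0_norm x0).
by rewrite ler_piMr// ltW.
Qed.

Let J : 'I_r.+1 := [arg max_(j > ord0) Re (lam j)]%O.

Let ReJ j : j != J -> Re (lam j) < Re (lam J).
Proof.
rewrite /J; case: arg_maxP => // k _ hk jk.
by rewrite lt_neqAle lamd//=; exact: hk.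
Qed.

Let z (l : 'I_r) : C := (m (lift J l))^-1.

Let z_neq0 l : z l != 0. Proof. by rewrite invr_eq0. Qed.

Let zd l k : l != k -> sqmod (z l) != sqmod (z k).
Proof.
move=> lk; rewrite !sqmodV; apply: contraNN (md (_ : lift J l != lift J k)) => [/eqP/invr_inj->//|].
by rewrite (inj_eq lift_inj).
Qed.

Let injm : injective (fun l : 'I_r => m (lift J l)).
Proof.
move=> l k h; apply/eqP/negPn/negP => lk.
have ne : lift J l != lift J k by rewrite (inj_eq lift_inj).
by have := md ne; rewrite h eqxx.
Qed.

(* [pos x j] is the place of [x - j] in [[0, gam[]; it imposes an equation only
   when it lies in [[0, 1[], which is what the pattern [sg] records on [X]. Only
   the leading exponent [J] matters for large arguments, where the constant matrix
   [Bm] inverts the system; so the determinant [D] of the system composed with [Bm]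
   is locally an exponential sum with limit 1, and vanishes on a countable set. *)
Section Pattern.
Variables (L' : nat) (sg : pred nat) (f : R -> C) (K : R).
Let L := L'.+1.
Hypothesis gam1 : 1 < gam.
Hypothesis mf : cmeas f.
Hypothesis fK : forall x, sqmod (f x) <= K.

Let pos (x : R) (j : nat) := fold gam (x - j%:R).

Let X := [set x | 0 <= x < 1 /\ forall j : 'I_L, (pos x j < 1) = sg j].

Let gamge : 1 <= gam. Proof. exact: ltW. Qed.

Lemma measurable_pattern : measurable X.
Proof.
have -> : X = [set x | 0 <= x < 1] `&` \bigcap_(j in [set` 'I_L]) [set x | (pos x j < 1) = sg j].
  apply/seteqP; split => x; first by move=> [h1 h2]; split => // j _; exact: h2.
  by move=> [h1 h2]; split => // j; exact: (h2 j).
apply: measurableI.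
  by rewrite (_ : [set x | _] = `[0, 1[)//; apply/seteqP; split => x /=; rewrite in_itv.
apply: fin_bigcap_measurable => // j _.
have mp : measurable_fun setT (fun x : R => pos x j).
  apply: (measurableT_comp (measurable_fold gam)).
  exact: measurable_funB.
have mlt : measurable_fun setT (fun x : R => pos x j < 1) by apply: measurable_fun_ltr.
have := mlt measurableT [set sg j] I; rewrite setTI.
by congr (measurable _); apply/seteqP; split.
Qed.

Variable Bm : 'M[C]_(L - r, L).
Hypothesis Bm1 : forall j : 'I_L, sg j -> forall k,
  \sum_(i < L - r) (if (i <= j)%N then (cofilter J)`_(j - i) else 0) * Bm i k = (j == k)%:R.

Let lead (p : R) : C := a J * cexp (lam J * p%:C).

Let lead_neq0 p : lead p != 0.
Proof. by rewrite mulf_neq0// cexp_neq0. Qed.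

(** Dividing by the dominant exponential gives the entries finite limits at +oo, namely the
    coefficients of [cofilter J]. *)
Let entry (p : R) (j i : nat) : C :=
  if (i <= j)%N then (lead p)^-1 * shift_coef (j - i) p else 0.

(** The identity rows at the unconstrained places make the system square without imposing a
    condition there. *)
Let G (p : 'I_L -> R) : 'M[C]_L := \matrix_(j, k)
  if sg j then \sum_(i < L - r) entry (p j) j i * Bm i k else (j == k)%:R.

Let entryE c j i x : entry (x - c) j i =
  \sum_l (if (i <= j)%N then (a J)^-1 * a l * cexp ((lam l - lam J) * (- c)%:C) * (cofilter l)`_(j - i) else 0)
    * cexp ((lam l - lam J) * x%:C).
Proof.
rewrite /entry; case: (i <= j)%N; last by rewrite big1// => l _; rewrite mul0r.
rewrite /lead /shift_coef mulr_sumr; apply: eq_bigr => l _.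
rewrite invfM -cexpN.
have -> : (lam l - lam J) * x%:C = lam l * x%:C - lam J * x%:C by ring.
have -> : (lam l - lam J) * (- c)%:C = - (lam l * c%:C) + lam J * c%:C by rewrite rmorphN/=; ring.
have -> : - (lam J * (x - c)%:C) = - (lam J * x%:C) + lam J * c%:C by rewrite rmorphB/=; ring.
have -> : lam l * (x - c)%:C = lam l * x%:C + - (lam l * c%:C) by rewrite rmorphB/=; ring.
rewrite !cexpD.
move: (cexp _) (cexp (- (lam J * x%:C))) (cexp (- (lam l * c%:C))) (cexp _) => e1 e2 e3 e4.
by ring.
Qed.

Let expsum_entry c j i : expsum (fun x => entry (x - c) j i).
Proof.
under eq_fun do rewrite entryE.
by apply: expsum_sum => l; exact: expsum_mono.
Qed.

Let tends_entry c j i :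
  tends (fun x => entry (x - c) j i) (if (i <= j)%N then (cofilter J)`_(j - i) else 0).
Proof.
under eq_fun do rewrite entryE.
pose t l : C := if l == J then (if (i <= j)%N then (cofilter J)`_(j - i) else 0) else 0.
rewrite (_ : (if _ then _ else _) = \sum_l t l); last first.
  by rewrite (bigD1 J)//= /t eqxx big1 ?addr0// => l /negbTE ->.
apply: tends_sum => l _; rewrite /t; case: eqP => [->|/eqP lJ].
  rewrite (_ : (fun x => _) = fun=> (if (i <= j)%N then (cofilter J)`_(j - i) else 0)).
    exact: tends_cst.
  by apply/funext => x; rewrite subrr !mul0r cexp0 !mulr1 mulVf// mul1r.
rewrite -[X in tends _ X](mulr0 (if (i <= j)%N then (a J)^-1 * a l * cexp ((lam l - lam J) * (- c)%:C) * (cofilter l)`_(j - i) else 0)).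
apply: tendsM; first exact: tends_cst.
by apply: tends_cexp; rewrite cReD cReN subr_lt0; exact: ReJ.
Qed.

(** With the numbers of turns [nu] fixed, the entries are exponential sums in [x]. The true numbers
    of turns vary with [x], but they take only countably many values. *)
Let countable_det_zeros (nu : 'I_L -> int) :
  countable [set x : R | \det (G (fun j => x - j%:R - gam * (nu j)%:~R)) = 0].
Proof.
have eE (x : R) (j : 'I_L) : x - j%:R - gam * (nu j)%:~R = x - (j%:R + gam * (nu j)%:~R).
  by rewrite opprD addrA.
apply: countable_expsum_zeros.
  apply: expsum_det => j k.
  under eq_fun do rewrite mxE eE.
  case: (sg j); last exact: expsum_cst.
  apply: expsum_sum => i; apply: expsumM; last exact: expsum_cst.
  exact: expsum_entry.
apply: (@tends_neq0 _ _ (\det (1%:M : 'M[C]_L))); last by rewrite det1 oner_neq0.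
apply: tends_det => j k; rewrite mxE.
under eq_fun do rewrite mxE eE.
case sj : (sg j); last exact: tends_cst.
rewrite -(Bm1 sj); apply: tends_sum => i _; apply: tendsM; last exact: tends_cst.
exact: tends_entry.
Qed.

Let D (x : R) := \det (G (fun j => pos x j)).

Let countable_zeros : countable [set x | D x = 0].
Proof.
apply: (@sub_countable _ _ _ (\bigcup_(nu in [set: {ffun 'I_L -> int}])
  [set x : R | \det (G (fun j => x - j%:R - gam * (nu j)%:~R)) = 0])); last first.
  by apply: bigcup_countable => // nu _; exact: countable_det_zeros.
apply: subset_card_le => x /= Dx.
exists [ffun j : 'I_L => Num.floor ((x - j%:R) / gam)] => //=.
rewrite -[RHS]Dx; congr (\det (G _)); apply/funext => j.
by rewrite ffunE.
Qed.

(** Cramer's rule: [Bm] applied to column 0 of the inverse of [G], the input whose normalized output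
    is 1 at place 0 and 0 at the other constrained places. *)
Let v (x : R) (i : 'I_(L - r)) : C :=
  (\sum_k Bm i k * (\adj (G (fun j => pos x j))) k ord0) / D x.

Let v_solves x (j : 'I_L) : D x != 0 -> sg j ->
  \sum_(i < L - r) entry (pos x j) j i * v x i = (j == ord0)%:R.
Proof.
move=> Dx sj.
have := congr1 (fun A : 'M[C]_L => A j ord0) (mul_mx_adj (G (fun j => pos x j))).
rewrite !mxE -/(D x) => h.
apply: (mulIf Dx); rewrite mulr_suml mulr_natl -h.
under [RHS]eq_bigr do rewrite mxE sj mulr_suml.
rewrite exchange_big/=; apply: eq_bigr => i _.
rewrite /v -mulrA divfK// mulr_sumr; apply: eq_bigr => k _; exact: mulrA.
Qed.

Let cmeas_entry (j : 'I_L) i : cmeas (fun x => entry (pos x j) j i).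
Proof.
rewrite /entry; case: (i <= j)%N; last exact: cmeas_cst.
apply: (cmeas_comp (f := fun p => (lead p)^-1 * shift_coef (j - i) p)).
  apply: cmeasM; last exact: cmeas_shift_coef.
  by apply: cmeasV; apply: cmeasM; [exact: cmeas_cst|exact: cmeas_cexp].
apply: (measurableT_comp (measurable_fold gam)).
exact: measurable_funB.
Qed.

Let cmeas_det n (A : R -> 'M[C]_n) :
  (forall i j, cmeas (fun x => A x i j)) -> cmeas (fun x => \det (A x)).
Proof.
move=> mA; apply: cmeas_sum => s; apply: cmeasM; first exact: cmeas_cst.
by apply: cmeas_prod.
Qed.

Let cmeas_G (j k : 'I_L) : cmeas (fun x => G (fun j => pos x j) j k).
Proof.
under eq_fun do rewrite mxE.
case: (sg j); last exact: cmeas_cst.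
apply: cmeas_sum => i; apply: cmeasM; [exact: cmeas_entry|exact: cmeas_cst].
Qed.

Let cmeas_D : cmeas D.
Proof. by apply: cmeas_det; exact: cmeas_G. Qed.

Let cmeas_v i : cmeas (v^~ i).
Proof.
apply: cmeasM; last exact: cmeasV.
apply: cmeas_sum => k; apply: cmeasM; first exact: cmeas_cst.
under eq_fun do rewrite mxE.
apply: cmeasM; first exact: cmeas_cst.
apply: cmeas_det => p q; under eq_fun do rewrite 2!mxE.
exact: cmeas_G.
Qed.

Let X' := X `&` [set x | D x != 0].

Let measurable_X' : measurable X'.
Proof.
apply: measurableI; first exact: measurable_pattern.
rewrite (_ : [set x | _] = ~` [set x | sqmod (D x) <= 0]); last first.
  apply/seteqP; split => x /=.
    by rewrite -sqmod_eq0 => /negP h1 h2; apply: h1; rewrite eq_le h2 sqmod_ge0.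
  by move=> /negP h; rewrite -sqmod_eq0; apply: contra h => /eqP ->.
apply: measurableC; rewrite -[X in measurable X]setTI; apply: measurable_fun_le => //.
exact: measurable_sqmod.
Qed.

Let pattern_approx' : filt_approx r.+1 gam shift_coef (fun x => (\1_X' x)%:C * f x).
Proof.
have [KB hKB] := shift_coef_bounded.
(* Output 0 sits at [x] itself, and the normalization by [lead] has divided it by [lead x]; the
   factor [f x / lead x] makes the actual output [f x]. *)
pose u (i : 'I_(L - r)) x := (\1_X' x)%:C * (v x i * (f x / lead x)).
apply: (@filt_approx_trunc _ _ _ _ KB gamge cmeas_shift_coef hKB _ u _ K).
- move=> i; apply: cmeasM; first exact: cmeas_indic.
  apply: cmeasM; first exact: cmeas_v.
  apply: cmeasM => //.
  by apply: cmeasV; apply: cmeasM; [exact: cmeas_cst|exact: cmeas_cexp].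
- by apply: cmeasM => //; exact: cmeas_indic.
- move=> x; apply: le_trans (fK x); rewrite sqmodM sqmodR indicE.
  by case: (_ \in _); rewrite ?expr1n ?mul1r// expr0n mul0r sqmod_ge0.
move=> E y hy; rewrite /filt.
pose h i (j : nat) : C := let x := fold gam (y + j%:R) in (\1_E x)%:C * u i x.
pose F (k i : nat) : C := if insub i is Some i' then shift_coef k y * h i' (k + i)%N else 0.
transitivity (\sum_(k < r.+1) \sum_(i < L - r) F k i).
  apply: eq_bigr => k _; rewrite mulr_sumr; apply: eq_bigr => i _.
  by rewrite /F valK /h natrD addrA.
rewrite (@reindex_filter _ r.+1 (L - r) L)//; last first.
  move=> k i rk; rewrite /F; case: insubP => // i' _ _.
  by rewrite shift_coef0// mul0r.
have hyg : 0 <= y < gam by case/andP: hy => -> /= hy1; apply: lt_trans hy1 gam1.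
have fy : fold gam y = y by rewrite fold_id.
(* The terms with [k + i = j] all come from one source point [x], equal to [y + j] modulo [gam], for
   which [pos x j = y]. They form row [j] of the system attached to [x]. *)
have row (j : 'I_L) : \sum_(i < L - r) (if (i <= j)%N then F (j - i)%N i else 0) =
    if j == ord0 then (\1_E y)%:C * ((\1_X' y)%:C * f y) else 0.
  set x := fold gam (y + j%:R).
  have [xX'|xX'] := boolP (x \in X'); last first.
    have ind0 : \1_X' x = 0 :> R by rewrite indicE (negbTE xX').
    rewrite big1 => [|i _].
      case: eqP => // j0.
      suff -> : \1_X' y = 0 :> R by rewrite mul0r mulr0.
      by rewrite -ind0 /x j0 addr0 fy.
    case: leqP => // ij; rewrite /F valK /h subnK// -/x /u.
    by rewrite ind0 mul0r !mulr0.
  have ind1 : \1_X' x = 1 :> R by rewrite indicE xX'.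
  have [[hx hsg] Dx] : X' x by rewrite inE in xX'.
  have [n hn] := foldE gam (y + j%:R); rewrite -/x in hn.
  have posx : pos x j = y.
    rewrite /pos (@fold_uniq _ _ gamge _ (- n)).
      by rewrite hn rmorphN/=; ring.
    by rewrite (_ : _ - _ = y)// hn rmorphN/=; ring.
  have sj : sg j by rewrite -hsg posx; case/andP: hy.
  transitivity ((\1_E x)%:C * lead y * (f x / lead x) * \sum_(i < L - r) entry (pos x j) j i * v x i).
    rewrite mulr_sumr; apply: eq_bigr => i _.
    rewrite posx /entry; case: leqP => ij; last by rewrite mul0r mulr0.
    rewrite /F valK /h subnK// -/x /u ind1 mul1r.
    have := lead_neq0 y; move: (lead y) (f x / lead x) (v x i) (shift_coef _ _) (\1_E x)%:C => p q b s e p0.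
    by field.
  rewrite v_solves//; case: eqP => j0; last by rewrite mulr0.
  have xy : x = y by rewrite /x j0 addr0 fy.
  rewrite -xy ind1 mulr1 mul1r -mulrA; congr (_ * _).
  by rewrite mulrC divfK.
rewrite (eq_bigr _ (fun j _ => row j)) (bigD1 ord0)//= big1 ?addr0//.
by move=> j /negbTE ->.
Qed.

Lemma pattern_approx : filt_approx r.+1 gam shift_coef (fun x => (\1_X x)%:C * f x).
Proof.
move=> eps e0; have [s hs] := pattern_approx' e0; exists s.
rewrite (_ : n2 _ _ = n2 `[0, 1[ (fun x => filt r.+1 shift_coef (trig_eval gam s) x - (\1_X' x)%:C * f x))//.
have mfl : cmeas (filt r.+1 shift_coef (trig_eval gam s)).
  apply: cmeas_filt; [exact: cmeas_shift_coef|exact: cmeas_trig].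
apply: (@eq_nnint_countable _ [set x | D x = 0]) => //.
- apply: measurable_sqmod; apply: cmeasB => //; apply: cmeasM => //.
  by apply: cmeas_indic; exact: measurable_pattern.
- by apply: measurable_sqmod; apply: cmeasB => //; apply: cmeasM => //; exact: cmeas_indic.
- by move=> x; exact: sqmod_ge0.
- by move=> x; exact: sqmod_ge0.
move=> x /eqP Dx; suff -> : \1_X' x = \1_X x :> R by [].
rewrite !indicE; congr (_%:R); congr (nat_of_bool _); apply/idP/idP => /set_mem h.
  by apply: mem_set; case: h.
by apply: mem_set; split.
Qed.

End Pattern.
(** If all places from [k] on lay in [0, 1[, each step [x |-> x - 1] would raise the representative
    modulo [gam] by [gam - 1 > 0], and it could not stay below 1. *)
Let slots_infinite x : 1 < gam ->
  forall k, exists2 s, (k <= s)%N & ~~ (fold gam (x - s%:R) < 1).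
Proof.
move=> gam1 k; apply: contrapT => h.
have gamge := ltW gam1.
have small s : (k <= s)%N -> fold gam (x - s%:R) < 1.
  by move=> ks; apply/negPn/negP => hs; apply: h; exists s.
have step n : fold gam (x - (k + n)%:R) = fold gam (x - k%:R) + n%:R * (gam - 1).
  elim: n => [|n IH]; first by rewrite addn0 mul0r addr0.
  have [q hq] := foldE gam (x - (k + n)%:R).
  have lt1 := small (k + n)%N (leq_addr _ _).
  have /andP[ge0 _] := fold_bounds gamge (x - (k + n)%:R).
  have e : x - (k + n.+1)%:R - gam * (q - 1)%:~R = fold gam (x - (k + n)%:R) + (gam - 1).
    by rewrite hq addnS -natr1 rmorphB/=; ring.
  rewrite (@fold_uniq _ _ gamge _ (q - 1)) e.
    by rewrite IH -natr1; ring.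
  by apply/andP; split; lra.
pose n := (Num.truncn (gam - 1)^-1).+1.
have := small (k + n)%N (leq_addr _ _); rewrite step.
have /andP[ge0 _] := fold_bounds gamge (x - k%:R).
have g0 : 0 < gam - 1 by rewrite subr_gt0.
have : 1 < n%:R * (gam - 1) by rewrite -ltr_pdivrMr// div1r; exact: truncnS_gt.
lra.
Qed.

(** For each length [n + 1] the interval [0, 1[ splits into finitely many visit patterns, and the
    equation is solved on those with enough unconstrained places. Each [x] lies in such a pattern
    for all large [n], so the solved parts converge to [f] boundedly. *)
Lemma shift_filt_approx_gt1 f K : 1 < gam -> cmeas f -> (forall x, sqmod (f x) <= K) ->
  filt_approx r.+1 gam shift_coef f.
Proof.
move=> gam1 mf fK.
have gamge := ltW gam1.
have [KB hKB] := shift_coef_bounded.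
have K0 : 0 <= K by apply: le_trans (fK 0); exact: sqmod_ge0.
pose sg n (s : {ffun 'I_n.+1 -> bool}) (k : nat) : bool := if insub k is Some i then s i else false.
pose X n (s : {ffun 'I_n.+1 -> bool}) :=
  [set x : R | 0 <= x < 1 /\ forall j : 'I_n.+1, (fold gam (x - j%:R) < 1) = sg n s j].
pose good n s := row_full (pow_mx z (fun k => ~~ sg n s k) n.+1).
pose F n s x : C := if good n s then (\1_(X n s) x)%:C * f x else 0.
pose pat n x := [ffun j : 'I_n.+1 => fold gam (x - j%:R) < 1].
have sgpat n x (j : 'I_n.+1) : sg n (pat n x) j = (fold gam (x - j%:R) < 1).
  by rewrite /sg valK ffunE.
have Xpat n x s : 0 <= x < 1 -> \1_(X n s) x = (s == pat n x)%:R :> R.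
  move=> hx; rewrite indicE; congr (_%:R); congr (nat_of_bool _); apply/idP/eqP => [/set_mem[_ h]|->].
    by apply/ffunP => j; rewrite ffunE h /sg valK.
  by apply: mem_set; split => // j; rewrite sgpat.
have mX n s : measurable (X n s).
  exact: measurable_pattern.
have sumF n x : 0 <= x < 1 -> \sum_(s : {ffun 'I_n.+1 -> bool}) F n s x =
    if good n (pat n x) then f x else 0.
  move=> hx; rewrite (bigD1 (pat n x))//= big1 ?addr0 => [|s sp].
    by rewrite /F Xpat// eqxx mul1r.
  by rewrite /F Xpat// (negbTE sp) mul0r if_same.
have mF n s : cmeas (F n s).
  rewrite /F; case: (good n s); last exact: cmeas_cst.
  by apply: cmeasM => //; exact: cmeas_indic.
apply: (@filt_approx_lim _ _ _ _ cmeas_shift_coef _ (fun n x => \sum_(s : {ffun 'I_n.+1 -> bool}) F n s x) K) => //.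
- by move=> n; exact: cmeas_sum.
- move=> n; apply: filt_approx_sum => // [|s].
    exact: cmeas_shift_coef.
  rewrite /F; case: (boolP (good n s)) => gs; last exact: filt_approx0.
  have [Bm hBm] := filter_right_inverse injm (fun l => m0 (lift J l)) gs.
  exact: (pattern_approx gam1 mf fK hBm).
- move=> n x hx; rewrite sumF//; case: ifP => _; first by rewrite subrr sqmod0.
  by rewrite sub0r sqmodN.
move=> x hx; have [L0 hL0] := powers_span z_neq0 zd (slots_infinite x gam1).
exists L0 => n nn; rewrite sumF//.
suff -> : good n (pat n x) by [].
have := hL0 n.+1 (leqW nn).
congr (row_full _); apply/matrixP => s l; rewrite !mxE.
by rewrite -sgpat.
Qed.

(** Here [b] has period 1, so the equation at [x] is [S x * b x = f x] with [S] the sum of the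
    coefficients. Its leading coefficient contains [cofilter J] at 1, a product of the [m l - 1]
    over [l != J], nonzero because no [m l] has modulus 1. *)
Lemma shift_filt_approx_eq1 f K : gam = 1 -> (forall l, sqmod (m l) != 1) ->
  cmeas f -> (forall x, sqmod (f x) <= K) -> filt_approx r.+1 gam shift_coef f.
Proof.
move=> gam1 m1 mf fK.
have gamge : 1 <= gam by rewrite gam1.
have [KB hKB] := shift_coef_bounded.
pose S x := \sum_(k < r.+1) shift_coef k x.
pose q j : C := \sum_(k < r.+1) (cofilter j)`_k.
have SE x : S x = \sum_j a j * q j * cexp (lam j * x%:C).
  rewrite /S /shift_coef exchange_big/=; apply: eq_bigr => j _.
  by rewrite /q mulr_sumr mulr_suml; apply: eq_bigr => k _; rewrite mulrAC.
have qJ : q J != 0.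
  rewrite (_ : q J = (cofilter J).[1]); last first.
    rewrite horner_coef size_cofilter; apply: eq_bigr => k _.
    by rewrite expr1n mulr1.
  rewrite /cofilter /filter_poly horner_prod; apply/prodf_neq0 => l _.
  rewrite !hornerE subr_eq0; apply: contraNN (m1 (lift J l)) => /eqP ->.
  by rewrite sqmod1.
have cS : countable [set x | S x = 0].
  rewrite (_ : [set x | _] = [set x | S x * cexp (- lam J * x%:C) = 0]); last first.
    apply/seteqP; split => x /= => [->|/eqP]; first by rewrite mul0r.
    by rewrite mulf_eq0 (negbTE (cexp_neq0 _)) orbF => /eqP.
  have TE x : S x * cexp (- lam J * x%:C) = \sum_j a j * q j * cexp ((lam j - lam J) * x%:C).
    rewrite SE mulr_suml; apply: eq_bigr => j _.
    by rewrite -mulrA -cexpD; congr (_ * cexp _); ring.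
  apply: countable_expsum_zeros.
    under eq_fun do rewrite TE.
    by apply: expsum_sum => j; exact: expsum_mono.
  apply: (@tends_neq0 _ _ (a J * q J)); last by rewrite mulf_neq0.
  under eq_fun do rewrite TE.
  rewrite (_ : a J * q J = \sum_j (if j == J then a J * q J else 0)); last first.
    by rewrite (bigD1 J)//= eqxx big1 ?addr0// => j /negbTE ->.
  apply: tends_sum => j _; case: eqP => [->|/eqP jJ].
    rewrite (_ : (fun x => _) = fun=> a J * q J); first exact: tends_cst.
    by apply/funext => x; rewrite subrr mul0r cexp0 mulr1.
  rewrite -[X in tends _ X](mulr0 (a j * q j)); apply: tendsM; first exact: tends_cst.
  by apply: tends_cexp; rewrite cReD cReN subr_lt0; exact: ReJ.
have mS : cmeas S by apply: cmeas_sum => k; exact: cmeas_shift_coef.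
(* [S x / S x] is 0 at a zero of [S], so the identity required of the truncated solution holds at
   every point; the countable set of zeros is dealt with afterwards. *)
have main : filt_approx r.+1 gam shift_coef (fun x => S x / S x * f x).
  apply: (@filt_approx_trunc _ _ _ _ KB gamge cmeas_shift_coef hKB 1 (fun _ x => f x / S x) _ K).
  - by move=> _; apply: cmeasM => //; exact: cmeasV.
  - by apply: cmeasM => //; apply: cmeasM => //; exact: cmeasV.
  - move=> x; have [->|Sx] := eqVneq (S x) 0.
      by rewrite mul0r mul0r sqmod0; apply: le_trans (fK 0); exact: sqmod_ge0.
    by rewrite divff// mul1r.
  move=> E x hx; rewrite /filt.
  have fx (k : nat) : fold gam (x + k%:R + 0%:R) = x.
    rewrite (@fold_uniq _ _ gamge _ k) gam1 addr0 mul1r.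
      by rewrite -pmulrn addrK.
    by rewrite -pmulrn addrK.
  transitivity (\sum_(k < r.+1) shift_coef k x * ((\1_E x)%:C * (f x / S x))).
    by apply: eq_bigr => k _; rewrite big_ord1 fx.
  by rewrite -mulr_suml -/(S x); ring.
move=> eps e0; have [s hs] := main _ e0; exists s.
rewrite (_ : n2 _ _ = n2 `[0, 1[ (fun x => filt r.+1 shift_coef (trig_eval gam s) x - S x / S x * f x))//.
have mfl : cmeas (filt r.+1 shift_coef (trig_eval gam s)).
  by apply: cmeas_filt; [exact: cmeas_shift_coef|exact: cmeas_trig].
apply: (@eq_nnint_countable _ [set x | S x = 0]) => //.
- by apply: measurable_sqmod; exact: cmeasB.
- apply: measurable_sqmod; apply: cmeasB => //; apply: cmeasM => //; apply: cmeasM => //; exact: cmeasV.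
- by move=> x; exact: sqmod_ge0.
- by move=> x; exact: sqmod_ge0.
by move=> x /eqP Sx; rewrite divff// mul1r.
Qed.

End ShiftFilter.

(** * Discrete delta functions on a fiber *)

Section FiberClaim.
Variable R : realType.
Local Notation C := R[i].
Local Notation mu := (@lebesgue_measure R).
Local Open Scope classical_set_scope.

(** The integral of [exp (l x)] over [0, 1]. *)
Definition int_cexp (l : C) : C := if l == 0 then 1 else (cexp l - 1) / l.

Lemma continuous_Re_expsum (z : C) s : continuous (fun x : R => Re (z * expsum_eval s x)).
Proof.
elim: s => [|q s IH].
  rewrite (_ : (fun x => _) = fun=> 0); first by move=> x; exact: cvg_cst.
  by apply/funext => x; rewrite /expsum_eval big_nil mulr0.
rewrite (_ : (fun x => _) = fun x : R => Re (z * q.1 * cexp (q.2 * x%:C)) + Re (z * expsum_eval s x)).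
  by move=> x; apply: cvgD; [exact: continuous_Re_cexp|exact: IH].
by apply/funext => x; rewrite /expsum_eval big_cons mulrDr cReD mulrA.
Qed.

Let integrable01 (h : R -> R) : continuous h -> mu.-integrable `[0, 1] (EFin \o h).
Proof.
move=> ch; apply: continuous_compact_integrable; first exact: segment_compact.
exact: continuous_subspaceT.
Qed.

Lemma Rintegral_Re_expsum (z : C) s :
  (\int[mu]_(x in `[0%R, 1%R]) Re (z * expsum_eval s x))%R =
  Re (z * \sum_(q <- s) q.1 * int_cexp q.2).
Proof.
elim: s => [|q s IH].
  rewrite big_nil (eq_Rintegral mu (g := cst 0)); last first.
    by move=> x _; rewrite /expsum_eval big_nil mulr0.
  by rewrite Rintegral_cst// mul0r mulr0.
rewrite (eq_Rintegral mu (g := (fun x : R => Re (z * q.1 * cexp (q.2 * x%:C))) \+ (fun x : R => Re (z * expsum_eval s x)))); last first.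
  by move=> x _; rewrite /expsum_eval big_cons mulrDr cReD mulrA.
rewrite RintegralD//; last 2 first.
- by apply: integrable01; exact: continuous_Re_cexp.
- by apply: integrable01; exact: continuous_Re_expsum.
rewrite IH big_cons mulrDr cReD; congr (_ + _).
rewrite /int_cexp; case: eqP => [->|/eqP q0].
  rewrite (eq_Rintegral mu (g := cst (Re (z * q.1)))); last first.
    by move=> x _; rewrite mul0r cexp0 mulr1.
  by rewrite Rintegral_cst//= lebesgue_measure_itv/= lte_fin ltr01 oppr0 adde0/= !mulr1.
rewrite Rintegral_Re_cexp// rmorph1 rmorph0 mulr1 mulr0 cexp0; congr Re.
by move: (q.2^-1) (cexp q.2) => u v; ring.
Qed.

Lemma cmeas_expsum_eval s : cmeas (expsum_eval s : R -> C).
Proof.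
by apply: cmeas_sum => q; apply: cmeasM; [exact: cmeas_cst|exact: cmeas_cexp].
Qed.

Lemma ip_box_expsum s (k : int) (b : bool) :
  ip (fun x => (\1_(`[0%R, 1%R[ : set R) x)%:C * expsum_eval s x) (box 1 `[0, 1[ (- k) b) =
  Re ((if b then - 'i%C else 1) * \sum_(q <- s) q.1 * int_cexp (q.2 + Complex 0 (2 * pi * k%:~R))).
Proof.
pose z : C := if b then - 'i%C else 1.
pose s' := [seq (q.1, q.2 + Complex 0 (2 * pi * k%:~R)) | q <- s].
have sE x : expsum_eval s' x = expsum_eval s x * expi (2 * pi * k%:~R * x).
  rewrite /expsum_eval big_map mulr_suml; apply: eq_bigr => q _ /=.
  by rewrite mulrDl cexpD expi_Cexp mulrA.
rewrite /ip (eq_Rintegral mu (g := (fun t => Re (z * expsum_eval s' t)) \_ `[0, 1[)); last first.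
  move=> t _; rewrite /patch /box indicE; case: (t \in _); last first.
    by rewrite !Re_mulR !Im_mulR !mul0r addr0.
  rewrite invr1 sqrtr1 sE rmorphN/= mulr1 mulrN mulNr.
  rewrite /z; move: (2 * pi * k%:~R * t) => y.
  rewrite !mul1r; move: (expsum_eval s t) => e.
  by case: b {z} => []; rewrite !(cReM, cImM, cReN, cImN) /= cosN sinN; ring.
rewrite -Rintegral_mkcond Rintegral_itv_bndo_bndc//; last first.
  apply: (@integrableS _ _ _ mu `[0, 1]) => //.
    by apply: subset_itvl; rewrite bnd_simp.
  by apply: integrable01; exact: continuous_Re_expsum.
by rewrite Rintegral_Re_expsum /s' big_map.
Qed.

(* The summands are the squared moduli of Fourier coefficients on [[0, 1]]. *)
Lemma expsum_bessel (s : seq (C * C)) (n c : nat) :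
  ((\sum_(k < n) sqmod (\sum_(q <- s) q.1 * int_cexp (q.2 + Complex 0 (2 * pi * (k%:R - c%:R)))))%:E
    <= n2 `[0%R, 1%R[ (expsum_eval s))%E.
Proof.
pose nu (k : 'I_n) : int := - (k%:Z - c%:Z).
have inu : injective nu by move=> k l /oppr_inj /addIr [] /ord_inj.
have bdd : exists K, forall x, `[0, 1[ x -> sqmod (expsum_eval s x) <= K.
  exists ((size s)%:R * \sum_(q <- s) sqmod q.1 * expR `|Re q.2| ^+ 2) => x /=.
  rewrite in_itv/= => /andP[x0 x1].
  apply: le_trans (sqmod_sum_le _ _) _; apply: ler_wpM2l; first exact: ler0n.
  apply: ler_sum => q _; rewrite sqmodM; apply: ler_wpM2l; first exact: sqmod_ge0.
  rewrite sqmod_cexp ler_sqr ?nnegrE ?expR_ge0// ler_expR mulrC Re_mulR mulrC.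
  apply: le_trans (ler_norm _) _; rewrite normrM (ger0_norm x0).
  by rewrite ler_piMr// ltW.
have [K hK] := bdd.
have L2f : L2 (fun x => (\1_(`[0%R, 1%R[ : set R) x)%:C * expsum_eval s x).
  apply: (L2_indic_bounded (K := K)) => //.
    by rewrite lebesgue_measure_itv/= lte_fin ltr01 -EFinB ltry.
  exact: cmeas_expsum_eval.
have := @box_bessel R 1 ltr01 _ nu `[0, 1[ 0 _ inu (measurable_itv _) _ L2f.
rewrite add0r => /(_ (@subset_refl _ _)).
rewrite (_ : n2 `[0, 1[ (fun x => _ * _) = n2 `[0, 1[ (expsum_eval s)); last first.
  by apply: eq_n2 => x hx; rewrite indicE mem_set// mul1r.
apply: le_trans; rewrite lee_fin le_eqVlt; apply/orP; left; apply/eqP.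
rewrite -(pair_bigA _ (fun (j : 'I_n) b => ip (fun x => (\1_(`[0%R, 1%R[ : set R) x)%:C * expsum_eval s x) (box 1 `[0, 1[ (nu j) b) ^+ 2))/=.
apply: eq_bigr => k _; rewrite big_bool /nu !ip_box_expsum rmorphB/= -!pmulrn.
move: (\sum_(_ <- _) _) => S.
by rewrite /sqmod !(cReM, cImM, cReN, cImN)/=; ring.
Qed.

(** The link between [g] and Fourier coefficients: the exponent is [2 pi i (y + d - i w)], and as
    [exp (2 pi i d) = 1] the numerator does not depend on [d]. *)
Lemma int_cexp_pole (w : C) (y : R) (d : int) : Re w != 0 ->
  int_cexp (Complex 0 (2 * pi * y) + (2 * pi)%:C * w + Complex 0 (2 * pi * d%:~R)) =
  (cexp ((2 * pi)%:C * w) * expi (2 * pi * y) - 1) /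
    (Complex 0 (2 * pi) * (Complex (y + d%:~R) 0 - Complex 0 1 * w)).
Proof.
move=> w0; have pi2 : 0 < 2 * pi :> R by rewrite mulr_gt0// pi_gt0.
have e : Complex 0 (2 * pi * y) + (2 * pi)%:C * w + Complex 0 (2 * pi * d%:~R) =
    Complex 0 (2 * pi) * (Complex (y + d%:~R) 0 - Complex 0 1 * w).
  by apply: complexP; rewrite !(cReM, cImM, cReD, cImD, cReN, cImN) /=; ring.
have nz : Complex 0 (2 * pi) * (Complex (y + d%:~R) 0 - Complex 0 1 * w) != 0.
  rewrite -e; apply/eqP => /(congr1 (@complex.Re R)).
  rewrite !cReD Re_mulR /= add0r addr0 => /eqP.
  by rewrite mulf_eq0 (negbTE w0) orbF gt_eqF.
rewrite /int_cexp e (negbTE nz) -e; congr ((_ - 1) / _).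
by rewrite !cexpD -!expi_cexp expi_2piz mulr1 mulrC.
Qed.

Section Fiber.
Variables (r : nat) (a w : 'I_r.+1 -> C) (alpha t : R).
Hypothesis a0 : forall j, a j != 0.
Hypothesis w0 : forall j, Re (w j) != 0.
Hypothesis wd : forall j k, j != k -> Re (w j) != Re (w k).
Hypothesis alpha0 : 0 < alpha.
Hypothesis alpha1 : alpha <= 1.

Let lam j : C := (2 * pi)%:C * w j.
Let m j : C := cexp (lam j) * expi (2 * pi * t).
Let om (q : int) : C := expi (2 * pi * alpha * q%:~R).
Let ii : C := Complex 0 (2 * pi).
Let P (q : int) : C := \prod_l (m l * om q - 1).

Let pi2 : 0 < 2 * pi :> R. Proof. by rewrite mulr_gt0// pi_gt0. Qed.

Let ii_neq0 : ii != 0.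
Proof.
by rewrite -sqmod_eq0 /sqmod/= expr0n/= add0r expf_neq0// gt_eqF.
Qed.

Let m_neq0 j : m j != 0.
Proof. by rewrite mulf_neq0 ?cexp_neq0// expi_cexp cexp_neq0. Qed.

Let sqmod_m j : sqmod (m j) = expR (2 * pi * Re (w j)) ^+ 2.
Proof. by rewrite sqmodM sqmod_expi mulr1 sqmod_cexp Re_mulR. Qed.

Let md j k : j != k -> sqmod (m j) != sqmod (m k).
Proof.
move=> jk; rewrite !sqmod_m eqrXn2 ?expR_ge0// (inj_eq (@expR_inj R)).
by rewrite (inj_eq (mulfI _)) ?wd// gt_eqF.
Qed.

Let m1 j : sqmod (m j) != 1.
Proof.
rewrite sqmod_m [X in _ != X](_ : 1 = expR 0 ^+ 2); last by rewrite expR0 expr1n.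
rewrite eqrXn2 ?expR_ge0// (inj_eq (@expR_inj R)).
by rewrite mulf_neq0// gt_eqF.
Qed.

Let lamd j k : j != k -> Re (lam j) != Re (lam k).
Proof.
by move=> jk; rewrite !Re_mulR (inj_eq (mulfI _)) ?wd// gt_eqF.
Qed.

Let cofilter_mul j q : (cofilter m j).[om q] * (m j * om q - 1) = P q.
Proof.
rewrite /P (bigD1_ord j)//= mulrC; congr (_ * _).
rewrite /cofilter /filter_poly horner_prod; apply: eq_bigr => l _.
by rewrite !hornerE.
Qed.

Let pole (x : R) j : C := Complex x 0 - Complex 0 1 * w j.

Let int_cexp_pole_om j q (d : int) :
  int_cexp (Complex 0 (2 * pi * (t + alpha * q%:~R)) + lam j + Complex 0 (2 * pi * d%:~R)) =
  (m j * om q - 1) / (ii * pole (t + d%:~R + alpha * q%:~R) j).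
Proof.
rewrite int_cexp_pole// (mulrDr (2 * pi) t) expiD (mulrA (2 * pi) alpha) /m /om -(mulrA (cexp _)).
by rewrite /pole (addrAC t).
Qed.

Let approx (f : R -> C) K : cmeas f -> (forall x, sqmod (f x) <= K) ->
  filt_approx r.+1 alpha^-1 (shift_coef a lam m) f.
Proof.
move=> mf fK; have [a1|a1] := eqVneq alpha 1.
  by apply: (shift_filt_approx_eq1 (gam := alpha^-1) a0 lamd m_neq0 _ m1 mf fK); rewrite a1 invr1.
apply: (shift_filt_approx_gt1 (gam := alpha^-1) a0 lamd m_neq0 md _ mf fK).
by rewrite invf_gt1// lt_neqAle a1.
Qed.

Lemma fiber_claim eps : 0 < eps -> exists s : seq (int * C), forall n c : nat,
  \sum_(k < n) sqmod (\sum_(q <- s) q.2 * gfun a w (t + (k%:R - c%:R) - alpha * q.1%:~R)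
     - (k == c :> nat)%:R) <= eps.
Proof.
move=> e0.
(* Chosen so that multiplication by [ii * expi (2 * pi * t * x)] gives the constant 1, whose Fourier
   coefficients are the delta. *)
pose f (x : R) : C := ii^-1 * expi (- (2 * pi * t) * x).
have mf : cmeas f by apply: cmeasM; [exact: cmeas_cst|exact: cmeas_expi].
have fK x : sqmod (f x) <= sqmod ii^-1 by rewrite sqmodM sqmod_expi mulr1.
have sii : 0 < sqmod ii by rewrite sqmod_gt0.
have e1 : 0 < eps / sqmod ii by rewrite divr_gt0.
have [s hs] := approx mf fK e1.
(* The factor [P] cancels the denominators [m j * om q - 1]; the sign changes because the frequency
   [alpha * q] of the input corresponds to the translate [g (x + alpha * q)]. *)
exists [seq (- q.1, q.2 * P q.1) | q <- s] => n c.
(* The error of the filter equation as an exponential sum. Its Fourier coefficients are the errors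
   on the fiber, the term [(- 1, 0)] accounting for the delta. *)
pose S : seq (C * C) := (- 1, 0) :: [seq (ii * q.2 * a j * (cofilter m j).[om q.1],
   Complex 0 (2 * pi * (t + alpha * q.1%:~R)) + lam j) | q <- s, j <- index_enum 'I_r.+1].
have SE x : expsum_eval S x =
    (ii * expi (2 * pi * t * x)) * (filt r.+1 (shift_coef a lam m) (trig_eval alpha^-1 s) x - f x).
  have -> : ii * expi (2 * pi * t * x) * (filt r.+1 (shift_coef a lam m) (trig_eval alpha^-1 s) x - f x) =
      -1 + ii * expi (2 * pi * t * x) * filt r.+1 (shift_coef a lam m) (trig_eval alpha^-1 s) x.
    rewrite mulrBr addrC; congr (_ + _); rewrite /f mulNr expiN.
    by have := expi_neq0 (2 * pi * t * x); move: (expi _) ii_neq0 => u i0 u0; field; rewrite u0.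
  rewrite /expsum_eval /S big_cons/= mul0r cexp0 mulr1; congr (_ + _).
  rewrite big_allpairs_dep/=.
  rewrite /filt; under [X in _ = _ * X]eq_bigr do rewrite /trig_eval mulr_sumr.
  rewrite [X in _ = _ * X]exchange_big/= mulr_sumr; apply: eq_bigr => q _.
  rewrite invrK.
  transitivity (ii * expi (2 * pi * t * x) * (q.2 * expi (2 * pi * alpha * q.1%:~R * x)) *
     \sum_j a j * cexp (lam j * x%:C) * (cofilter m j).[om q.1]).
    rewrite mulr_sumr; apply: eq_bigr => j _.
    rewrite mulrDl cexpD -expi_Cexp.
    have -> : 2 * pi * (t + alpha * q.1%:~R) * x = 2 * pi * t * x + 2 * pi * alpha * q.1%:~R * x by ring.
    rewrite expiD; move: (expi _) (expi _) (cexp _) (_.[_]) => u1 u2 u3 u4.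
    by ring.
  rewrite -mulrA; congr (_ * _).
  under [RHS]eq_bigr do rewrite /shift_coef mulr_suml.
  rewrite [RHS]exchange_big/= mulr_sumr; apply: eq_bigr => j _.
  rewrite horner_coef (size_cofilter m_neq0) !mulr_sumr; apply: eq_bigr => k _.
  have -> : 2 * pi * alpha * q.1%:~R * (x + k%:R) = 2 * pi * alpha * q.1%:~R * x + (2 * pi * alpha * q.1%:~R) *+ k.
    by rewrite -(mulr_natr (2 * pi * alpha * q.1%:~R) k); ring.
  rewrite expiD expiMn -/(om q.1); move: (expi _) (cexp _) (_`_k) (om _ ^+ _) => u1 u2 u3 u4.
  by ring.
have := @expsum_bessel S n c.
rewrite (eq_n2 (g := fun x => (ii * expi (2 * pi * t * x)) * (filt r.+1 (shift_coef a lam m) (trig_eval alpha^-1 s) x - f x))); last by move=> x _; exact: SE.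
have := @n2M_le R `[0, 1[ (fun x => ii * expi (2 * pi * t * x)) (fun x => filt r.+1 (shift_coef a lam m) (trig_eval alpha^-1 s) x - f x) (sqmod ii).
have mfl : cmeas (filt r.+1 (shift_coef a lam m) (trig_eval alpha^-1 s)).
  by apply: cmeas_filt; [exact: cmeas_shift_coef|exact: cmeas_trig].
move=> /(_ (measurable_itv _) (cmeasM (cmeas_cst _) (cmeas_expi _)) (cmeasB mfl mf) (ltW sii)).
have h1 x : `[0, 1[ x -> sqmod (ii * expi (2 * pi * t * x)) <= sqmod ii.
  by move=> _; rewrite sqmodM sqmod_expi mulr1.
move=> /(_ h1) h2 h3; have := le_trans h3 h2.
move=> /le_trans /(_ (lee_wpmul2l _ (ltW hs))); rewrite lee_fin => /(_ (ltW sii)).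
rewrite -EFinM lee_fin (_ : sqmod ii * (eps / sqmod ii) = eps); last first.
  by rewrite mulrC divfK// gt_eqF.
apply: le_trans.
rewrite le_eqVlt; apply/orP; left; apply/eqP; apply: eq_bigr => k _; congr sqmod.
rewrite /S big_cons/= big_allpairs_dep/= big_map/= [RHS]addrC.
have kc : k%:R - c%:R = (k%:Z - c%:Z)%:~R :> R by rewrite rmorphB.
congr (_ + _); last first.
  rewrite add0r kc /int_cexp.
  have -> : (Complex 0 (2 * pi * (k%:Z - c%:Z)%:~R) == 0 :> C) = (k == c :> nat).
    rewrite -sqmod_eq0 /sqmod/= expr0n/= add0r sqrf_eq0 mulf_eq0 gt_eqF//=.
    by rewrite intr_eq0 subr_eq0.
  case: eqP => kc'; first by rewrite mulr1.
  by rewrite -expi_cexp expi_2piz subrr mul0r mulr0; exact: oppr0.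
apply: eq_bigr => q _; rewrite kc /gfun mulr_sumr; apply: eq_bigr => j _.
rewrite int_cexp_pole_om rmorphN/= mulrN opprK -(cofilter_mul j).
have : pole (t + (k%:Z - c%:Z)%:~R + alpha * q.1%:~R) j != 0.
  apply/eqP => /(congr1 (@complex.Im R)).
  rewrite /pole !(cReM, cImM, cReD, cImD, cReN, cImN)/= => /eqP.
  by rewrite mul0r mul1r !add0r oppr_eq0 (negbTE (w0 _)).
rewrite /pole; move: (Complex _ 0 - Complex 0 1 * w j) ((cofilter m j).[om q.1]) (m j * om q.1 - 1) ii_neq0.
by move=> u1 u2 u3 i0 u0; field; rewrite u0.
Qed.

End Fiber.
End FiberClaim.

(** * Square sums of [g] along lattices *)

Section LatticeSums.
Variable R : realType.
Local Notation C := R[i].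
Local Notation mu := (@lebesgue_measure R).
Local Open Scope classical_set_scope.

Let pi2 : 0 < 2 * pi :> R. Proof. by rewrite mulr_gt0// pi_gt0. Qed.

(** The bound depends on [Re l] only; in the application the imaginary part carries the base point
    of the lattice, and the estimate is uniform in it. *)
Let sqmodB1_ge (l : C) : (expR (Re l) - 1) ^+ 2 <= sqmod (cexp l - 1).
Proof.
have -> : sqmod (cexp l - 1) = sqmod (cexp l) - 2 * Re (cexp l) + 1.
  by rewrite /sqmod !(cReD, cImD, cReN, cImN)/=; ring.
have h : Re (cexp l) <= expR (Re l).
  by rewrite /cexp Re_mulR /= ler_piMr ?expR_ge0// cos_le1.
by rewrite sqmod_cexp sqrrB1; lra.
Qed.

(* Up to a constant the summands are the Fourier coefficients of an exponential on
   [[0, 1]], so Bessel's inequality bounds the sum uniformly in [y]. *)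
Let lattice_pole1 (w : C) : Re w != 0 -> exists B : R, forall y (n c : nat),
  \sum_(k < n) sqmod (Complex (y + (k%:R - c%:R)) 0 - Complex 0 1 * w)^-1 <= B.
Proof.
move=> w0.
pose rho := expR (2 * pi * Re w).
pose K := expR `|2 * pi * Re w| ^+ 2.
pose sii := sqmod (Complex 0 (2 * pi) : C).
have d0 : 0 < (rho - 1) ^+ 2.
  rewrite exprn_even_gt0//= subr_eq0 -[X in _ == X]expR0 (inj_eq (@expR_inj R)).
  by rewrite mulf_neq0// gt_eqF.
have sii0 : 0 < sii.
  by rewrite /sii /sqmod/= expr0n/= add0r exprn_gt0.
exists (K * sii / (rho - 1) ^+ 2) => y n c.
pose l : C := Complex 0 (2 * pi * y) + (2 * pi)%:C * w.
have Rel : Re l = 2 * pi * Re w by rewrite cReD Re_mulR /= add0r.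
have := @expsum_bessel R [:: (1, l)] n c.
have cm : cmeas (expsum_eval [:: (1 : C, l)]) by exact: cmeas_expsum_eval.
have bd x : `[0, 1[ x -> sqmod (expsum_eval [:: (1 : C, l)] x) <= K.
  rewrite /= in_itv/= => /andP[x0 x1]; rewrite /expsum_eval big_seq1 mul1r.
  rewrite sqmod_cexp ler_sqr ?nnegrE ?expR_ge0// ler_expR mulrC Re_mulR Rel mulrC.
  apply: le_trans (ler_norm _) _; rewrite normrM (ger0_norm x0).
  by rewrite ler_piMr// ltW.
have := n2_bounded (D := `[0, 1[) (measurable_itv _) cm bd.
rewrite lebesgue_measure_itv/= lte_fin ltr01 -EFinB -EFinM subr0 mulr1.
move=> h1 /le_trans /(_ h1); rewrite lee_fin => h2.
rewrite ler_pdivlMr// -ler_pdivrMr//.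
apply: le_trans h2; rewrite !mulr_suml; apply: ler_sum => k _.
rewrite big_seq1 mul1r.
have -> : k%:R - c%:R = (k%:Z - c%:Z)%:~R :> R by rewrite rmorphB.
rewrite int_cexp_pole//; move: (Complex (_ + _) 0 - _ * w) => u.
rewrite invfM mulrC 2!sqmodM (sqmodV (Complex 0 (2 * pi))) -/sii [leRHS]mulrCA.
apply: ler_wpM2l; first by rewrite invr_ge0 ltW.
rewrite mulrC; apply: ler_wpM2r; first exact: sqmod_ge0.
have -> : cexp ((2 * pi)%:C * w) * expi (2 * pi * y) = cexp l.
  by rewrite /l cexpD -expi_cexp mulrC.
by rewrite /rho -Rel; exact: sqmodB1_ge.
Qed.

Variable p : R.
Hypothesis p0 : 0 < p.

Lemma lattice_pole (w : C) : Re w != 0 -> exists B : R, forall y (n c : nat),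
  \sum_(k < n) sqmod (Complex (y + (k%:R - c%:R) * p) 0 - Complex 0 1 * w)^-1 <= B.
Proof.
move=> w0; have wp : Re ((p^-1)%:C * w) != 0.
  by rewrite Re_mulR mulf_neq0// invr_eq0 gt_eqF.
have [B hB] := lattice_pole1 wp; exists (p^-1 ^+ 2 * B) => y n c.
apply: le_trans (ler_wpM2l _ (hB (p^-1 * y) n c)); last exact: sqr_ge0.
rewrite mulr_sumr; apply: ler_sum => k _.
have -> : Complex (y + (k%:R - c%:R) * p) 0 - Complex 0 1 * w =
    p%:C * (Complex (p^-1 * y + (k%:R - c%:R)) 0 - Complex 0 1 * ((p^-1)%:C * w)).
  have pn : p != 0 by rewrite gt_eqF.
  by apply: complexP; rewrite !(cReM, cImM, cReD, cImD, cReN, cImN) /=; field.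
by rewrite invfM sqmodM (sqmodV p%:C) sqmodR exprVn.
Qed.

Variables (N : nat) (a w : 'I_N -> C).
Hypothesis w0 : forall j, Re (w j) != 0.
Let g := gfun a w.

Let pole_neq0 j (x : R) : Complex x 0 - Complex 0 1 * w j != 0.
Proof.
apply/eqP => /(congr1 (@complex.Im R)).
rewrite !(cReM, cImM, cReD, cImD, cReN, cImN)/= => /eqP.
by rewrite mul0r mul1r !add0r oppr_eq0 (negbTE (w0 _)).
Qed.

Let poleV_le j (x : R) : sqmod (Complex x 0 - Complex 0 1 * w j)^-1 <= (Re (w j) ^+ 2)^-1.
Proof.
have h0 : 0 < sqmod (Complex x 0 - Complex 0 1 * w j) by rewrite sqmod_gt0 pole_neq0.
rewrite sqmodV lef_pV2 ?posrE ?exprn_even_gt0 ?w0//.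
apply: le_trans (sqr_Im_le _).
rewrite !(cReM, cImM, cReD, cImD, cReN, cImN)/=.
by rewrite mul0r mul1r !add0r sqrrN.
Qed.

Lemma cmeas_gfun : cmeas g.
Proof.
apply: cmeas_sum => j; apply: cmeasM; first exact: cmeas_cst.
apply: cmeasV; apply: cmeasB; last exact: cmeas_cst.
exact: (cmeas_real (h := id)).
Qed.

Lemma gfun_lattice : exists B : R, forall y (n c : nat),
  \sum_(k < n) sqmod (g (y + (k%:R - c%:R) * p)) <= B.
Proof.
have /choice[B hB] : forall j, exists B : R, forall y (n c : nat),
    \sum_(k < n) sqmod (Complex (y + (k%:R - c%:R) * p) 0 - Complex 0 1 * w j)^-1 <= B.
  by move=> j; exact: lattice_pole.
exists (N%:R * \sum_j sqmod (a j) * B j) => y n c.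
apply: (@le_trans _ _ (\sum_(k < n) N%:R * \sum_j sqmod (a j) *
    sqmod (Complex (y + (k%:R - c%:R) * p) 0 - Complex 0 1 * w j)^-1)).
  apply: ler_sum => k _; apply: le_trans (sqmod_sum_le _ _) _.
  rewrite [index_enum _]unlock -enumT size_enum_ord; apply: ler_wpM2l => //.
  by apply: ler_sum => j _; rewrite sqmodM.
rewrite -mulr_sumr; apply: ler_wpM2l => //; rewrite exchange_big/=.
by apply: ler_sum => j _; rewrite -mulr_sumr; apply: ler_wpM2l; [exact: sqmod_ge0|exact: hB].
Qed.

(** The difference of two simple fractions is [z - y] times their product; one factor is bounded
    because the pole is off the real line, the other is square summable along the lattice. *)
Lemma gfun_lattice_lip : exists B : R, forall y z (n c : nat),
  \sum_(k < n) sqmod (g (y + (k%:R - c%:R) * p) - g (z + (k%:R - c%:R) * p)) <= B * (y - z) ^+ 2.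
Proof.
have /choice[B hB] : forall j, exists B : R, forall y (n c : nat),
    \sum_(k < n) sqmod (Complex (y + (k%:R - c%:R) * p) 0 - Complex 0 1 * w j)^-1 <= B.
  by move=> j; exact: lattice_pole.
exists (N%:R * \sum_j sqmod (a j) * (Re (w j) ^+ 2)^-1 * B j) => y z n c.
pose q j (x : R) := Complex x 0 - Complex 0 1 * w j.
apply: (@le_trans _ _ (\sum_(k < n) N%:R * \sum_j sqmod (a j) * (Re (w j) ^+ 2)^-1 * (y - z) ^+ 2 *
    sqmod (q j (y + (k%:R - c%:R) * p))^-1)).
  apply: ler_sum => k _; rewrite /g /gfun -sumrB; apply: le_trans (sqmod_sum_le _ _) _.
  rewrite [index_enum _]unlock -enumT size_enum_ord; apply: ler_wpM2l => //.
  apply: ler_sum => j _.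
  set y' := y + _; set z' := z + _.
  have -> : a j / (Complex y' 0 - Complex 0 1 * w j) - a j / (Complex z' 0 - Complex 0 1 * w j) =
      a j * (q j z')^-1 * (z - y)%:C * (q j y')^-1.
    have e : (z - y)%:C = q j z' - q j y'.
      apply: complexP; rewrite /q !(cReM, cImM, cReD, cImD, cReN, cImN)/= /y' /z'; ring.
    rewrite -/(q j y') -/(q j z') e.
    have : q j y' != 0 by exact: pole_neq0.
    have : q j z' != 0 by exact: pole_neq0.
    by move: (q j y') (q j z') => u v v0 u0; field; rewrite u0.
  rewrite !sqmodM; apply: ler_wpM2r; first exact: sqmod_ge0.
  rewrite sqmodR -(sqrrN (y - z)) opprB; apply: ler_wpM2r; first exact: sqr_ge0.
  by apply: ler_wpM2l; [exact: sqmod_ge0|exact: poleV_le].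
rewrite -mulr_sumr -mulrA; apply: ler_wpM2l => //; rewrite exchange_big/= mulr_suml.
apply: ler_sum => j _; rewrite -mulr_sumr [leRHS]mulrAC; apply: ler_wpM2l; last exact: hB.
apply: mulr_ge0; last exact: sqr_ge0.
by apply: mulr_ge0; [exact: sqmod_ge0|rewrite invr_ge0 sqr_ge0].
Qed.

Lemma L2_gfun : L2 g.
Proof.
apply/L2P; split; first exact: cmeas_gfun.
have [B hB] := gfun_lattice.
apply: (@le_lt_trans _ _ (B%:E * p%:E)%E); last by rewrite -EFinM ltry.
apply: (@le_nnint_cells R 0 p _ _ p0) => [x||n]; first exact: sqmod_ge0.
  by apply: measurable_sqmod; exact: cmeas_gfun.
rewrite add0r; apply: (@le_trans _ _ (nnint `[0, p[ (cst B))).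
  apply: le_nnint => //.
  - by move=> x _; apply: sumr_ge0 => k _; exact: sqmod_ge0.
  - apply: measurable_sum => k; apply: measurable_sqmod; apply: cmeas_shift.
    exact: cmeas_gfun.
  - by move=> x _; rewrite big_mkord; exact: hB.
by rewrite nnint_cst// lebesgue_measure_itv/= lte_fin p0 -EFinB subr0.
Qed.

End LatticeSums.

(** * Gabor systems with alpha beta <= 1 *)

Section Sufficiency.
Variable R : realType.
Local Notation C := R[i].
Local Notation mu := (@lebesgue_measure R).
Local Open Scope classical_set_scope.

Variables (r : nat) (a w : 'I_r.+1 -> C) (alpha beta : R).
Hypothesis a0 : forall j, a j != 0.
Hypothesis w0 : forall j, Re (w j) != 0.
Hypothesis wd : forall j k, j != k -> Re (w j) != Re (w k).
Hypothesis alpha0 : 0 < alpha.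
Hypothesis beta0 : 0 < beta.
Hypothesis ab1 : alpha * beta <= 1.

Let p := beta^-1.
Let g := gfun a w.
Let p0 : 0 < p. Proof. by rewrite invr_gt0. Qed.
Let pn0 : p != 0. Proof. by rewrite gt_eqF. Qed.
Let bn0 : beta != 0. Proof. by rewrite gt_eqF. Qed.

Definition shift_comb (s : seq (int * C)) (x : R) : C :=
  \sum_(q <- s) q.2 * g (x - alpha * q.1%:~R).

(** Closeness in l^2 on the fiber [t + p Z] to the delta at [t], stated on all finite windows of [n]
    points starting at [t - c p]; the index of [t] itself is [c]. *)
Definition delta_comb (s : seq (int * C)) (t eta : R) := forall n c : nat,
  \sum_(k < n) sqmod (shift_comb s (t + (k%:R - c%:R) * p) - (k == c :> nat)%:R) <= eta.

(** Dilation by [beta] keeps the form of [g] and turns the steps [p] and [alpha] into 1 and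
    [alpha * beta]. *)
Let gfun_scale (x : R) :
  gfun (fun j => beta%:C * a j) (fun j => beta%:C * w j) (beta * x) = g x.
Proof.
apply: eq_bigr => j _.
have -> : Complex (beta * x) 0 - Complex 0 1 * (beta%:C * w j) =
    beta%:C * (Complex x 0 - Complex 0 1 * w j).
  by apply: complexP; rewrite !(cReM, cImM, cReD, cImD, cReN, cImN) /=; ring.
have b0 : beta%:C != 0 :> C by rewrite fmorph_eq0.
by rewrite invfM mulrACA divff// mul1r.
Qed.

(** A combination with error [eta / 4] at [t0] keeps error [eta] nearby, as its restriction to the
    fiber is Lipschitz in [t] for the l^2 norm. This openness is what the compactness argument
    needs. *)
Lemma delta_comb_near (t0 eta : R) : 0 < eta -> exists s, exists2 d, 0 < d &
  forall t, `|t - t0| < d -> delta_comb s t eta.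
Proof.
move=> e0; have e4 : 0 < eta / 4 by rewrite divr_gt0.
have b0 : beta%:C != 0 :> C by rewrite fmorph_eq0.
have [s hs] : exists s, delta_comb s t0 (eta / 4).
  have ab0 : 0 < alpha * beta by rewrite mulr_gt0.
  have [|||s hs] := @fiber_claim R r (fun j => beta%:C * a j) (fun j => beta%:C * w j)
      (alpha * beta) (beta * t0) _ _ _ ab0 ab1 _ e4.
  - by move=> j; rewrite mulf_neq0.
  - by move=> j; rewrite Re_mulR mulf_neq0.
  - by move=> j k jk; rewrite !Re_mulR (inj_eq (mulfI bn0)) wd.
  exists s => n c; apply: le_trans (hs n c); rewrite le_eqVlt; apply/orP; left; apply/eqP.
  apply: eq_bigr => k _; congr (sqmod (_ - _)); apply: eq_bigr => q _; congr (_ * _).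
  rewrite -gfun_scale; congr (gfun _ _ _); rewrite /p; field.
  exact: bn0.
have [B hB] := gfun_lattice_lip p0 a w0.
have B0 : 0 <= B.
  have := hB 1 0 0%N 0%N; rewrite big_ord0 subr0 expr1n mulr1; exact.
pose Q := (size s)%:R * (\sum_(q <- s) sqmod q.2 * B).
have Q0 : 0 <= Q.
  by apply: mulr_ge0 => //; apply: sumr_ge0 => q _; rewrite mulr_ge0 ?sqmod_ge0.
have lip t n c : \sum_(k < n) sqmod (shift_comb s (t + (k%:R - c%:R) * p) -
    shift_comb s (t0 + (k%:R - c%:R) * p)) <= Q * (t - t0) ^+ 2.
  apply: (@le_trans _ _ (\sum_(k < n) (size s)%:R * \sum_(q <- s) sqmod q.2 *
      sqmod (g ((t - alpha * q.1%:~R) + (k%:R - c%:R) * p) - g ((t0 - alpha * q.1%:~R) + (k%:R - c%:R) * p)))).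
    apply: ler_sum => k _; rewrite /shift_comb -sumrB; apply: le_trans (sqmod_sum_le _ _) _.
    apply: ler_wpM2l => //; apply: ler_sum => q _.
    by rewrite -mulrBr sqmodM !(addrAC _ (_ * p)).
  rewrite -mulr_sumr -mulrA; apply: ler_wpM2l => //; rewrite exchange_big/= mulr_suml.
  apply: ler_sum => q _; rewrite -mulr_sumr -mulrA; apply: ler_wpM2l; first exact: sqmod_ge0.
  apply: le_trans (hB _ _ _ _) _; rewrite le_eqVlt; apply/orP; left; apply/eqP.
  by congr (_ * _ ^+ 2); ring.
have Q1 : 0 < Q + 1 by rewrite ltr_wpDl.
exists s, (Num.sqrt (eta / 4 / (Q + 1))); first by rewrite sqrtr_gt0 divr_gt0.
move=> t ht n c.
have ht2 : (t - t0) ^+ 2 <= eta / 4 / (Q + 1).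
  have pos0 : 0 <= eta / 4 / (Q + 1) by rewrite ltW// divr_gt0.
  rewrite -(sqr_sqrtr pos0) -(real_normK (num_real (t - t0))).
  by rewrite ler_sqr ?nnegrE ?sqrtr_ge0// ltW.
apply: (@le_trans _ _ (\sum_(k < n) (2 * sqmod (shift_comb s (t + (k%:R - c%:R) * p) -
    shift_comb s (t0 + (k%:R - c%:R) * p)) + 2 * sqmod (shift_comb s (t0 + (k%:R - c%:R) * p) - (k == c :> nat)%:R)))).
  apply: ler_sum => k _; apply: le_trans (sqmodD_le _ _).
  by rewrite addrA subrK.
rewrite big_split/= -!mulr_sumr.
have h1 := lip t n c; have h2 := hs n c.
have h3 : Q * (t - t0) ^+ 2 <= eta / 4.
  apply: (@le_trans _ _ ((Q + 1) * (eta / 4 / (Q + 1)))).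
    by apply: ler_pM => //; [exact: sqr_ge0|rewrite lerDl].
  by rewrite mulrC divfK// gt_eqF.
lra.
Qed.

Definition gabor_approx (h : R -> C) := forall eps, 0 < eps -> exists s,
  (n2 setT (fun x => h x - lincomb (gabor g alpha beta) s x)%R < eps%:E)%E.

Let cmeas_g : cmeas g. Proof. exact: cmeas_gfun. Qed.

Lemma cmeas_lincomb s : cmeas (lincomb (gabor g alpha beta) s).
Proof.
apply: cmeas_sum => q; apply: cmeasM; first exact: cmeas_cst.
by apply: cmeasM; [exact: cmeas_expi|exact: (cmeas_shift (f := g))].
Qed.

Lemma gabor_approx_close h : cmeas h ->
  (forall eps, 0 < eps -> exists h', [/\ cmeas h', gabor_approx h' &
    (n2 setT (fun x => h x - h' x)%R < eps%:E)%E]) -> gabor_approx h.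
Proof.
move=> mh H eps e0; have e4 : 0 < eps / 4 by rewrite divr_gt0.
have [h' [mh' ah' hh']] := H _ e4; have [s hs] := ah' _ e4; exists s.
rewrite (_ : n2 _ _ = n2 setT (fun x => (h x - h' x) + (h' x - lincomb (gabor g alpha beta) s x))); last first.
  by apply: eq_n2 => x _; ring.
apply: le_lt_trans (n2D_le _ _ _) _ => //.
- exact: cmeasB.
- by apply: cmeasB => //; exact: cmeas_lincomb.
apply: (@lt_le_trans _ _ (2%:E * (eps / 4)%:E + 2%:E * (eps / 4)%:E)%E).
  by apply: lteD; rewrite lte_pmul2l.
by rewrite -!EFinM -EFinD lee_fin; lra.
Qed.

Lemma gabor_approx0 : gabor_approx (fun=> 0).
Proof.
move=> eps e0; exists [::]; rewrite (_ : n2 _ _ = 0%E) ?lte_fin//.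
rewrite /n2 (eq_nnint (G := cst 0)) ?nnint_cst ?mul0e// => x _.
by rewrite /lincomb big_nil subr0 sqmod0.
Qed.

Lemma gabor_approxD f h : cmeas f -> cmeas h ->
  gabor_approx f -> gabor_approx h -> gabor_approx (fun x => f x + h x).
Proof.
move=> mf mh hf hh eps e0.
have e4 : 0 < eps / 4 by rewrite divr_gt0.
have [s hs] := hf _ e4; have [t ht] := hh _ e4.
exists (s ++ t).
rewrite (_ : n2 _ _ = n2 setT (fun x => (f x - lincomb (gabor g alpha beta) s x) +
   (h x - lincomb (gabor g alpha beta) t x))); last first.
  by apply: eq_n2 => x _; rewrite /lincomb big_cat/=; ring.
apply: le_lt_trans (n2D_le _ _ _) _ => //.
- by apply: cmeasB => //; exact: cmeas_lincomb.
- by apply: cmeasB => //; exact: cmeas_lincomb.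
apply: (@lt_le_trans _ _ (2%:E * (eps / 4)%:E + 2%:E * (eps / 4)%:E)%E).
  by apply: lteD; rewrite lte_pmul2l.
by rewrite -!EFinM -EFinD lee_fin; lra.
Qed.

Lemma gabor_approx_sum I (s : seq I) (F : I -> R -> C) :
  (forall i, cmeas (F i)) -> (forall i, gabor_approx (F i)) ->
  gabor_approx (fun x => \sum_(i <- s) F i x).
Proof.
move=> mF hF; elim: s => [|i s IH].
  by under eq_fun do rewrite big_nil; exact: gabor_approx0.
under eq_fun do rewrite big_cons.
by apply: gabor_approxD => //; exact: cmeas_sum.
Qed.

Let periodic_int (d : R -> C) : (forall y, d (y + p) = d y) ->
  forall y (l n : nat), d (y + (l%:R - n%:R) * p) = d y.
Proof.
move=> pd; have pdn n y : d (y + n%:R * p) = d y.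
  elim: n => [|n IH]; first by rewrite mul0r addr0.
  by rewrite -natr1 mulrDl mul1r addrA pd.
move=> y l n; rewrite -(pdn n) -(pdn l y); congr d; ring.
Qed.

(** With a trigonometric polynomial in place of [b] the product is a combination of Gabor atoms, as
    [p^-1 = beta]. The polynomial approximates [b] on one cell; the uniform bound on the fiber sums
    of [g] controls the error on the whole line. *)
Lemma gabor_approx_periodic b K (c : C) (m : int) : cmeas b -> (forall y, sqmod (b y) <= K) ->
  (forall y, b (y + p) = b y) -> gabor_approx (fun x => b x * (c * g (x - alpha * m%:~R))).
Proof.
move=> mb bK pb eps e0.
have [B hB] := gfun_lattice p0 a w0.
have B0 : 0 <= B by have := hB 0 0%N 0%N; rewrite big_ord0.
have cB0 : 0 <= sqmod c * B by rewrite mulr_ge0// sqmod_ge0.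
have cB1 : 0 < sqmod c * B + 1 by rewrite ltr_wpDl.
have eta0 : 0 < eps / (sqmod c * B + 1) by rewrite divr_gt0.
have [s hs] := trig_dense 0 p0 mb bK eta0.
exists [seq ((m, q.1), c * q.2) | q <- s].
pose d x := b x - trig_eval p s x.
have md : cmeas d by apply: cmeasB => //; exact: cmeas_trig.
have pd y : d (y + p) = d y.
  rewrite /d pb; congr (_ - _); apply: eq_bigr => q _; congr (_ * _).
  have -> : 2 * pi * p^-1 * q.1%:~R * (y + p) = 2 * pi * p^-1 * q.1%:~R * y + 2 * pi * q.1%:~R.
    by field.
  by rewrite expiD expi_2piz mulr1.
rewrite (_ : n2 _ _ = n2 setT (fun x => d x * (c * g (x - alpha * m%:~R)))); last first.
  apply: eq_n2 => x _; rewrite /d mulrBl; congr (_ - _).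
  rewrite /lincomb big_map mulr_suml; apply: eq_bigr => q _ /=.
  by rewrite /gabor /p invrK; ring.
apply: (@le_lt_trans _ _ ((sqmod c * B)%:E * n2 `[0%R, (0 + p)%R[ d)%E).
  apply: (@le_nnint_cells R 0 p _ _ p0) => [x||n]; first exact: sqmod_ge0.
    apply: measurable_sqmod; apply: cmeasM => //; apply: cmeasM; first exact: cmeas_cst.
    exact: (cmeas_shift (f := g)).
  rewrite -nnintZ//; last 2 first.
  - by move=> x; exact: sqmod_ge0.
  - exact: measurable_sqmod.
  apply: le_nnint => //.
  - by move=> x _; apply: sumr_ge0 => k _; exact: sqmod_ge0.
  - apply: measurable_sum => k; apply: measurable_sqmod.
    apply: (cmeas_shift (f := fun x => d x * (c * g (x - alpha * m%:~R)))).
    apply: cmeasM => //; apply: cmeasM; first exact: cmeas_cst.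
    exact: (cmeas_shift (f := g)).
  - by apply: measurable_funM => //; exact: measurable_sqmod.
  move=> x _; rewrite big_mkord.
  under eq_bigr do rewrite periodic_int// !sqmodM addrAC.
  rewrite -mulr_sumr mulrC; apply: ler_wpM2r; first exact: sqmod_ge0.
  by rewrite -mulr_sumr; apply: ler_wpM2l; [exact: sqmod_ge0|exact: hB].
apply: (@le_lt_trans _ _ ((sqmod c * B)%:E * (eps / (sqmod c * B + 1))%:E)%E).
  by apply: lee_wpmul2l; [rewrite lee_fin|exact: ltW].
rewrite -EFinM lte_fin mulrA ltr_pdivrMr// mulrC ltr_pM2l// ltrDl//.
Qed.

Lemma cmeas_comb s : cmeas (shift_comb s).
Proof.
by apply: cmeas_sum => q; apply: cmeasM; [exact: cmeas_cst|exact: (cmeas_shift (f := g))].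
Qed.

Lemma gabor_approx_periodic_comb b K s : cmeas b -> (forall y, sqmod (b y) <= K) ->
  (forall y, b (y + p) = b y) -> gabor_approx (fun x => b x * shift_comb s x).
Proof.
move=> mb bK pb; under eq_fun do rewrite mulr_sumr.
apply: gabor_approx_sum => q.
  apply: cmeasM => //; apply: cmeasM; first exact: cmeas_cst.
  exact: (cmeas_shift (f := g)).
exact: gabor_approx_periodic bK pb.
Qed.

Section Cell.
Variable u : R.

Let per (x : R) : R := u + p * fold 1 ((x - u) / p).

Let measurable_per : measurable_fun setT per.
Proof.
apply: measurable_funD => //; apply: measurable_funM => //.
apply: (measurableT_comp (measurable_fold 1)).
by apply: measurable_funM => //; exact: measurable_funB.
Qed.

Let perD x : per (x + p) = per x.
Proof.
rewrite /per (_ : (x + p - u) / p = (x - u) / p + 1); last by field.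
by rewrite foldD.
Qed.

Let per_id x : u <= x < u + p -> per x = x.
Proof.
move=> /andP[h1 h2]; rewrite /per fold_id//; first by field.
by rewrite divr_ge0 ?subr_ge0 ?(ltW p0)//= ltr_pdivrMr// mul1r ltrBlDl.
Qed.

Let per_cell x (l n : nat) : u <= x < u + p -> per (x + (l%:R - n%:R) * p) = x.
Proof.
move=> hx; have H y (k : nat) : per (y + k%:R * p) = per y.
  elim: k => [|k IH]; first by rewrite mul0r addr0.
  by rewrite -natr1 mulrDl mul1r addrA perD.
rewrite -(H _ n) -[RHS](per_id hx) -(H x l); congr per; ring.
Qed.

(* The vanishing of [F] on the fibers where [f x = 0] lets the induction treat the
   intervals one at a time, each acting on what the previous ones left out. *)
Lemma patch_combs (ts : seq (seq (int * C) * (R * R))) f K :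
  cmeas f -> (forall x, sqmod (f x) <= K) ->
  exists F, [/\ cmeas F, gabor_approx F & forall x, u <= x < u + p ->
    (f x = 0 -> forall l n : nat, F (x + (l%:R - n%:R) * p) = 0) /\
    ((exists2 t, t \in ts & t.2.1 < x < t.2.2) ->
      exists t, [/\ t \in ts, t.2.1 < x < t.2.2 & forall l n : nat,
        F (x + (l%:R - n%:R) * p) = f x * shift_comb t.1 (x + (l%:R - n%:R) * p)])].
Proof.
elim: ts f => [|t ts IH] f mf fK.
  exists (fun=> 0); split; first exact: cmeas_cst.
    exact: gabor_approx0.
  by move=> x _; split => // -[].
pose U := [set x : R | t.2.1 < x < t.2.2].
have mU : measurable U.
  rewrite (_ : U = `]t.2.1, t.2.2[); first exact: measurable_itv.
  by apply/seteqP; split => x /=; rewrite in_itv.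
have K0 : 0 <= K by apply: le_trans (fK 0); exact: sqmod_ge0.
have indK (A : set R) x : sqmod ((\1_A x)%:C * f x) <= K.
  rewrite sqmodM sqmodR indicE; case: (_ \in _); rewrite ?expr1n ?mul1r//.
  by rewrite expr0n mul0r.
have mind (A : set R) : measurable A -> cmeas (fun x => (\1_A x)%:C * f x).
  by move=> mA; apply: cmeasM => //; exact: cmeas_indic.
have [F [mF aF hF]] := IH (fun x => (\1_(~` U) x)%:C * f x) (mind _ (measurableC mU)) (indK _).
pose b x := (\1_U (per x))%:C * f (per x).
have mb : cmeas b.
  by apply: (cmeas_comp (f := fun x => (\1_U x)%:C * f x)) => //; exact: mind.
have bper l n x : u <= x < u + p -> b (x + (l%:R - n%:R) * p) = (\1_U x)%:C * f x.
  by move=> hx; rewrite /b per_cell.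
exists (fun x => b x * shift_comb t.1 x + F x); split.
- by apply: cmeasD => //; apply: cmeasM => //; exact: cmeas_comb.
- apply: gabor_approxD => //.
    by apply: cmeasM => //; exact: cmeas_comb.
  apply: (gabor_approx_periodic_comb (K := K)) => //.
    by move=> y; exact: indK.
  by move=> y; rewrite /b perD.
move=> x hx; have [F0 F1] := hF x hx; split.
  by move=> fx l n; rewrite bper// fx mulr0 mul0r add0r F0// fx mulr0.
have [xU|xU] := boolP (x \in U).
  move=> _; exists t; split; first by rewrite mem_head.
    by rewrite inE in xU.
  move=> l n; rewrite bper// indicE xU mul1r F0 ?addr0//.
  by rewrite indicE in_setC xU mul0r.
move=> [t' t't xt'].
have t'ts : t' \in ts.
  move: t't; rewrite in_cons => /orP[/eqP tt|//].
  by move: xU; rewrite notin_setE /U /= -tt xt'.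
have [|s [sts sx hs]] := F1; first by exists t'.
exists s; split => //; first by rewrite in_cons sts orbT.
move=> l n; rewrite bper// hs indicE (negbTE xU) mul0r mul0r add0r.
by rewrite indicE in_setC xU mul1r.
Qed.

(** On the fiber through [x], [f] is [f x] times a delta and [F] is [f x] times a combination within
    [eta] of that delta. Each fiber therefore contributes at most [K * eta] to the squared error,
    however many cells are taken. *)
Lemma gabor_approx_cell f K : cmeas f -> (forall x, sqmod (f x) <= K) ->
  (forall x, ~~ (u <= x < u + p) -> f x = 0) -> gabor_approx f.
Proof.
move=> mf fK f0; apply: gabor_approx_close => // eps e0.
have K0 : 0 <= K by apply: le_trans (fK 0); exact: sqmod_ge0.
have K1 : 0 < K + 1 by rewrite ltr_wpDl.
pose eta := eps / ((K + 1) * p).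
have eta0 : 0 < eta by rewrite divr_gt0// mulr_gt0.
have /choice[sd hsd] : forall t0 : R, exists sd : seq (int * C) * R, 0 < sd.2 /\
    forall t, `|t - t0| < sd.2 -> delta_comb sd.1 t eta.
  by move=> t0; have [s [d d0 hd]] := delta_comb_near t0 eta0; exists (s, d).
have [D _ hD] : finite_subset_cover [set: R] (fun t0 : R => ball t0 (sd t0).2) `[u, u + p].
  have /(_ u (u + p)) := @segment_compact R; rewrite compact_cover; apply.
    by move=> t0 _; exact: ball_open.
  by move=> t0 _; exists t0 => //; apply: ballxx; exact: (hsd t0).1.
pose ts := [seq ((sd t0).1, (t0 - (sd t0).2, t0 + (sd t0).2)) | t0 <- finmap.enum_fset D].
have [F [mF aF hF]] := patch_combs ts mf fK; exists F; split => //.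
have pt x : u <= x < u + p -> exists s, delta_comb s x eta /\ forall l n : nat,
    F (x + (l%:R - n%:R) * p) = f x * shift_comb s (x + (l%:R - n%:R) * p).
  move=> hx; have [_ [|t [/mapP[t0 _ ->] /= ht ft]]] := hF x hx.
    have [|t0 t0D xt0] := hD x.
      by rewrite /= in_itv/=; case/andP: hx => -> /= /ltW.
    exists ((sd t0).1, (t0 - (sd t0).2, t0 + (sd t0).2)).
      by apply/mapP; exists t0.
    by move: xt0 => /=; rewrite -ball_normE /ball_/= ltr_distlC.
  exists (sd t0).1; split => //; apply: (hsd t0).2.
  by rewrite ltr_distl.
apply: (@le_lt_trans _ _ ((K * eta)%:E * p%:E)%E); last first.
  rewrite -EFinM lte_fin -[ltRHS](_ : (K + 1) * eta * p = eps); last first.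
    by rewrite /eta; field; rewrite pn0 gt_eqF.
  by rewrite ltr_pM2r// ltr_pM2r// ltrDl.
apply: (@le_nnint_cells R u p _ _ p0) => [x||n]; first exact: sqmod_ge0.
  by apply: measurable_sqmod; exact: cmeasB.
apply: (@le_trans _ _ (nnint `[u, (u + p)%R[ (cst (K * eta)))); last first.
  by rewrite nnint_cst// lebesgue_measure_itv/= lte_fin ltrDl p0 -EFinB (addrAC u) subrr add0r.
apply: le_nnint => //.
- by move=> x _; apply: sumr_ge0 => k _; exact: sqmod_ge0.
- apply: measurable_sum => k; apply: measurable_sqmod.
  by apply: (cmeas_shift (f := fun x => f x - F x)); exact: cmeasB.
move=> x /=; rewrite in_itv/= => hx; rewrite big_mkord.
have [s [ds Fs]] := pt x hx.
apply: (@le_trans _ _ (\sum_(k < n + n) sqmod (f x) *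
   sqmod (shift_comb s (x + (k%:R - n%:R) * p) - (k == n :> nat)%:R))).
  apply: ler_sum => k _; rewrite Fs -sqmodM -sqmodN.
  rewrite (_ : f (x + (k%:R - n%:R) * p) = f x * (k == n :> nat)%:R).
    by rewrite -mulrBr -mulrN opprB.
  case: eqP => [->|/eqP kn]; first by rewrite subrr mul0r addr0 mulr1.
  rewrite mulr0 f0//.
  case/andP: hx => hx1 hx2; rewrite negb_and -leNgt -ltNge; apply/orP.
  have [kn'|kn'] := ltnP k n; [left|right].
    have h : k%:R + 1 <= n%:R :> R by rewrite natr1 ler_nat.
    have : (k%:R - n%:R) * p <= -1 * p by apply: ler_wpM2r; [exact: ltW|lra].
    lra.
  have h : n%:R + 1 <= k%:R :> R by rewrite natr1 ler_nat ltn_neqAle eq_sym kn.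
  have : 1 * p <= (k%:R - n%:R) * p by apply: ler_wpM2r; [exact: ltW|lra].
  lra.
rewrite -mulr_sumr; apply: ler_pM => //; first exact: sqmod_ge0.
by apply: sumr_ge0 => k _; exact: sqmod_ge0.
Qed.

End Cell.
End Sufficiency.

Section Density.
Variable R : realType.
Local Notation C := R[i].
Local Notation mu := (@lebesgue_measure R).
Local Open Scope classical_set_scope.

Variables (r : nat) (a w : 'I_r.+1 -> C) (alpha beta : R).
Hypothesis a0 : forall j, a j != 0.
Hypothesis w0 : forall j, Re (w j) != 0.
Hypothesis wd : forall j k, j != k -> Re (w j) != Re (w k).
Hypothesis alpha0 : 0 < alpha.
Hypothesis beta0 : 0 < beta.
Hypothesis ab1 : alpha * beta <= 1.

Let p := beta^-1.
Let p0 : 0 < p. Proof. by rewrite invr_gt0. Qed.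

Lemma gabor_approx_bounded_support n u f K : cmeas f -> (forall x, sqmod (f x) <= K) ->
  (forall x, ~~ (u <= x < u + n%:R * p) -> f x = 0) -> gabor_approx a w alpha beta f.
Proof.
elim: n u f => [|n IH] u f mf fK f0.
  rewrite (_ : f = fun=> 0); first exact: gabor_approx0.
  apply/funext => x; apply: f0; rewrite mul0r addr0; apply/negP => /andP[h1].
  by rewrite ltNge h1.
have K0 : 0 <= K by apply: le_trans (fK 0); exact: sqmod_ge0.
have indK (A : set R) x : sqmod ((\1_A x)%:C * f x) <= K.
  rewrite sqmodM sqmodR indicE; case: (_ \in _); rewrite ?expr1n ?mul1r//.
  by rewrite expr0n mul0r.
pose A : set R := `[u, u + p[.
have mA : measurable A by exact: measurable_itv.
have mind (B : set R) : measurable B -> cmeas (fun x => (\1_B x)%:C * f x).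
  by move=> mB; apply: cmeasM => //; exact: cmeas_indic.
have inA x : (x \in A) = (u <= x < u + p).
  by apply/idP/idP => [/set_mem|h]; [|apply/mem_set]; rewrite /A /= in_itv.
rewrite (_ : f = fun x => (\1_A x)%:C * f x + (\1_(~` A) x)%:C * f x); last first.
  apply/funext => x; rewrite -mulrDl -rmorphD/= !indicE in_setC.
  by case: (x \in A); rewrite ?addr0 ?add0r mul1r.
apply: gabor_approxD; [exact: mind|apply: mind; exact: measurableC| |].
  apply: (gabor_approx_cell a0 w0 wd alpha0 beta0 ab1 (u := u)) => [|x|x hx].
  - exact: mind.
  - exact: (indK A x).
  - by rewrite indicE inA (negbTE hx) mul0r.
apply: (IH (u + p)) => [|x|x hx].
- by apply: mind; exact: measurableC.
- exact: indK.
rewrite indicE in_setC inA; case: (boolP (u <= x < u + p)) => h; first by rewrite mul0r.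
rewrite f0 ?mulr0//; apply: contra hx => /andP[h1 h2].
move: h; rewrite h1/= -leNgt => -> /=.
by move: h2; rewrite -natr1 mulrDl mul1r (addrAC u) -addrA.
Qed.

Lemma gabor_complete : complete_L2 (gabor (gfun a w) alpha beta).
Proof.
move=> f /L2P[mf ff]; suff : gabor_approx a w alpha beta f by [].
apply: gabor_approx_close => // eps e0.
(* Truncation in height and in support at once; every point lies in [E n] for large [n], and the
   remainder is dominated by [f]. *)
pose E (n : nat) := [set x : R | sqmod (f x) <= n%:R] `&` `[(- (n%:R * p))%R, (n%:R * p)%R[.
have mE n : measurable (E n).
  apply: measurableI => //; rewrite -[X in measurable X]setTI.
  by apply: measurable_fun_le => //; exact: measurable_sqmod.
pose h n x := (\1_(E n) x)%:C * f x.
have mh n : cmeas (h n) by apply: cmeasM => //; exact: cmeas_indic.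
have fh n x : sqmod (f x - h n x) <= sqmod (f x).
  rewrite /h indicE; case: (_ \in _); last by rewrite mul0r subr0.
  by rewrite mul1r subrr sqmod0 sqmod_ge0.
have [n hn] : exists n, (nnint setT (fun x => sqmod (f x - h n x)%R) < eps%:E)%E.
  apply: (nnint_dominated_small (G := fun x => sqmod (f x))) => //.
  - by move=> n; apply: measurable_sqmod; exact: cmeasB.
  - exact: measurable_sqmod.
  - by move=> n x; exact: sqmod_ge0.
  move=> x _; apply: cvg_near_cst.
  pose n0 := (Num.truncn (Num.max (sqmod (f x)) (`|x| / p))).+1.
  have hm : Num.max (sqmod (f x)) (`|x| / p) < n0%:R by exact: truncnS_gt.
  exists n0 => // n /= nn.
  have : Num.max (sqmod (f x)) (`|x| / p) < n%:R.
    by apply: lt_le_trans hm _; rewrite ler_nat.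
  rewrite gt_max ltr_pdivrMr// => /andP[h1 h2].
  rewrite /h indicE mem_set ?mul1r ?subrr ?sqmod0//; split; first exact: ltW.
  by rewrite /= in_itv/=; move: h2; rewrite ltr_norml => /andP[/ltW -> ->].
exists (h n); split => //.
apply: (@gabor_approx_bounded_support (n + n) (- (n%:R * p)) (h n) n%:R) => // x.
  rewrite /h indicE; case: (boolP (x \in E n)) => [/set_mem[h1 _]|_]; first by rewrite mul1r.
  by rewrite mul0r sqmod0 ler0n.
move=> hx; rewrite /h indicE; case: (boolP (x \in E n)) => [/set_mem[_]|]; last by rewrite mul0r.
rewrite /= in_itv/= => /andP[h1 h2]; move: hx; rewrite h1/= natrD mulrDl addrA addNr add0r.
by rewrite h2.
Qed.

End Density.

(** [0 < N] makes explicit that the sum defining [g] is nonempty: the system generated by [g = 0] is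
    never complete. *)
Theorem theorem1p9 (R : realType) (N : nat) (a w : 'I_N -> R[i]) :
  (0 < N)%N ->
  (forall k, a k != 0) ->
  (forall k, complex.Re (w k) != 0) ->
  (forall k l, k != l -> complex.Re (w k) != complex.Re (w l)) ->
  forall alpha beta : R, 0 < alpha -> 0 < beta ->
  (complete_L2 (gabor (gfun a w) alpha beta) <-> alpha * beta <= 1).
Proof.
case: N a w => // r a w _ a0 w0 wd alpha beta alpha0 beta0; split => [cp|ab1].
  rewrite leNgt; apply/negP => ab1.
  exact: (gabor_incomplete (L2_gfun ltr01 a w0) alpha0 beta0 ab1 cp).
exact: gabor_complete.
Qed.
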